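(* Over a discrete field $\mathbf{k}$, the structure of a graded symmetric Frobenius algebra is equivalent to that of a biunital coFrobenius bialgebra.
   Context: **Tate vector spaces.** $\mathbf{k}$ is a field with the discrete topology. A linearly topologized vector space is a $\mathbf{k}$-vector space with a Hausdorff translation-invariant topology having a neighbourhood basis of $0$ consisting of open linear subspaces; morphisms are continuous linear maps. Its completion is $\widehat A=\varprojlim_U A/U$ ($U$ ranging over open linear subspaces, each $A/U$ discrete, limit topologized inside the product); $A$ is complete if $A\to\widehat A$ is an isomorphism. $A$ is linearly compact if it is complete and $\dim A/U<\infty$ for every open linear subspace $U$; $A$ is Tate if it is complete and has an open linearly compact subspace. The dual $A^\vee=\mathrm{Hom}(A,\mathbf{k})$ (continuous linear maps) has neighbourhood basis of $0$ given by the annihilators $L^\perp$, $L\subset A$ linearly compact. On the algebraic tensor product $A\otimes B$: a linear subspace $Q$ is open in the $*$ topology iff (i) $U\otimes V\subset Q$ for some open linear $U\subset A,V\subset B$, (ii) for each $a\in A$ there is an open linear $V\subset B$ with $a\otimes V\subset Q$, (iii) for each $b\in B$ there is an open linear $U\subset A$ with $U\otimes b\subset Q$; it is open in the $!$ topology iff $U\otimes B+A\otimes V\subset Q$ for some open linear $U\subset A,V\subset B$. The completions are denoted $A\hat\otimes^*B$ and $A\hat\otimes^!B$. **Graded version.** A graded Tate vector space is $A=\bigoplus_{i\in\mathbb{Z}}A_i$ with each $A_i$ Tate; a homogeneous map of degree $k$ is a collection of continuous linear maps $A_i\to B_{i+k}$, and all maps and elements considered are homogeneous, with degree denoted $|\cdot|$.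 $A^\vee=\bigoplus_i A^\vee_i$, $A_i^\vee=\mathrm{Hom}(A_{-i},\mathbf{k})$. $(A\otimes^*B)_k=\bigoplus_{i+j=k}A_i\hat\otimes^*B_j$ and $(A\otimes^!B)_k=\prod_{i+j=k}A_i\hat\otimes^!B_j$. Both are commutative and associative up to canonical isomorphism, and the identity induces canonical continuous maps $A\otimes^*B\to A\otimes^!B$ and $A\otimes^*(B\otimes^!C)\to(A\otimes^*B)\otimes^!C$, which are inserted tacitly in compositions. **Signs.** $1$ is the identity map; $(\varphi\otimes\psi)(a\otimes b)=(-1)^{|\psi||a|}\varphi(a)\otimes\psi(b)$; $\tau(a\otimes b)=(-1)^{|a||b|}b\otimes a$; elements are viewed as maps from $\mathbf{k}$. A product is a map $\mu:A\otimes^*A\to A$; it is associative if $\mu(\mu\otimes1)=(-1)^{|\mu|}\mu(1\otimes\mu)$; $\eta\in A$ is a unit if $(-1)^{|\mu|}\mu(\eta\otimes1)=1=\mu(1\otimes\eta)$. A coproduct is a map $\lambda:A\to A\otimes^!A$; it is coassociative if $(\lambda\otimes1)\lambda=(-1)^{|\lambda|}(1\otimes\lambda)\lambda$; $\varepsilon:A\to\mathbf{k}$ is a counit if $(\varepsilon\otimes1)\lambda=1=(-1)^{|\lambda|}(1\otimes\varepsilon)\lambda$. **Biunital coFrobenius bialgebra.** A graded Tate vector space $A$ endowed with a product $\mu:A\otimes^*A\to A$, a coproduct $\lambda:A\to A\otimes^!A$, and elements $\eta\in A$, $\varepsilon\in A^\vee$, such that $\mu$ is associative with unit $\eta$, $\lambda$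 is coassociative with counit $\varepsilon$, and, with copairing $c=(-1)^{|\lambda||\mu|+|\mu|}\lambda\eta\in A\otimes^!A$ and pairing $p=(-1)^{|\lambda|}\varepsilon\mu:A\otimes^*A\to\mathbf{k}$, $\lambda=(1\otimes\mu)(c\otimes1)=(-1)^{|\mu|}(\mu\otimes1)(1\otimes c)$, $\mu=(-1)^{|\mu||\lambda|+|\lambda|}(p\otimes1)(1\otimes\lambda)=(-1)^{|\mu||\lambda|}(1\otimes p)(\lambda\otimes1)$, $\tau c=(-1)^{|\lambda|}c$ and $p\tau=(-1)^{|\mu|}p$. **Graded symmetric Frobenius algebra.** $(A,\mu,\eta,\varepsilon)$ consisting of a graded Tate vector space $A$, a degree zero associative product $\mu:A\otimes^*A\to A$ with unit $\eta$, and a linear map $\varepsilon:A\to\mathbf{k}$ such that: (i) the pairing $p=(-1)^{|\varepsilon|}\varepsilon\mu:A\otimes^*A\to\mathbf{k}$ is perfect, i.e. the map $\vec p:A\to A^\vee$, $\vec p(a)(b)=p(a\otimes b)$, is a topological isomorphism; (ii) the triple product $p(\mu\otimes1):A\otimes^*A\otimes^*A\to\mathbf{k}$ is cyclically symmetric, i.e. $p(\mu\otimes1)\sigma=p(\mu\otimes1)$ for $\sigma(a\otimes b\otimes c)=(-1)^{(|a|+|b|)|c|}c\otimes a\otimes b$. *)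

(* Defs.v *)
From HB Require Import structures.
From mathcomp Require Import all_boot all_order all_algebra.
From mathcomp Require Import generic_quotient ring_quotient.
From mathcomp Require Import boolp classical_sets functions.
From mathcomp Require Import topology_structure separation_axioms.

Set Implicit Arguments.
Unset Strict Implicit.
Unset Printing Implicit Defensive.

Import GRing.Theory.
Local Open Scope classical_set_scope.
Local Open Scope quotient_scope.
Local Open Scope ring_scope.

Section Subspaces.
Variables (k : fieldType) (V : lmodType k).

Record lsubspace := Subspace {
  subspace_set :> set V;
  subspace0 : subspace_set 0;
  subspaceP : forall (a : k) (x y : V),
    subspace_set x -> subspace_set y -> subspace_set (a *: x + y) }.

Definition subspace_mem (W : lsubspace) : V -> Prop := subspace_set W.
Coercion subspace_mem : lsubspace >-> Funclass.

Lemma zero_sub0 : [set (0 : V)] 0. Proof. by []. Qed.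
Lemma zero_subP (a : k) (x y : V) :
  [set (0 : V)] x -> [set (0 : V)] y -> [set (0 : V)] (a *: x + y).
Proof. by move=> /= -> ->; rewrite scaler0 addr0. Qed.
Definition zero_sub := Subspace zero_sub0 zero_subP.

Definition full_sub :=
  @Subspace setT I (fun _ _ _ _ _ => I).

Lemma cap_subP (U W : lsubspace) (a : k) (x y : V) :
  (U `&` W) x -> (U `&` W) y -> (U `&` W) (a *: x + y).
Proof. by move=> [? ?] [? ?]; split; exact: subspaceP. Qed.
Definition cap_sub (U W : lsubspace) :=
  @Subspace (U `&` W) (conj (subspace0 U) (subspace0 W)) (@cap_subP U W).

Definition span_set (X : set V) : set V :=
  [set x | forall U : lsubspace, X `<=` U -> U x].
Lemma span_sub0 (X : set V) : span_set X 0.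
Proof. by move=> U _; exact: subspace0. Qed.
Lemma span_subP (X : set V) (a : k) (x y : V) :
  span_set X x -> span_set X y -> span_set X (a *: x + y).
Proof. by move=> Hx Hy U XU; apply: subspaceP; [exact: Hx|exact: Hy]. Qed.
Definition span_sub (X : set V) := Subspace (@span_sub0 X) (@span_subP X).

Definition sub_pred (W : lsubspace) : {pred V} := fun x => `[< W x >].

Lemma sub_predE (W : lsubspace) x : (x \in sub_pred W) = `[< W x >].
Proof. by []. Qed.

Lemma sub_pred_submod (W : lsubspace) : submod_closed (sub_pred W).
Proof.
split=> [|a x y]; rewrite !sub_predE; first by apply/asboolP/subspace0.
by move=> /asboolP Wx /asboolP Wy; apply/asboolP/subspaceP.
Qed.

HB.instance Definition _ (W : lsubspace) :=
  GRing.isSubmodClosed.Build k V (sub_pred W) (sub_pred_submod W).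

Definition subsp (W : lsubspace) : Type := {x : V | x \in sub_pred W}.

HB.instance Definition _ (W : lsubspace) := SubChoice.on (subsp W).
HB.instance Definition _ (W : lsubspace) :=
  [SubChoice_isSubLmodule of subsp W by <:].

Definition mk_subsp (W : lsubspace) (x : V) (Wx : W x) : subsp W :=
  exist _ x (asboolT Wx).

Definition quo (W : lsubspace) : Type := Quotient.quot (sub_pred W).
HB.instance Definition _ (W : lsubspace) := GRing.Zmodule.on (quo W).

Definition quo_pi (W : lsubspace) (x : V) : quo W :=
  \pi_(Quotient.quot (sub_pred W)) x.
Definition quo_scale (W : lsubspace) (a : k) (x : quo W) : quo W :=
  quo_pi W (a *: repr (x : Quotient.quot (sub_pred W))).

Lemma quo_piP (W : lsubspace) (x y : V) :
  quo_pi W x = quo_pi W y <-> W (x - y).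
Proof.
rewrite /quo_pi; split.
  by move/eqP; rewrite -Quotient.idealrBE => /asboolP.
by move=> Wxy; apply/eqP; rewrite -Quotient.idealrBE; apply/asboolP.
Qed.

Lemma quo_pi_repr (W : lsubspace) (x : quo W) :
  quo_pi W (repr (x : Quotient.quot (sub_pred W))) = x.
Proof. exact: reprK. Qed.

Lemma quo_piD (W : lsubspace) (x y : V) :
  quo_pi W (x + y) = quo_pi W x + quo_pi W y.
Proof. by rewrite /quo_pi -[RHS]Quotient.pi_add. Qed.

Lemma quo_piZ (W : lsubspace) (a : k) (x : V) :
  quo_pi W (a *: x) = quo_scale a (quo_pi W x).
Proof.
apply/quo_piP; rewrite -scalerBr -[_ *: _]addr0.
apply: subspaceP; last exact: subspace0.
by apply/quo_piP; rewrite quo_pi_repr.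
Qed.

Lemma quo_pi0 (W : lsubspace) : quo_pi W 0 = 0.
Proof. by apply: (addrI (quo_pi W 0)); rewrite -quo_piD !addr0. Qed.

Lemma quo_scaleA (W : lsubspace) (a b : k) (v : quo W) :
  quo_scale a (quo_scale b v) = quo_scale (a * b) v.
Proof. by rewrite -[v]quo_pi_repr -!quo_piZ scalerA. Qed.
Lemma quo_scale1 (W : lsubspace) : left_id 1 (@quo_scale W).
Proof. by move=> v; rewrite -[v]quo_pi_repr -!quo_piZ scale1r. Qed.
Lemma quo_scaleDr (W : lsubspace) : right_distributive (@quo_scale W) +%R.
Proof.
move=> a u v; rewrite -[u]quo_pi_repr -[v]quo_pi_repr.
by rewrite -quo_piD -!quo_piZ -quo_piD scalerDr.
Qed.
Lemma quo_scaleDl (W : lsubspace) v :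
  {morph (@quo_scale W)^~ v : a b / a + b}.
Proof.
by move=> a b; rewrite -[v]quo_pi_repr -!quo_piZ -quo_piD scalerDl.
Qed.

HB.instance Definition _ (W : lsubspace) :=
  GRing.Zmodule_isLmodule.Build k (quo W)
    (@quo_scaleA W) (@quo_scale1 W) (@quo_scaleDr W) (@quo_scaleDl W).

End Subspaces.

Section DependentProduct.
Variables (k : fieldType) (I : Type) (M : I -> lmodType k).

Definition dprod : Type := forall i, M i.
HB.instance Definition _ := gen_eqMixin dprod.
HB.instance Definition _ := gen_choiceMixin dprod.

Definition dprod_zero : dprod := fun=> 0.
Definition dprod_opp (x : dprod) : dprod := fun i => - x i.
Definition dprod_add (x y : dprod) : dprod := fun i => x i + y i.
Definition dprod_scale (a : k) (x : dprod) : dprod := fun i => a *: x i.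

Lemma dprod_addA : associative dprod_add.
Proof. by move=> x y z; apply/functional_extensionality_dep => i; exact: addrA. Qed.
Lemma dprod_addC : commutative dprod_add.
Proof. by move=> x y; apply/functional_extensionality_dep => i; exact: addrC. Qed.
Lemma dprod_add0 : left_id dprod_zero dprod_add.
Proof. by move=> x; apply/functional_extensionality_dep => i; exact: add0r. Qed.
Lemma dprod_addN : left_inverse dprod_zero dprod_opp dprod_add.
Proof. by move=> x; apply/functional_extensionality_dep => i; exact: addNr. Qed.
HB.instance Definition _ := GRing.isZmodule.Build dprod
  dprod_addA dprod_addC dprod_add0 dprod_addN.

Lemma dprod_scaleA (a b : k) (x : dprod) :
  dprod_scale a (dprod_scale b x) = dprod_scale (a * b) x.
Proof. by apply/functional_extensionality_dep => i; exact: scalerA. Qed.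
Lemma dprod_scale1 : left_id 1 dprod_scale.
Proof. by move=> x; apply/functional_extensionality_dep => i; exact: scale1r. Qed.
Lemma dprod_scaleDr : right_distributive dprod_scale +%R.
Proof. by move=> a x y; apply/functional_extensionality_dep => i; exact: scalerDr. Qed.
Lemma dprod_scaleDl (x : dprod) : {morph dprod_scale^~ x : a b / a + b}.
Proof. by move=> a b; apply/functional_extensionality_dep => i; exact: scalerDl. Qed.
HB.instance Definition _ := GRing.Zmodule_isLmodule.Build k dprod
  dprod_scaleA dprod_scale1 dprod_scaleDr dprod_scaleDl.

End DependentProduct.

Section FiniteSupport.
Variables (k : fieldType) (I : eqType) (M : I -> lmodType k).

Definition fin_supp : set (dprod M) :=
  [set x | exists s : seq I, forall i, i \notin s -> x i = 0].
Lemma fin_supp0 : fin_supp 0.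
Proof. by exists [::]. Qed.
Lemma fin_suppP (a : k) (x y : dprod M) :
  fin_supp x -> fin_supp y -> fin_supp (a *: x + y).
Proof.
move=> [s xs] [t yt]; exists (s ++ t) => i; rewrite mem_cat negb_or.
by case/andP=> /xs xi0 /yt yi0; rewrite -[LHS]/(a *: x i + y i) xi0 yi0 scaler0 addr0.
Qed.
Definition fin_supp_sub := Subspace fin_supp0 fin_suppP.

Definition dsum : Type := subsp fin_supp_sub.
HB.instance Definition _ := GRing.Lmodule.on dsum.

Definition single (i : I) (x : M i) : dprod M := dfwith (0 : dprod M) x.
Lemma single_fin_supp (i : I) (x : M i) : fin_supp (single x).
Proof.
by exists [:: i] => j; rewrite inE eq_sym => ij; rewrite /single dfwith_out.
Qed.
Definition dsum_in (i : I) (x : M i) : dsum :=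
  @mk_subsp k _ fin_supp_sub _ (single_fin_supp x).

End FiniteSupport.

Section TensorProduct.
Variables (k : fieldType) (V W : lmodType k).

(* the vector space with basis V * W *)
Definition free_pairs := dsum (fun _ : V * W => (k^o : lmodType k)).
Definition basis_pair (v : V) (w : W) : free_pairs :=
  dsum_in (M := fun _ => (k^o : lmodType k)) (i := (v, w)) 1.

Inductive bilin_rel : set free_pairs :=
| bilin_addl v v' w :
    bilin_rel (basis_pair (v + v') w - basis_pair v w - basis_pair v' w)
| bilin_addr v w w' :
    bilin_rel (basis_pair v (w + w') - basis_pair v w - basis_pair v w')
| bilin_scalel a v w : bilin_rel (basis_pair (a *: v) w - a *: basis_pair v w)
| bilin_scaler a v w : bilin_rel (basis_pair v (a *: w) - a *: basis_pair v w).

Definition tensor : Type := quo (span_sub bilin_rel).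
HB.instance Definition _ := GRing.Lmodule.on tensor.

Definition tens (v : V) (w : W) : tensor :=
  quo_pi (span_sub bilin_rel) (basis_pair v w).

End TensorProduct.

HB.structure Definition TopLmodule (k : fieldType) :=
  {V of GRing.Lmodule k V & Topological V}.

(* Hausdorffness is not part of this structure: it is required in [tate] and is
   automatic for completions.  The discrete topology of the field [k] plays no
   role beyond the requirement that scalings by constants be continuous. *)
HB.mixin Record isLinearTopology (k : fieldType) V & TopLmodule k V := {
  nbhs_translate : forall (x : V) (S : set V),
    nbhs x S <-> nbhs (0 : V) [set v | S (x + v)];
  nbhs0_lsubspace : forall S : set V, nbhs (0 : V) S ->
    exists U : lsubspace V, open (U : set V) /\ U `<=` S }.

#[short(type="linTopType")]
HB.structure Definition LinTop (k : fieldType) :=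
  {V of TopLmodule k V & isLinearTopology k V}.

(* The linear topology on V whose neighbourhoods of 0 are the supersets of the
   finite intersections of members of B (B is a subbasis of linear subspaces,
   carried as a phantom argument of the type). *)
Definition gen_lintop (k : fieldType) (V : lmodType k)
  (B : set (lsubspace V)) : Type := V.

Section GeneratedTopology.
Variables (k : fieldType) (V : lmodType k) (B : set (lsubspace V)).

Local Notation gen_lintop := (gen_lintop B).

Inductive meets : set (lsubspace V) :=
| meets_full : meets (full_sub V)
| meets_cap U W : B U -> meets W -> meets (cap_sub U W).

HB.instance Definition _ := GRing.Lmodule.on gen_lintop.

Definition gen_nbhs (x : gen_lintop) : set_system gen_lintop :=
  [set S | exists2 U, meets U & forall u, U u -> S (x + u)].
HB.instance Definition _ := hasNbhs.Build gen_lintop gen_nbhs.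

Lemma meets_capP U W : meets U -> meets W ->
  exists2 X, meets X & (X `<=` U `&` W).
Proof.
move=> mU mW; elim: mU => [|U' U'' BU' _ [X mX XUW]]; first by exists W.
exists (cap_sub U' X); first exact: meets_cap.
by move=> x [U'x /XUW[]].
Qed.

Lemma gen_nbhs_proper (x : gen_lintop) : ProperFilter (nbhs x).
Proof.
apply: Build_ProperFilter_ex => [S [U _ US]|].
  by exists (x + 0); apply: US; exact: subspace0.
split.
- by exists (full_sub V) => //; exact: meets_full.
- move=> S T [U mU US] [W mW WT]; have [X mX XUW] := meets_capP mU mW.
  by exists X => // u /XUW[Uu Wu]; split; [exact: US|exact: WT].
- by move=> S T ST [U mU US]; exists U => // u /US/ST.
Qed.

Lemma gen_nbhs_singleton (x : gen_lintop) (S : set gen_lintop) :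
  nbhs x S -> S x.
Proof. by move=> [U _ US]; rewrite -[x]addr0; apply: US; exact: subspace0. Qed.

Lemma gen_nbhs_nbhs (x : gen_lintop) (S : set gen_lintop) :
  nbhs x S -> nbhs x (nbhs^~ S).
Proof.
move=> [U mU US]; exists U => // u Uu; exists U => // v Uv; rewrite -addrA.
by apply: US; rewrite -[u]scale1r; exact: subspaceP.
Qed.

HB.instance Definition _ := Nbhs_isNbhsTopological.Build gen_lintop
  gen_nbhs_proper gen_nbhs_singleton gen_nbhs_nbhs.

Lemma gen_nbhs_translate (x : gen_lintop) (S : set gen_lintop) :
  nbhs x S <-> nbhs (0 : gen_lintop) [set v | S (x + v)].
Proof.
by split=> -[U mU US]; exists U => // u /US; rewrite /= add0r.
Qed.

Lemma gen_nbhs0_lsubspace (S : set gen_lintop) : nbhs (0 : gen_lintop) S ->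
  exists U : lsubspace gen_lintop, open (U : set gen_lintop) /\ U `<=` S.
Proof.
move=> [U mU US].
exists (@Subspace k gen_lintop U (subspace0 U) (@subspaceP k V U)).
split; last by move=> u /US; rewrite add0r.
rewrite openE => u Uu; exists U => // v Uv.
by rewrite -[u]scale1r; exact: (subspaceP 1 Uu Uv).
Qed.

HB.instance Definition _ := isLinearTopology.Build k gen_lintop
  gen_nbhs_translate gen_nbhs0_lsubspace.

Lemma gen_openP (U : lsubspace V) :
  open (U : set gen_lintop) <-> exists2 W, meets W & (W `<=` U).
Proof.
split=> [oU|[W mW WU]].
  have [W mW WU] : nbhs (0 : gen_lintop) U.
    by apply: open_nbhs_nbhs; split=> //; exact: subspace0.
  by exists W => // w /WU; rewrite add0r.
rewrite openE => u Uu; exists W => // v /WU Uv.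
by rewrite -[u]scale1r; exact: (subspaceP 1 Uu Uv).
Qed.

End GeneratedTopology.

Section Morphisms.
Variables (k : fieldType) (A B : linTopType k).

Definition cont_linear : set (A -> B) := [set f | linear f /\ continuous f].

Lemma linear_continuousP (f : A -> B) : linear f ->
  continuous f <-> forall S, nbhs (0 : B) S -> nbhs (0 : A) (f @^-1` S).
Proof.
move=> lf.
have fD x y : f (x + y) = f x + f y by rewrite -[x in LHS]scale1r lf scale1r.
have f0 : f 0 = 0 by apply: (addrI (f 0)); rewrite -fD !addr0.
split=> [cf S S0|cf x S].
  by apply: (cf 0 S); rewrite f0.
rewrite nbhs_translate => /cf Sx; apply/nbhs_translate.
by apply: filterS Sx => v /=; rewrite fD.
Qed.

Lemma cont_linear0 : cont_linear 0.
Proof.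
split; first by move=> a x y; rewrite -[LHS]/(0 : B) scaler0 addr0.
exact: (@cst_continuous A B 0).
Qed.

Lemma cont_linearP (a : k) (f g : A -> B) :
  cont_linear f -> cont_linear g -> cont_linear (a *: f + g).
Proof.
move=> [lf cf] [lg cg].
have lfg : linear (a *: f + g).
  move=> b x y; rewrite -[LHS]/(a *: f (b *: x + y) + g (b *: x + y)).
  rewrite -[(a *: f + g) x]/(a *: f x + g x) -[(a *: f + g) y]/(a *: f y + g y).
  by rewrite lf lg !scalerDr !scalerA [a * b]mulrC addrACA.
split=> //; apply/(linear_continuousP lfg) => S /nbhs0_lsubspace[U [oU US]].
have U0 : nbhs (0 : B) U by apply: open_nbhs_nbhs; split=> //; exact: subspace0.
have fU := (linear_continuousP lf).1 cf _ U0.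
have gU := (linear_continuousP lg).1 cg _ U0.
by apply: filterS2 fU gU => x fx gx; apply: US; exact: (subspaceP a fx gx).
Qed.

Definition cont_linear_sub : lsubspace (A -> B) :=
  Subspace cont_linear0 cont_linearP.

Definition chom : Type := subsp cont_linear_sub.
HB.instance Definition _ := GRing.Lmodule.on chom.

Definition chom_fun (f : chom) : A -> B :=
  val (f : {x : A -> B | x \in sub_pred cont_linear_sub}).
Coercion chom_fun : chom >-> Funclass.

Lemma chomP (f : chom) : cont_linear f.
Proof. by apply/asboolP; exact: (valP (f : {x | x \in sub_pred cont_linear_sub})). Qed.

Definition mk_chom (f : A -> B) (Hf : cont_linear f) : chom :=
  @mk_subsp k _ cont_linear_sub f Hf.

Definition topological_iso (f : A -> B) :=
  [/\ linear f, continuous f &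
      exists g : B -> A, [/\ cancel f g, cancel g f & continuous g]].

(* "The" continuous linear map satisfying P.  It is only used with formulas
   prescribing the values on (iterated) pure tensors of elements of complete
   spaces; pure tensors span a dense subspace of a completed tensor product, so
   that such a map, which exists in all the cases below, is unique. *)
Definition the_chom (P : set chom) : chom := xget 0 P.

End Morphisms.

Section Composition.
Variables (k : fieldType) (A B C : linTopType k).

Lemma id_cont_linear : @cont_linear k A A id.
Proof. by split=> // x S. Qed.
Definition chom_id : chom A A := mk_chom id_cont_linear.

Lemma comp_cont_linear (g : chom B C) (f : chom A B) :
  cont_linear ((g : B -> C) \o (f : A -> B)).
Proof.
have [[lg cg] [lf cf]] := (chomP g, chomP f); split.
  by move=> a x y /=; rewrite lf lg.
by move=> x; apply: continuous_comp; [exact: cf|exact: cg].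
Qed.
Definition chom_comp (g : chom B C) (f : chom A B) : chom A C :=
  mk_chom (comp_cont_linear g f).
End Composition.

Section Constructions.
Variable k : fieldType.

(* the zero subspace is open *)
Definition discrete (V : lmodType k) : linTopType k :=
  gen_lintop [set zero_sub V].

(* product topology, generated by the cylinders *)
Definition prod_top (I : Type) (A : I -> linTopType k) : linTopType k :=
  @gen_lintop k (dprod (fun i => A i : lmodType k))
    [set W | exists i (U : lsubspace (A i)), open (U : set (A i)) /\
       W = [set x : dprod (fun i => A i : lmodType k) | U (x i)] :> set _].

Definition sub_top (A : linTopType k) (W : lsubspace A) : linTopType k :=
  @gen_lintop k (subsp W)
    [set X | exists U : lsubspace A, open (U : set A) /\
       X = [set x : subsp W | U (\val x)] :> set _].

(* direct sum topology: the finest linear topology making all inclusions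
   continuous *)
Definition sum_top (I : eqType) (A : I -> linTopType k) : linTopType k :=
  @gen_lintop k (dsum (fun i => A i : lmodType k))
    [set X | forall i, open [set a : A i |
       X (dsum_in (M := fun i => A i : lmodType k) a)]].

Section Completion.
Variable A : linTopType k.

Definition open_sub : Type := {U : lsubspace A | open (U : set A)}.

(* The product of all the discrete quotients A/U, U open; the completion is the
   subspace of the families compatible with the projections A/U -> A/U'. *)
Definition quotients : linTopType k :=
  prod_top (fun U : open_sub => discrete (quo (sval U))).

Definition compatible : set quotients :=
  [set x | forall (U U' : open_sub) (a : A),
     (sval U : set A) `<=` sval U' -> x U = quo_pi (sval U) a ->
     x U' = quo_pi (sval U') a].
Lemma compatible0 : compatible 0.
Proof.
move=> U U' a UU' Ha; rewrite -[LHS]/(0 : quo (sval U')) -quo_pi0.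
by apply/quo_piP/UU'/quo_piP; rewrite quo_pi0 -Ha.
Qed.
Lemma compatibleP (c : k) (x y : quotients) :
  compatible x -> compatible y -> compatible (c *: x + y).
Proof.
move=> cx cy U U' a UU'.
rewrite -[LHS]/(c *: (x U : quo (sval U)) + (y U : quo (sval U))).
rewrite -[X in _ -> X = _]/(c *: (x U' : quo (sval U')) + (y U' : quo (sval U'))).
have xU := esym (quo_pi_repr (x U)); have yU := esym (quo_pi_repr (y U)).
rewrite (cx _ _ _ UU' xU) (cy _ _ _ UU' yU) [in X in X -> _]xU [in X in X -> _]yU.
have scaleE (W : lsubspace A) v : c *: quo_pi W v = quo_pi W (c *: v).
  by rewrite quo_piZ.
by rewrite !scaleE -!quo_piD => /quo_piP/UU' ?; apply/quo_piP.
Qed.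
Definition compatible_sub := Subspace compatible0 compatibleP.

Definition completion : linTopType k := sub_top compatible_sub.

Lemma compatible_pi (a : A) : compatible (fun U => quo_pi (sval U) a).
Proof.
by move=> U U' b UU' /quo_piP Uab; apply/quo_piP; exact: UU'.
Qed.
Definition to_completion (a : A) : completion :=
  @mk_subsp k quotients compatible_sub _ (@compatible_pi a).

Definition complete := topological_iso to_completion.

End Completion.
End Constructions.

Section TateSpaces.
Variable k : fieldType.

Definition fin_dim (V : lmodType k) : Prop :=
  exists (n : nat) (e : 'I_n -> V),
    forall v, exists c : 'I_n -> k, v = \sum_(i < n) c i *: e i.

Definition lin_compact (A : linTopType k) : Prop :=
  complete A /\
  forall U : lsubspace A, open (U : set A) -> fin_dim (quo U).

Definition tate (A : linTopType k) : Prop :=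
  [/\ hausdorff_space A, complete A &
      exists L : lsubspace A, open (L : set A) /\ lin_compact (sub_top L)].

Definition scalars : linTopType k := discrete (k^o : lmodType k).

(* The annihilators of linearly compact subspaces form a neighbourhood basis of
   0 in the dual, as finite sums of linearly compact subspaces are linearly
   compact. *)
Definition dual (A : linTopType k) : linTopType k :=
  @gen_lintop k (chom A scalars)
    [set X | exists L : lsubspace A, lin_compact (sub_top L) /\
       X = [set f : chom A scalars | forall a, L a -> f a = 0] :> set _].

(* Q ranges over linear subspaces below, so it contains the span U (x) V iff it
   contains the tensors u (x) v.  Both families of subspaces are closed under
   finite intersections and under enlargement, so they are exactly the open
   subspaces of the topologies they generate. *)
Definition star_open (A B : linTopType k) (Q : set (tensor A B)) : Prop :=
  [/\ exists (U : lsubspace A) (V : lsubspace B),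
        [/\ open (U : set A), open (V : set B) &
            forall u v, U u -> V v -> Q (tens u v)],
      forall a, exists V : lsubspace B,
        open (V : set B) /\ forall v, V v -> Q (tens a v) &
      forall b, exists U : lsubspace A,
        open (U : set A) /\ forall u, U u -> Q (tens u b)].

Definition bang_open (A B : linTopType k) (Q : set (tensor A B)) : Prop :=
  exists (U : lsubspace A) (V : lsubspace B),
    [/\ open (U : set A), open (V : set B),
        forall u b, U u -> Q (tens u b) &
        forall a v, V v -> Q (tens a v)].

Definition star (A B : linTopType k) : linTopType k :=
  completion (@gen_lintop k (tensor A B) [set Q | star_open Q]).

Definition bang (A B : linTopType k) : linTopType k :=
  completion (@gen_lintop k (tensor A B) [set Q | bang_open Q]).

Definition star_tens (A B : linTopType k) (a : A) (b : B) : star A B :=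
  to_completion (tens a b : @gen_lintop k (tensor A B) [set Q | star_open Q]).

Definition bang_tens (A B : linTopType k) (a : A) (b : B) : bang A B :=
  to_completion (tens a b : @gen_lintop k (tensor A B) [set Q | bang_open Q]).

End TateSpaces.

Section Graded.
Variable k : fieldType.

(* A = \bigoplus_i A_i is represented by the family of its components. *)
Definition gspace : Type := int -> linTopType k.

Definition gtate (A : gspace) : Prop := forall i, tate (A i).

(* Homogeneous maps of degree d.  The target degree is a separate index equated
   to i + d, so that no transport is needed along identities between degrees;
   [geq] compares maps whose degrees are equal but written differently, and is
   meaningful only in that case. *)
Record ghom (A B : gspace) (d : int) := GHom {
  ghom_comp :> forall i j : int, i + d = j -> chom (A i) (B j) }.

Definition geq (A B : gspace) (d d' : int)
    (f : ghom A B d) (g : ghom A B d') : Prop :=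
  forall (i j : int) (e : i + d = j) (e' : i + d' = j), f i j e = g i j e'.

Definition gscale (A B : gspace) (d : int) (a : k) (f : ghom A B d) :
  ghom A B d := GHom (fun i j e => a *: f i j e).

Definition gcomp (A B C : gspace) (d d' : int)
    (g : ghom B C d') (f : ghom A B d) : ghom A C (d + d') :=
  GHom (fun i j e =>
    chom_comp (g (i + d) j (etrans (esym (addrA i d d')) e))
              (f i (i + d) erefl)).

Definition chom_cast (A : gspace) (i j : int) (e : i = j) : chom (A i) (A j) :=
  match e with erefl => chom_id (A i) end.

Definition gid (A : gspace) : ghom A A 0 :=
  GHom (fun i j e => chom_cast A (etrans (esym (addr0 i)) e)).

(* the field k as a graded space: k in degree 0 and 0 in the other degrees *)
Definition unit_set (i : int) : set k^o := [set x | i <> 0 -> x = 0].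
Lemma unit_set0 i : unit_set i 0. Proof. by []. Qed.
Lemma unit_setP i (a : k) (x y : k^o) :
  unit_set i x -> unit_set i y -> unit_set i (a *: x + y).
Proof. by move=> Hx Hy i0; rewrite Hx // Hy // scaler0 addr0. Qed.
Definition unit_sub i := Subspace (@unit_set0 i) (@unit_setP i).
Definition gunit : gspace := fun i => discrete (subsp (unit_sub i)).
Definition gunit1 : gunit 0 :=
  @mk_subsp k _ (unit_sub 0) 1 (fun H => False_ind _ (H erefl)).
Definition gunit_val (i : int) (x : gunit i) : k :=
  \val (x : subsp (unit_sub i)).

(* Elements of degree d of A are represented by maps k -> A of degree d, and
   elements of degree d of the graded dual by maps A -> k of degree d. *)
Definition gdual (A : gspace) : gspace := fun i => dual (A (- i)).

Definition bideg (n : int) : Type := {p : int * int | p.1 + p.2 == n}.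
HB.instance Definition _ n := Choice.on (bideg n).
Definition mk_bideg (i j n : int) (e : i + j = n) : bideg n :=
  exist _ (i, j) (introT eqP e).

(* (A [*] B)_n is the direct sum, and (A [!] B)_n the product, over i + j = n of the
   completed tensor products of A_i and B_j. *)
Definition gstar (A B : gspace) : gspace := fun n =>
  sum_top (fun p : bideg n => star (A (sval p).1) (B (sval p).2)).
Definition gbang (A B : gspace) : gspace := fun n =>
  prod_top (fun p : bideg n => bang (A (sval p).1) (B (sval p).2)).

Definition gstar_tens (A B : gspace) (i j n : int) (e : i + j = n)
    (a : A i) (b : B j) : gstar A B n :=
  @dsum_in k (bideg n) (fun p => star (A (sval p).1) (B (sval p).2))
    (mk_bideg e) (star_tens a b).
Definition gbang_tens (A B : gspace) (i j n : int) (e : i + j = n)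
    (a : A i) (b : B j) : gbang A B n :=
  @single k (bideg n) (fun p => bang (A (sval p).1) (B (sval p).2))
    (mk_bideg e) (bang_tens a b).

End Graded.

(* The Koszul sign rule, the symmetries, and the canonical maps, each given by
   its values on pure tensors. *)
Section TensorMaps.
Variable k : fieldType.
Implicit Types A B C : gspace k.

Definition gstar_map A A' B B' (d d' : int)
    (f : ghom A A' d) (g : ghom B B' d') :
    ghom (gstar A B) (gstar A' B') (d + d') :=
  GHom (fun n n' _ => the_chom [set h |
    forall (i j i' j' : int) (e : i + j = n) (e' : i' + j' = n')
      (ei : i + d = i') (ej : j + d' = j') (a : A i) (b : B j),
    h (gstar_tens e a b) =
      (-1) ^ (d' * i) *: gstar_tens e' (f i i' ei a) (g j j' ej b)]).

Definition gbang_map A A' B B' (d d' : int)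
    (f : ghom A A' d) (g : ghom B B' d') :
    ghom (gbang A B) (gbang A' B') (d + d') :=
  GHom (fun n n' _ => the_chom [set h |
    forall (i j i' j' : int) (e : i + j = n) (e' : i' + j' = n')
      (ei : i + d = i') (ej : j + d' = j') (a : A i) (b : B j),
    h (gbang_tens e a b) =
      (-1) ^ (d' * i) *: gbang_tens e' (f i i' ei a) (g j j' ej b)]).

Definition star_swap A B : ghom (gstar A B) (gstar B A) 0 :=
  GHom (fun n n' _ => the_chom [set h |
    forall (i j : int) (e : i + j = n) (e' : j + i = n') (a : A i) (b : B j),
    h (gstar_tens e a b) = (-1) ^ (i * j) *: gstar_tens e' b a]).

Definition bang_swap A B : ghom (gbang A B) (gbang B A) 0 :=
  GHom (fun n n' _ => the_chom [set h |
    forall (i j : int) (e : i + j = n) (e' : j + i = n') (a : A i) (b : B j),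
    h (gbang_tens e a b) = (-1) ^ (i * j) *: gbang_tens e' b a]).

Definition bang_assoc A B C :
    ghom (gbang (gbang A B) C) (gbang A (gbang B C)) 0 :=
  GHom (fun n n' _ => the_chom [set h |
    forall (i j l p q : int) (e1 : i + j = p) (e2 : p + l = n)
      (e3 : j + l = q) (e4 : i + q = n') (a : A i) (b : B j) (c : C l),
    h (gbang_tens e2 (gbang_tens e1 a b) c) =
      gbang_tens e4 a (gbang_tens e3 b c)]).

(* A [*] (B [!] C) -> (A [*] B) [!] C and (A [!] B) [*] C -> A [!] (B [*] C),
   induced by the identity of the algebraic tensor product *)
Definition star_bang A B C :
    ghom (gstar A (gbang B C)) (gbang (gstar A B) C) 0 :=
  GHom (fun n n' _ => the_chom [set h |
    forall (i j l p q : int) (e1 : j + l = q) (e2 : i + q = n)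
      (e3 : i + j = p) (e4 : p + l = n') (a : A i) (b : B j) (c : C l),
    h (gstar_tens e2 a (gbang_tens e1 b c)) =
      gbang_tens e4 (gstar_tens e3 a b) c]).

Definition bang_star A B C :
    ghom (gstar (gbang A B) C) (gbang A (gstar B C)) 0 :=
  GHom (fun n n' _ => the_chom [set h |
    forall (i j l p q : int) (e1 : i + j = p) (e2 : p + l = n)
      (e3 : j + l = q) (e4 : i + q = n') (a : A i) (b : B j) (c : C l),
    h (gstar_tens e2 (gbang_tens e1 a b) c) =
      gbang_tens e4 a (gstar_tens e3 b c)]).

(* k [*] A = A = A [*] k and k [!] A = A = A [!] k *)
Definition star_lunit A : ghom A (gstar (gunit k) A) 0 :=
  GHom (fun n n' _ => the_chom [set h |
    forall (e : 0 + n = n') (a : A n), h a = gstar_tens e (gunit1 k) a]).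
Definition star_runit A : ghom A (gstar A (gunit k)) 0 :=
  GHom (fun n n' _ => the_chom [set h |
    forall (e : n + 0 = n') (a : A n), h a = gstar_tens e a (gunit1 k)]).
Definition bang_lunit A : ghom (gbang (gunit k) A) A 0 :=
  GHom (fun n n' _ => the_chom [set h |
    forall (e : 0 + n' = n) (a : A n'), h (gbang_tens e (gunit1 k) a) = a]).
Definition bang_runit A : ghom (gbang A (gunit k)) A 0 :=
  GHom (fun n n' _ => the_chom [set h |
    forall (e : n' + 0 = n) (a : A n'), h (gbang_tens e a (gunit1 k)) = a]).

End TensorMaps.

Notation "g \og f" := (gcomp g f) (at level 50, left associativity).
Notation "f *og g" := (gstar_map f g) (at level 40, left associativity).
Notation "f !og g" := (gbang_map f g) (at level 40, left associativity).
Notation "a *g f" := (gscale a f) (at level 45, right associativity).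
Notation "f =g g" := (geq f g) (at level 70, no associativity).

Section Algebras.
Variables (k : fieldType) (A : gspace k).

(* mu (mu (x) 1) = (-1)^m mu (1 (x) mu).  The two sides are defined on the two
   bracketings of A [*] A [*] A; they are compared on the tensors a (x) b (x) c,
   which span a dense subspace of either. *)
Definition star_associative (m : int) (mu : ghom (gstar A A) A m) : Prop :=
  forall (i j l p q n n' : int) (e1 : i + j = p) (e2 : p + l = n)
    (e3 : j + l = q) (e4 : i + q = n)
    (e : n + (m + 0 + m) = n') (e' : n + (0 + m + m) = n')
    (a : A i) (b : A j) (c : A l),
  (mu \og (mu *og gid A)) n n' e (gstar_tens e2 (gstar_tens e1 a b) c) =
  (-1) ^ m *: (mu \og (gid A *og mu)) n n' e'
                 (gstar_tens e4 a (gstar_tens e3 b c)).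

Definition star_unit (m : int) (mu : ghom (gstar A A) A m)
    (eta : ghom (gunit k) A (- m)) : Prop :=
  (-1) ^ m *g (mu \og (eta *og gid A) \og star_lunit A) =g gid A /\
  mu \og (gid A *og eta) \og star_runit A =g gid A.

Definition bang_coassociative (l : int) (lam : ghom A (gbang A A) l) : Prop :=
  bang_assoc A A A \og (lam !og gid A) \og lam =g
  (-1) ^ l *g ((gid A !og lam) \og lam).

Definition bang_counit (l : int) (lam : ghom A (gbang A A) l)
    (eps : ghom A (gunit k) (- l)) : Prop :=
  bang_lunit A \og (eps !og gid A) \og lam =g gid A /\
  (-1) ^ l *g (bang_runit A \og (gid A !og eps) \og lam) =g gid A.

(* The degrees of the unit and of the counit are forced by the unit and counit
   equations. *)
Record cofrob_data (m l : int) := CoFrobData {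
  cofrob_mul : ghom (gstar A A) A m;
  cofrob_comul : ghom A (gbang A A) l;
  cofrob_unit : ghom (gunit k) A (- m);
  cofrob_counit : ghom A (gunit k) (- l) }.

Definition copairing (m l : int) (S : cofrob_data m l) :
    ghom (gunit k) (gbang A A) (- m + l) :=
  (-1) ^ (l * m + m) *g (cofrob_comul S \og cofrob_unit S).

Definition pairing (m l : int) (S : cofrob_data m l) :
    ghom (gstar A A) (gunit k) (m + - l) :=
  (-1) ^ l *g (cofrob_counit S \og cofrob_mul S).

Record is_cofrobenius (m l : int) (S : cofrob_data m l) : Prop := {
  cofrob_assoc : star_associative (cofrob_mul S);
  cofrob_unitP : star_unit (cofrob_mul S) (cofrob_unit S);
  cofrob_coassoc : bang_coassociative (cofrob_comul S);
  cofrob_counitP : bang_counit (cofrob_comul S) (cofrob_counit S);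
  cofrob_comul_l : cofrob_comul S =g
    (gid A !og cofrob_mul S) \og bang_star A A A
      \og (copairing S *og gid A) \og star_lunit A;
  cofrob_comul_r : cofrob_comul S =g
    (-1) ^ m *g ((cofrob_mul S !og gid A) \og star_bang A A A
      \og (gid A *og copairing S) \og star_runit A);
  cofrob_mul_l : cofrob_mul S =g
    (-1) ^ (m * l + l) *g (bang_lunit A \og (pairing S !og gid A)
      \og star_bang A A A \og (gid A *og cofrob_comul S));
  cofrob_mul_r : cofrob_mul S =g
    (-1) ^ (m * l) *g (bang_runit A \og (gid A !og pairing S)
      \og bang_star A A A \og (cofrob_comul S *og gid A));
  cofrob_copairing_sym :
    bang_swap A A \og copairing S =g (-1) ^ l *g copairing S;
  cofrob_pairing_sym :
    pairing S \og star_swap A A =g (-1) ^ m *g pairing S }.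

(* b has degree - j = - (i + d), so that a (x) b has degree n = - d and n' = 0. *)
Definition perfect (d : int) (p : ghom (gstar A A) (gunit k) d) : Prop :=
  exists P : ghom A (gdual A) d,
    (forall (i j n n' : int) (e : i + d = j) (e1 : i + - j = n) (e2 : n + d = n')
       (a : A i) (b : A (- j)),
       (P i j e a : chom (A (- j)) (scalars k)) b =
       gunit_val (p n n' e2 (gstar_tens e1 a b))) /\
    (forall (i j : int) (e : i + d = j), topological_iso (P i j e)).

(* t o sigma = t, evaluated on the tensors a (x) b (x) c, for
   sigma (a (x) b (x) c) = (-1)^((|a| + |b|) |c|) c (x) a (x) b *)
Definition cyclic (d : int)
    (t : ghom (gstar (gstar A A) A) (gunit k) d) : Prop :=
  forall (i j l p q n n' : int) (e1 : i + j = p) (e2 : p + l = n)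
    (e3 : l + i = q) (e4 : q + j = n) (e : n + d = n')
    (a : A i) (b : A j) (c : A l),
  (-1) ^ ((i + j) * l) *: t n n' e (gstar_tens e4 (gstar_tens e3 c a) b) =
  t n n' e (gstar_tens e2 (gstar_tens e1 a b) c).

Record frob_data (d : int) := FrobData {
  frob_mul : ghom (gstar A A) A 0;
  frob_unit : ghom (gunit k) A 0;
  frob_counit : ghom A (gunit k) d }.

Definition frob_pairing (d : int) (F : frob_data d) :
    ghom (gstar A A) (gunit k) (0 + d) :=
  (-1) ^ d *g (frob_counit F \og frob_mul F).

Record is_frobenius (d : int) (F : frob_data d) : Prop := {
  frob_assoc : star_associative (frob_mul F);
  frob_unitP : star_unit (frob_mul F) (frob_unit F);
  frob_perfect : perfect (frob_pairing F);
  frob_cyclic : cyclic (frob_pairing F \og (frob_mul F *og gid A)) }.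

Definition frob_of_cofrob (l : int) (S : cofrob_data 0 l) : frob_data (- l) :=
  FrobData (cofrob_mul S) (cofrob_unit S) (cofrob_counit S).

End Algebras.

(* The regrading s : A -> A' of degree m, A'_i = A_(i - m), turns a product of
   degree m on A into the degree zero product s mu (s (x) s)^-1 on A'. *)
Section Shift.
Variables (k : fieldType) (A : gspace k) (m : int).

Definition shift : gspace k := fun i => A (i - m).
Definition to_shift : ghom A shift m :=
  GHom (fun i j e => chom_cast A (canRL (addrK m) e)).

Definition shift_related (l : int) (S : cofrob_data A m l)
    (F : frob_data shift (- (l + m))) : Prop :=
  [/\ frob_mul F \og (to_shift *og to_shift) =g to_shift \og cofrob_mul S,
      frob_unit F =g to_shift \og cofrob_unit S &
      frob_counit F \og to_shift =g cofrob_counit S].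

End Shift.

(* Main.v *)
Require Import Defs.
From HB Require Import structures.
From mathcomp Require Import all_boot all_order all_algebra.
From mathcomp Require Import generic_quotient ring_quotient.
From mathcomp Require Import boolp classical_sets functions.
From mathcomp Require Import topology_structure separation_axioms.
From mathcomp Require Import zify.
Import GRing.Theory.
Set Implicit Arguments.
Unset Strict Implicit.
Unset Printing Implicit Defensive.
Local Open Scope ring_scope.

(** The coproduct of a coFrobenius bialgebra is the transpose of the product for
    the pairing, so it is determined by the product, the unit and the counit; and
    conversely such a transpose exists as soon as the pairing is perfect.  The
    proof makes this precise for completed tensor products by reducing all the
    axioms to identities between elements.

    For products of any degree [m], [elt_frobenius] collects associativity, the
    unit laws, graded symmetry and perfectness of the form [eps (a b)], and
    [comul_adjoint] says that slicing [lam b] by the functional [eps (a -)] gives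
    [a b] up to sign.  Two facts about [A [!] B], for [A] and [B] complete, replace
    the finite-dimensional duality between [A (x) B] and [Hom (A^v, B)].  An element
    is determined by its slices by the functionals on [A] ([slice_separated]); and
    if [A] is Tate, the continuous maps from the dual of [A] to [B] are exactly those
    given by slicing an element ([slice_chom] and [slices_surjective]).  When the
    form is perfect every functional is some [eps (a -)], so an identity between
    values of composites of [lam] and [mu] can be tested on slices
    ([form_slices_ext]), where it becomes an identity between iterated products; the
    exponents of the signs are compared modulo 2.

    From a coFrobenius bialgebra ([cofrobenius_elt]): the relation
    [mu = (p (x) 1)(1 (x) lam)], up to sign, is [comul_adjoint].  Slicing [lam eta]
    inverts the pairing, and by [slice_chom] it does so continuously on the dual.

    Towards a coFrobenius bialgebra: the slices of the copairing have to be the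
    inverse of the pairing, and [slices_surjective] yields an element with these
    slices ([copairing_exists]).  Then [lam = (1 (x) mu)(c (x) 1)] is the required
    coproduct ([comul_exists]), the only one ([comul_unique]), and all the other
    axioms follow by slicing ([elt_cofrobenius]); coassociativity, for instance, is
    the transpose of associativity.

    In degree zero, [elt_frobenius] is the definition of a symmetric Frobenius
    algebra ([frobenius_eltP]): cyclicity of the triple product amounts to symmetry
    of the form, and the map [a |-> p (a, -)] into the dual is continuous because a
    linearly compact subspace is finite-dimensional modulo any open one
    ([pairing_chom]).  In degree [m], the regrading multiplies the product
    by the sign [(-1)^(m |a|)] and transports each condition of [elt_frobenius]
    ([elt_frobenius_shifted]).

    All the structural maps are specified by their values on pure tensors, so that
    their existence has to be proved before they can be evaluated.  This needs the
    universal properties of the completed tensor products and, for the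
    associativity of the graded [!]-product, an infinite sum ([bang_assocE]). *)

(** * Open subspaces of a linear topology *)

Section SubspaceClosure.
Variables (k : fieldType) (V : lmodType k) (U : lsubspace V).

Lemma lsubD x y : U x -> U y -> U (x + y).
Proof. by move=> Ux Uy; rewrite -[x]scale1r; apply: subspaceP. Qed.

Lemma lsubZ a x : U x -> U (a *: x).
Proof. by move=> Ux; rewrite -[_ *: _]addr0; apply: subspaceP => //; apply: subspace0. Qed.

Lemma lsubN x : U x -> U (- x).
Proof. by rewrite -scaleN1r; apply: lsubZ. Qed.

Lemma lsubB x y : U x -> U y -> U (x - y).
Proof. by move=> Ux Uy; apply: lsubD => //; apply: lsubN. Qed.

Lemma lsub_sum I (r : seq I) (P : pred I) (F : I -> V) :
  (forall i, P i -> U (F i)) -> U (\sum_(i <- r | P i) F i).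
Proof.
move=> UF; elim/big_rec: _ => [|i x Pi Ux]; first exact: subspace0.
by apply: lsubD => //; apply: UF.
Qed.

Lemma lsubBC x y : U (x - y) -> U (y - x).
Proof. by move=> /lsubN; rewrite opprB. Qed.

Lemma lsub_trans y x z : U (x - y) -> U (y - z) -> U (x - z).
Proof. by move=> xy yz; have := lsubD xy yz; rewrite addrA subrK. Qed.

Lemma lsub_shift x y : U (x - y) -> U y -> U x.
Proof. by move=> xy /(lsubD xy); rewrite subrK. Qed.

End SubspaceClosure.

Section LinearMaps.
Variables (k : fieldType) (V W : lmodType k) (f : V -> W).
Hypothesis lf : linear f.

Lemma linfD x y : f (x + y) = f x + f y.
Proof. by rewrite -[x in LHS]scale1r lf scale1r. Qed.

Lemma linf0 : f 0 = 0.
Proof. by apply: (addrI (f 0)); rewrite -linfD !addr0. Qed.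

Lemma linfZ a x : f (a *: x) = a *: f x.
Proof. by rewrite -[a *: x]addr0 lf linf0 addr0. Qed.

Lemma linfN x : f (- x) = - f x.
Proof. by rewrite -scaleN1r linfZ scaleN1r. Qed.

Lemma linfB x y : f (x - y) = f x - f y.
Proof. by rewrite linfD linfN. Qed.

Lemma linf_sum I (r : seq I) (P : pred I) (F : I -> V) :
  f (\sum_(i <- r | P i) F i) = \sum_(i <- r | P i) f (F i).
Proof. by apply: (big_morph f linfD linf0). Qed.

Definition preim_sub (U : lsubspace W) : lsubspace V.
Proof.
exists (fun x => U (f x)); first by rewrite linf0; apply: subspace0.
by move=> a x y Ux Uy; rewrite lf; apply: subspaceP.
Defined.

End LinearMaps.

Section OpenSubspaces.
Variables (k : fieldType) (A : linTopType k).
Implicit Types U V : lsubspace A.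

Lemma open_nbhs0 U : open (U : set A) -> nbhs (0 : A) (U : set A).
Proof. by move=> oU; apply: open_nbhs_nbhs; split=> //; apply: subspace0. Qed.

Lemma nbhs0_open U : nbhs (0 : A) (U : set A) -> open (U : set A).
Proof.
move=> nU; rewrite openE => u Uu; apply/nbhs_translate.
by apply: filterS nU => v Uv; apply: lsubD.
Qed.

Lemma open_upward U V : open (U : set A) -> (forall x, U x -> V x) -> open (V : set A).
Proof. by move=> /open_nbhs0 nU UV; apply/nbhs0_open; apply: filterS nU => x /UV. Qed.

Lemma open_cap U V : open (U : set A) -> open (V : set A) -> open (cap_sub U V : set A).
Proof. by move=> oU oV; apply: openI. Qed.

Lemma open_full : open (full_sub A : set A).
Proof. exact: openT. Qed.

Lemma open_caps (I : eqType) (s : seq I) (P : I -> A -> Prop) :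
  (forall i, i \in s -> exists U, open (U : set A) /\ forall u, U u -> P i u) ->
  exists U, open (U : set A) /\ forall u, U u -> forall i, i \in s -> P i u.
Proof.
elim: s => [|i s IH] H; first by exists (full_sub A); split; [exact: open_full|].
have [|U [oU UP]] := IH; first by move=> j js; apply: H; rewrite inE js orbT.
have [V [oV VP]] := H i (mem_head _ _).
exists (cap_sub U V); split; first exact: open_cap.
by move=> u [Uu Vu] j; rewrite inE => /predU1P[->|]; [apply: VP|apply: UP].
Qed.

Definition separated := forall x : A, (forall U, open (U : set A) -> U x) -> x = 0.

(** The open subspaces form a neighbourhood basis of zero, so families indexed by
    them can replace Cauchy filters. *)
Definition cauchy_complete := forall x : lsubspace A -> A,
  (forall U V, open (U : set A) -> open (V : set A) ->
     (forall u, U u -> V u) -> V (x U - x V)) ->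
  exists a, forall U, open (U : set A) -> U (a - x U).

End OpenSubspaces.

Arguments separated {k} A.
Arguments cauchy_complete {k} A.

(** Completeness without reference to the completion: it is equivalent to
    [complete] and is the form in which extensions are built. *)
Definition sep_complete (k : fieldType) (A : linTopType k) :=
  separated A /\ cauchy_complete A.

Section Continuity.
Variables (k : fieldType) (A B : linTopType k).

Lemma continuous_open_sub (f : A -> B) : linear f ->
  (forall W : lsubspace B, open (W : set B) ->
     exists U : lsubspace A, open (U : set A) /\ forall x, U x -> W (f x)) ->
  continuous f.
Proof.
move=> lf H; apply/(linear_continuousP lf) => S /nbhs0_lsubspace[W [oW WS]].
have [U [oU UW]] := H W oW.
by apply: filterS (open_nbhs0 oU) => x /UW/WS.
Qed.

Lemma chom_linear (f : chom A B) : linear f.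
Proof. by have [] := chomP f. Qed.

Lemma chom_preim_open (f : chom A B) (W : lsubspace B) : open (W : set B) ->
  open (preim_sub (chom_linear f) W : set A).
Proof.
move=> oW; have [lf cf] := chomP f; apply: nbhs0_open.
by have := (linear_continuousP lf).1 cf _ (open_nbhs0 oW).
Qed.

Lemma chom_open (f : chom A B) (W : lsubspace B) : open (W : set B) ->
  exists U : lsubspace A, open (U : set A) /\ forall x, U x -> W (f x).
Proof.
by move=> oW; exists (preim_sub (chom_linear f) W); split=> //; apply: chom_preim_open.
Qed.

Lemma chom_ext (f g : chom A B) : (forall x, f x = g x) -> f = g.
Proof. by move=> fg; apply: val_inj; apply/funext. Qed.

Lemma mk_chomE (f : A -> B) (Hf : cont_linear f) x : mk_chom Hf x = f x.
Proof. by []. Qed.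

Lemma build_chom (f : A -> B) : linear f ->
  (forall W : lsubspace B, open (W : set B) ->
     exists U : lsubspace A, open (U : set A) /\ forall x, U x -> W (f x)) ->
  exists h : chom A B, forall x, h x = f x.
Proof.
move=> lf H.
by exists (mk_chom (conj lf (continuous_open_sub lf H) : cont_linear f)).
Qed.

(** Evaluating a map specified by its values on pure tensors amounts to
    constructing one continuous map with these values. *)
Lemma the_chomP (P : set (chom A B)) : (exists h, P h) -> P (the_chom P).
Proof. by move=> [h Ph]; apply: xgetI Ph. Qed.

Lemma chomD (f : chom A B) x y : f (x + y) = f x + f y.
Proof. exact: linfD (chom_linear f) _ _. Qed.
Lemma chomZ (f : chom A B) a x : f (a *: x) = a *: f x.
Proof. exact: linfZ (chom_linear f) _ _. Qed.
Lemma chom0 (f : chom A B) : f 0 = 0.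
Proof. exact: linf0 (chom_linear f). Qed.
Lemma chomN (f : chom A B) x : f (- x) = - f x.
Proof. exact: linfN (chom_linear f) _. Qed.
Lemma chomB (f : chom A B) x y : f (x - y) = f x - f y.
Proof. exact: linfB (chom_linear f) _ _. Qed.
Lemma chom_sum (f : chom A B) I (r : seq I) (P : pred I) (F : I -> A) :
  f (\sum_(i <- r | P i) F i) = \sum_(i <- r | P i) f (F i).
Proof. exact: linf_sum (chom_linear f) _ _ _ _. Qed.
Lemma add_chomE (f g : chom A B) x : (f + g : chom A B) x = f x + g x.
Proof. by []. Qed.
Lemma opp_chomE (f : chom A B) x : (- f : chom A B) x = - f x.
Proof. by []. Qed.
Lemma scale_chomE c (f : chom A B) x : (c *: f : chom A B) x = c *: f x.
Proof. by []. Qed.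
Lemma zero_chomE x : (0 : chom A B) x = 0.
Proof. by []. Qed.

End Continuity.

Lemma chom_compE (k : fieldType) (A B C : linTopType k) (g : chom B C) (f : chom A B) x :
  chom_comp g f x = g (f x).
Proof. by []. Qed.

Lemma chom_idE (k : fieldType) (A : linTopType k) (x : A) : chom_id A x = x.
Proof. by []. Qed.

Section GeneratedOpen.
Variables (k : fieldType) (V : lmodType k) (B : set (lsubspace V)).

(** The vector spaces [V] and [gen_lintop B] have the same operations but are
    distinct structures, whence these two transports of subspaces. *)
Definition of_gen (U : lsubspace (gen_lintop B)) : lsubspace V :=
  @Subspace k V U (subspace0 U) (@subspaceP k _ U).
Definition to_gen (U : lsubspace V) : lsubspace (gen_lintop B) :=
  @Subspace k (gen_lintop B) U (subspace0 U) (@subspaceP k _ U).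

Lemma gen_basic_open U : B U -> open (to_gen U : set (gen_lintop B)).
Proof.
move=> BU; apply/gen_openP; exists (cap_sub U (full_sub V)).
  by apply: meets_cap => //; apply: meets_full.
by move=> x [].
Qed.

(** An open subspace of a generated topology contains a finite intersection of
    generators. *)
Lemma gen_open_ind (P : lsubspace V -> Prop) :
  P (full_sub V) ->
  (forall U W, P U -> P W -> P (cap_sub U W)) ->
  (forall U W : lsubspace V, P U -> (forall x, U x -> W x) -> P W) ->
  (forall U, B U -> P U) ->
  forall U : lsubspace (gen_lintop B), open (U : set (gen_lintop B)) -> P (of_gen U).
Proof.
move=> P1 PI Pup BP U oU; have /gen_openP[W mW WU] : open (of_gen U : set (gen_lintop B)) by [].
apply: (Pup W); last by move=> x /WU.
elim: mW => {W WU} [//|U' W' /BP PU' _ PW']; exact: PI.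
Qed.

End GeneratedOpen.

Lemma discrete_open (k : fieldType) (V : lmodType k) (U : lsubspace (discrete V)) :
  open (U : set (discrete V)).
Proof.
have o0 : open (to_gen [set zero_sub V] (zero_sub V) : set (discrete V)).
  exact: gen_basic_open.
by apply: (open_upward o0) => x ->; apply: subspace0.
Qed.

Lemma discrete_separated (k : fieldType) (V : lmodType k) : separated (discrete V).
Proof. by move=> x H; apply: (H (zero_sub _)); apply: discrete_open. Qed.

(** * Completions *)

Lemma quo_pi_scale (k : fieldType) (V : lmodType k) (W : lsubspace V) a x :
  quo_pi W (a *: x) = a *: quo_pi W x.
Proof. exact: quo_piZ. Qed.

Definition mk_open_sub (k : fieldType) (A : linTopType k) (U : lsubspace A)
    (oU : open (U : set A)) : open_sub A :=
  exist (fun U : lsubspace A => open (U : set A)) U oU.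

Section CompletionTheory.
Variables (k : fieldType) (A : linTopType k).

Definition comp_at (x : completion A) (U : open_sub A) : quo (sval U) :=
  (\val (x : subsp (compatible_sub A)) : quotients A) U.

Lemma comp_at_compat x (U U' : open_sub A) a :
  (forall u, sval U u -> sval U' u) ->
  comp_at x U = quo_pi (sval U) a -> comp_at x U' = quo_pi (sval U') a.
Proof.
move=> UU'.
have /asboolP cx := valP (x : {x | x \in sub_pred (compatible_sub A)}).
exact: (cx U U' a UU').
Qed.

Lemma comp_atP x U : exists a, comp_at x U = quo_pi (sval U) a.
Proof. by eexists; rewrite -[LHS]quo_pi_repr. Qed.

Lemma comp_at_inj x y : (forall U, comp_at x U = comp_at y U) -> x = y.
Proof. by move=> xy; apply: val_inj; apply/functional_extensionality_dep. Qed.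

Lemma comp_at_linear U : linear (comp_at ^~ U).
Proof. by []. Qed.

Lemma comp_at_iota a U : comp_at (to_completion a) U = quo_pi (sval U) a.
Proof. by []. Qed.

(** The kernels of the projections to the discrete quotients form a neighbourhood
    basis of zero ([comp_open_ker]). *)
Definition comp_ker (U : open_sub A) : lsubspace (completion A).
Proof.
exists (fun x => comp_at x U = 0); first exact: (linf0 (comp_at_linear U)).
by move=> a x y x0 y0; rewrite (comp_at_linear U) x0 y0 scaler0 addr0.
Defined.

Lemma comp_ker_open U : open (comp_ker U : set (completion A)).
Proof.
apply: gen_basic_open.
pose W : lsubspace (quotients A) :=
  preim_sub (fun a x y => erefl : (a *: x + y : dprod _) U = a *: (x : dprod _) U + (y : dprod _) U) (zero_sub (quo (sval U))).
exists W; split; last by [].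
apply: gen_basic_open; exists U, (zero_sub (quo (sval U))); split; last by [].
exact: discrete_open.
Qed.

Lemma comp_ker_sub (U U' : open_sub A) : (forall u, sval U u -> sval U' u) ->
  forall x, comp_ker U x -> comp_ker U' x.
Proof.
move=> UU' x x0; apply: etrans (quo_pi0 _); apply: (comp_at_compat UU').
by apply: etrans x0 _; rewrite quo_pi0.
Qed.

Lemma comp_open_ker (W : lsubspace (completion A)) : open (W : set (completion A)) ->
  exists U : open_sub A, forall x, comp_ker U x -> W x.
Proof.
have full : open_sub A by exists (full_sub A); apply: open_full.
have capo (U1 U2 : open_sub A) : exists U : open_sub A, forall x : completion A,
    comp_ker U x -> comp_ker U1 x /\ comp_ker U2 x.
  case: U1 U2 => [U1 o1] [U2 o2].
  exists (mk_open_sub (open_cap o1 o2)) => x x0.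
  by split; apply: comp_ker_sub x0 => u [].
pose P (X : lsubspace (subsp (compatible_sub A))) :=
  exists U : open_sub A, forall x : completion A, comp_ker U x -> X x.
move=> oW; suff : P (of_gen W) by [].
apply: (@gen_open_ind _ _ _ P _ _ _ _ W) => //.
- by exists full.
- move=> U1 U2 [V1 V1P] [V2 V2P]; have [V VP] := capo V1 V2.
  by exists V => x /VP[/V1P ? /V2P ?]; split.
- by move=> U1 U2 [V VP] U12; exists V => x /VP/U12.
move=> U [X [oX UX]] {W oW}.
pose Q (Y : lsubspace (dprod (fun U : open_sub A => discrete (quo (sval U)) : lmodType k))) :=
  exists U : open_sub A, forall x : completion A, comp_ker U x -> Y (\val x).
suff [V VP] : Q (of_gen X) by exists V => x /VP; rewrite /subspace_mem UX.
apply: (@gen_open_ind _ _ _ Q _ _ _ _ X) => //.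
- by exists full.
- move=> U1 U2 [V1 V1P] [V2 V2P]; have [V VP] := capo V1 V2.
  by exists V => x /VP[/V1P ? /V2P ?]; split.
- by move=> U1 U2 [V VP] U12; exists V => x /VP/U12.
move=> Y [i [Z [_ YZ]]]; exists i => x x0; rewrite /subspace_mem YZ /=.
by have -> : (\val x) i = 0 by []; apply: subspace0.
Qed.

Lemma completion_separated : separated (completion A).
Proof.
move=> x H; apply: comp_at_inj => U.
by rewrite (H (comp_ker U) (@comp_ker_open U)).
Qed.

(** The limit is diagonal: its component at [U] is that of the member of the
    family indexed by the kernel over [U]. *)
Lemma completion_cauchy : cauchy_complete (completion A).
Proof.
move=> x Hx.
pose y (U : open_sub A) : discrete (quo (sval U)) := comp_at (x (comp_ker U)) U.
have cy : compatible (y : quotients A).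
  move=> U U' a UU' yU.
  have := Hx _ _ (@comp_ker_open U) (@comp_ker_open U') (comp_ker_sub UU').
  rewrite /subspace_mem /= (linfB (comp_at_linear U')) => /eqP; rewrite subr_eq0 => /eqP e.
  by rewrite /y -e; apply: comp_at_compat yU.
exists (@mk_subsp k _ (compatible_sub A) _ cy) => W oW; have [U UW] := comp_open_ker oW.
apply: (lsub_trans (y := x (comp_ker U))).
  by apply: UW; rewrite /subspace_mem /= (linfB (comp_at_linear U)); apply/subrr.
by apply: Hx => //; apply: comp_ker_open.
Qed.

Lemma completion_complete : sep_complete (completion A).
Proof. by split; [exact: completion_separated|exact: completion_cauchy]. Qed.

Lemma to_completion_linear : linear (@to_completion k A).
Proof.
by move=> a x y; apply: comp_at_inj => U; rewrite (comp_at_linear U) !comp_at_iota quo_piD quo_piZ.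
Qed.

Lemma to_completion_open (W : lsubspace (completion A)) : open (W : set (completion A)) ->
  exists U : lsubspace A, open (U : set A) /\ forall x, U x -> W (to_completion x).
Proof.
move=> /comp_open_ker[[U oU] UW]; exists U; split=> // x Ux; apply: UW.
by rewrite /subspace_mem /= comp_at_iota -(quo_pi0 U); apply/quo_piP; rewrite subr0.
Qed.

Lemma to_completion_dense (W : lsubspace (completion A)) x : open (W : set (completion A)) ->
  exists a, W (x - to_completion a).
Proof.
move=> /comp_open_ker[U UW]; have [a xa] := comp_atP x U; exists a; apply: UW.
by rewrite /subspace_mem /= (linfB (comp_at_linear U)) xa comp_at_iota subrr.
Qed.

Lemma to_completion_strict (U : lsubspace A) : open (U : set A) ->
  exists W : lsubspace (completion A), open (W : set (completion A)) /\
    forall a, W (to_completion a) -> U a.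
Proof.
move=> oU; exists (comp_ker (mk_open_sub oU)); split; first exact: comp_ker_open.
move=> a; rewrite /subspace_mem /= comp_at_iota -[RHS](quo_pi0 U) => /quo_piP.
by rewrite subr0.
Qed.

End CompletionTheory.

(** The images of representatives of the components of a point of the completion
    form a Cauchy family, and the extension is its limit. *)
Lemma completion_extend (k : fieldType) (A C : linTopType k) (f : chom A C) :
  sep_complete C ->
  exists h : chom (completion A) C, forall a, h (to_completion a) = f a.
Proof.
move=> [sC cC].
pose pre (W : lsubspace C) (oW : open (W : set C)) : open_sub A :=
  mk_open_sub (chom_preim_open f oW).
have lim (x : completion A) : exists c, forall (W : lsubspace C) (oW : open (W : set C)) a,
    comp_at x (pre W oW) = quo_pi (sval (pre W oW)) a -> W (c - f a).
  have yex (W : lsubspace C) : exists a, forall oW : open (W : set C),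
      comp_at x (pre W oW) = quo_pi (sval (pre W oW)) a.
    have [oW|nW] := pselect (open (W : set C)); last by exists 0 => oW.
    have [a xa] := comp_atP x (pre W oW); exists a => oW'.
    by rewrite (Prop_irrelevance oW' oW).
  have [y yP] := choice yex.
  have [U V oU oV UV|c cP] := cC (fun W => f (y W)).
    have /quo_piP : quo_pi (sval (pre V oV)) (y U) = quo_pi (sval (pre V oV)) (y V).
      rewrite -yP; apply/esym; apply: (comp_at_compat _ (yP U oU)) => u; exact: UV.
    by rewrite -chomB.
  exists c => W oW a; rewrite (yP W oW) => /quo_piP /= ya.
  by apply: (lsub_trans (y := f (y W))); [apply: cP|rewrite -chomB].
have [h hP] := choice lim.
have hlin : linear h.
  move=> a x y; apply/eqP; rewrite -subr_eq0; apply/eqP; apply: sC => W oW.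
  have [u xu] := comp_atP x (pre W oW); have [v yv] := comp_atP y (pre W oW).
  have := hP (a *: x + y) W oW (a *: u + v).
  rewrite (comp_at_linear (pre W oW)) xu yv -quo_pi_scale -quo_piD => /(_ erefl) H.
  apply: lsub_trans H _; apply: lsubBC.
  rewrite chomD chomZ opprD addrACA -scalerBr.
  by apply: lsubD; [apply: lsubZ; apply: hP xu|apply: hP yv].
have [H HE] : exists H : chom (completion A) C, forall x, H x = h x.
  apply: build_chom hlin _ => W oW.
  exists (comp_ker (pre W oW)); split; first exact: comp_ker_open.
  by move=> x x0; have := hP x W oW 0; rewrite chom0 subr0 quo_pi0; apply.
exists H => a; rewrite HE; apply/eqP; rewrite -subr_eq0; apply/eqP; apply: sC => W oW.
exact: hP.
Qed.

Lemma completion_dense (k : fieldType) (A C : linTopType k) (h : chom (completion A) C)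
    (W : lsubspace C) :
  open (W : set C) -> (forall a, W (h (to_completion a))) -> forall x, W (h x).
Proof.
move=> oW H x; have [U [oU UW]] := chom_open h oW.
have [a xa] := to_completion_dense x oU.
by apply: lsub_shift (H a); rewrite -chomB; apply: UW.
Qed.

Lemma separated_eq (k : fieldType) (A C : linTopType k) (f g : chom A C) x :
  separated C -> (forall W : lsubspace C, open (W : set C) -> W ((f - g : chom A C) x)) ->
  f x = g x.
Proof. by move=> sC H; apply/eqP; rewrite -subr_eq0; apply/eqP; apply: sC. Qed.

Lemma complete_sep_complete (k : fieldType) (A : linTopType k) :
  complete A <-> sep_complete A.
Proof.
split=> [[_ _ [g [gK Kg cg]]]|gA].
  split=> [x xU|x Hx].
    rewrite -(gK x); apply: etrans (gK 0); congr g; apply: comp_at_inj => -[U oU].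
    by rewrite !comp_at_iota; apply/quo_piP; rewrite subr0; apply: xU.
  pose y (U : open_sub A) : discrete (quo (sval U)) := quo_pi (sval U) (x (sval U)).
  have cy : compatible (y : quotients A).
    move=> [U oU] [U' oU'] a /= UU' /quo_piP/= e; apply/quo_piP => /=.
    by apply: lsub_trans (UU' _ e); apply: lsubBC; apply: Hx.
  exists (g (@mk_subsp k _ (compatible_sub A) _ cy)) => U oU.
  have : comp_at (to_completion (g (@mk_subsp k _ (compatible_sub A) _ cy))) (mk_open_sub oU) = y (mk_open_sub oU).
    by rewrite Kg.
  by rewrite comp_at_iota => /quo_piP.
have [h hE] := completion_extend (chom_id A) gA.
have cont_emb : continuous (@to_completion k A).
  by apply: continuous_open_sub; [exact: to_completion_linear|exact: to_completion_open].
split=> //; first exact: to_completion_linear.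
exists h; split; last by have [] := chomP h.
  by move=> a; rewrite hE.
pose emb := mk_chom (conj (@to_completion_linear k A) cont_emb : cont_linear _).
move=> x; apply: (@separated_eq _ _ _ (chom_comp emb h) (chom_id _)).
  exact: completion_separated.
move=> W oW; apply: completion_dense => // a.
rewrite add_chomE opp_chomE -[chom_comp _ _ _]/(emb (h (to_completion a))) hE subrr.
exact: subspace0.
Qed.

(** * Direct sums and algebraic tensor products *)

Section DirectSums.
Variables (k : fieldType) (I : eqType) (M : I -> lmodType k).

Definition dsum_at (x : dsum M) (i : I) : M i :=
  (\val (x : subsp (fin_supp_sub M)) : dprod M) i.

Lemma dsum_at_linear i : linear (dsum_at ^~ i).
Proof. by []. Qed.

Lemma dsum_at_inj x y : (forall i, dsum_at x i = dsum_at y i) -> x = y.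
Proof. by move=> xy; apply: val_inj; apply/functional_extensionality_dep. Qed.

Lemma dsum_at_in i (a : M i) : dsum_at (dsum_in a) i = a.
Proof. by rewrite /dsum_at /= /single dfwith_in. Qed.

Lemma dsum_at_out i j (a : M i) : i != j -> dsum_at (dsum_in a) j = 0.
Proof. by move=> ij; rewrite /dsum_at /= /single dfwith_out. Qed.

Lemma dsum_in_linear i : linear (@dsum_in k I M i).
Proof.
move=> c a b; apply: dsum_at_inj => j; rewrite dsum_at_linear.
have [ij|nij] := eqVneq i j; first by subst j; rewrite !dsum_at_in.
by rewrite !dsum_at_out // scaler0 addr0.
Qed.

Lemma dsum_supp (x : dsum M) :
  exists s : seq I, uniq s /\ forall i, i \notin s -> dsum_at x i = 0.
Proof.
have /asboolP[s sP] := valP (x : {x | x \in sub_pred (fin_supp_sub M)}).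
exists (undup s); split; first exact: undup_uniq.
by move=> i; rewrite mem_undup; apply: sP.
Qed.

Section Lift.
Variables (X : lmodType k) (h : forall i, M i -> X).
Hypothesis lh : forall i, linear (@h i).

Lemma supp_sum_widen (x : dsum M) (s t : seq I) : uniq s -> uniq t ->
  {subset s <= t} -> (forall i, i \notin s -> dsum_at x i = 0) ->
  \sum_(i <- t) h (dsum_at x i) = \sum_(i <- s) h (dsum_at x i).
Proof.
move=> us ut st xs.
rewrite (bigID (mem s)) /= [X in _ + X]big1 ?addr0.
  rewrite -big_filter; apply: perm_big; apply: uniq_perm => //.
    exact: filter_uniq.
  move=> i; rewrite mem_filter /=; apply/andP/idP => [[]//|si].
  by split=> //; apply: st.
by move=> i /xs ->; rewrite linf0.
Qed.

Lemma supp_sum_eq (x : dsum M) (s t : seq I) : uniq s -> uniq t ->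
  (forall i, i \notin s -> dsum_at x i = 0) ->
  (forall i, i \notin t -> dsum_at x i = 0) ->
  \sum_(i <- s) h (dsum_at x i) = \sum_(i <- t) h (dsum_at x i).
Proof.
move=> us ut xs xt.
have uu : uniq (undup (s ++ t)) by apply: undup_uniq.
rewrite -(@supp_sum_widen x s _ us uu _ xs) -?(@supp_sum_widen x t _ ut uu _ xt) //.
  by move=> i it; rewrite mem_undup mem_cat it orbT.
by move=> i it; rewrite mem_undup mem_cat it.
Qed.

(** The extension sums over a chosen support of each element; it is linear because
    any larger finite set gives the same sum. *)
Lemma dsum_lift : exists H : dsum M -> X,
  linear H /\ forall i a, H (dsum_in a) = h (a : M i).
Proof.
have [s sP] := choice dsum_supp.
exists (fun x => \sum_(i <- s x) h (dsum_at x i)); split.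
  move=> c x y; pose t := undup (s x ++ s y ++ s (c *: x + y)).
  have tw z : {subset s z <= t} ->
      \sum_(i <- s z) h (dsum_at z i) = \sum_(i <- t) h (dsum_at z i).
    move=> zt; have [uz z0] := sP z.
    by rewrite (@supp_sum_widen z (s z) t) // undup_uniq.
  rewrite !tw; first last.
  - by move=> i it; rewrite mem_undup !mem_cat it !orbT.
  - by move=> i it; rewrite mem_undup !mem_cat it.
  - by move=> i it; rewrite mem_undup !mem_cat it !orbT.
  rewrite scaler_sumr -big_split; apply: eq_bigr => i _.
  by rewrite dsum_at_linear lh.
move=> i a; have [us s0] := sP (dsum_in a).
rewrite (@supp_sum_eq _ _ [:: i]) // ?big_seq1 ?dsum_at_in //.
by move=> j; rewrite inE eq_sym; apply: dsum_at_out.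
Qed.

End Lift.

Lemma dsum_sum (x : dsum M) :
  exists s : seq I, x = \sum_(i <- s) dsum_in (dsum_at x i).
Proof.
have [s [us sP]] := dsum_supp x; exists s; apply: dsum_at_inj => i.
rewrite (linf_sum (dsum_at_linear i)).
have [si|nsi] := boolP (i \in s).
  rewrite (bigD1_seq i) //= dsum_at_in big1 ?addr0 // => j ji.
  exact: dsum_at_out.
rewrite sP // big1_seq // => j /andP[_ js]; apply: dsum_at_out.
by apply: contraNneq nsi => <-.
Qed.

End DirectSums.

Section Quotients.
Variables (k : fieldType) (V X : lmodType k) (W : lsubspace V).

Lemma quo_lift (h : V -> X) : linear h -> (forall w, W w -> h w = 0) ->
  exists H : quo W -> X, linear H /\ forall v, H (quo_pi W v) = h v.
Proof.
move=> lh h0; have [r rP] := choice (fun x : quo W =>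
  ex_intro (fun v => quo_pi W v = x) _ (quo_pi_repr x)).
have hr v : h (r (quo_pi W v)) = h v.
  apply/eqP; rewrite -subr_eq0 -linfB //; apply/eqP/h0/quo_piP.
  by rewrite rP.
exists (fun x => h (r x)); split=> // a x y.
by rewrite -[in LHS](rP x) -[in LHS](rP y) -quo_pi_scale -quo_piD hr lh.
Qed.

End Quotients.

Section TensorUniversal.
Variables (k : fieldType) (V W : lmodType k).

Definition is_bilinear (X : lmodType k) (b : V -> W -> X) :=
  (forall w, linear (b ^~ w)) /\ (forall v, linear (b v)).

Lemma tens_bilinear : is_bilinear (@tens k V W).
Proof.
have eqs (x y : free_pairs V W) : bilin_rel (x - y) ->
    quo_pi (span_sub (@bilin_rel k V W)) x = quo_pi (span_sub (@bilin_rel k V W)) y.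
  by move=> xy; apply/quo_piP => U; apply.
have addl (v v' : V) (w : W) : tens (v + v') w = tens v w + tens v' w.
  by rewrite /tens -[RHS]quo_piD; apply: eqs; rewrite opprD addrA; apply: bilin_addl.
have addr (v : V) (w w' : W) : tens v (w + w') = tens v w + tens v w'.
  by rewrite /tens -[RHS]quo_piD; apply: eqs; rewrite opprD addrA; apply: bilin_addr.
have scl a (v : V) (w : W) : tens (a *: v) w = a *: tens v w.
  by rewrite /tens -[RHS]quo_pi_scale; apply: eqs; apply: bilin_scalel.
have scr a (v : V) (w : W) : tens v (a *: w) = a *: tens v w.
  by rewrite /tens -[RHS]quo_pi_scale; apply: eqs; apply: bilin_scaler.
by split=> [w a x y|v a x y]; rewrite ?addl ?addr ?scl ?scr.
Qed.

Lemma tensor_sum (t : tensor V W) :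
  exists s : seq (V * W), t = \sum_(p <- s) tens p.1 p.2.
Proof.
have -> : t = quo_pi (span_sub (@bilin_rel k V W))
    (repr (t : Quotient.quot (sub_pred (span_sub (@bilin_rel k V W))))).
  by rewrite quo_pi_repr.
move: (repr _) => x; have [s ->] := dsum_sum x.
exists [seq (dsum_at x p *: p.1, p.2) | p <- s]; rewrite big_map /=.
have lp : linear (quo_pi (span_sub (@bilin_rel k V W))).
  by move=> a y z; rewrite quo_piD quo_pi_scale.
rewrite (linf_sum lp); apply: eq_bigr => -[v w] _.
rewrite (linfZ (tens_bilinear.1 w)) /tens -[RHS]quo_pi_scale; congr quo_pi.
by rewrite /basis_pair -(linfZ (@dsum_in_linear _ _ _ _)); rewrite [_ *: 1]mulr1.
Qed.

Lemma tens_lift (X : lmodType k) (b : V -> W -> X) : is_bilinear b ->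
  exists H : tensor V W -> X, linear H /\ forall v w, H (tens v w) = b v w.
Proof.
move=> [bl br].
have lb (p : V * W) : linear (fun c : k^o => c *: b p.1 p.2).
  by move=> a c c'; rewrite scalerDl scalerA.
have [F [lF FE]] := dsum_lift lb.
have Fb (v : V) (w : W) : F (basis_pair v w) = b v w by rewrite /basis_pair FE scale1r.
have [|H [lH HE]] := quo_lift (W := span_sub (@bilin_rel k V W)) lF.
  pose K := preim_sub lF (zero_sub X).
  move=> x /(_ K); apply=> y [] *; rewrite /= /subspace_mem /= !(linfB lF) ?(linfZ lF) !Fb.
  - by rewrite (linfD (bl _)) -addrA -opprD subrr.
  - by rewrite (linfD (br _)) -addrA -opprD subrr.
  - by rewrite (linfZ (bl _)) subrr.
  - by rewrite (linfZ (br _)) subrr.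
by exists H; split=> // v w; rewrite /tens HE Fb.
Qed.

Lemma tens_sub_ind (U : lsubspace (tensor V W)) :
  (forall v w, U (tens v w)) -> forall t, U t.
Proof. by move=> H t; have [s ->] := tensor_sum t; apply: lsub_sum. Qed.

End TensorUniversal.

(** * Completed tensor products *)

(** The two completed tensor products differ only in the family [T] of subspaces of
    the algebraic tensor product that are declared open. *)
Section CompletedTensor.
Variables (k : fieldType) (A B : linTopType k) (T : set (lsubspace (tensor A B))).

Let ctens : linTopType k := completion (gen_lintop T).
Let ctens_tens (a : A) (b : B) : ctens := to_completion (tens a b : gen_lintop T).

Lemma ctens_bilinear : is_bilinear ctens_tens.
Proof.
have lin_emb := @to_completion_linear k (gen_lintop T).
have [tl tr] := @tens_bilinear k A B.
split=> [b a x y|a c x y].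
  by rewrite /ctens_tens (tl b) -[RHS]lin_emb.
by rewrite /ctens_tens (tr a) -[RHS]lin_emb.
Qed.

Lemma ctens_lift (D : linTopType k) (b : A -> B -> D) : is_bilinear b -> sep_complete D ->
  (forall (H : tensor A B -> D) (lH : linear H), (forall x y, H (tens x y) = b x y) ->
     forall W : lsubspace D, open (W : set D) -> T (preim_sub lH W)) ->
  exists h : chom ctens D, forall x y, h (ctens_tens x y) = b x y.
Proof.
move=> bb cD TW; have [H [lH HE]] := tens_lift bb.
have [|h hE] := @build_chom k (gen_lintop T) D H lH.
  move=> W oW; exists (to_gen T (preim_sub lH W)); split=> //.
  by apply: gen_basic_open; apply: TW.
have [g gE] := completion_extend h cD.
by exists g => x y; rewrite /ctens_tens gE hE HE.
Qed.

Lemma ctens_dense (D : linTopType k) (h : chom ctens D) (W : lsubspace D) :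
  open (W : set D) -> (forall a b, W (h (ctens_tens a b))) -> forall x, W (h x).
Proof.
move=> oW H; apply: completion_dense => // t.
have lt : linear (fun t : tensor A B => h (to_completion (t : gen_lintop T))).
  by move=> a x y; rewrite -(chom_linear h) -(@to_completion_linear k (gen_lintop T)).
exact: (@tens_sub_ind k A B (preim_sub lt W)).
Qed.

Lemma ctens_approx (R : lsubspace ctens) (x : ctens) : open (R : set ctens) ->
  exists s : seq (A * B), R (x - \sum_(p <- s) ctens_tens p.1 p.2).
Proof.
move=> oR; have [t xt] := to_completion_dense x oR.
have [s ts] := @tensor_sum k A B t; exists s.
have lin_emb := @to_completion_linear k (gen_lintop T).
by rewrite /ctens_tens -(linf_sum lin_emb) -ts.
Qed.

(** The span of [S] is open in the algebraic tensor product, so it contains the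
    trace of an open subspace [R] of the completion, and every point of [R] is a
    limit of elements of this span. *)
Lemma ctens_nbhd (S : A -> B -> Prop) :
  (forall Q : lsubspace (tensor A B), (forall a b, S a b -> Q (tens a b)) -> T Q) ->
  exists R : lsubspace ctens, open (R : set ctens) /\
    forall (D : linTopType k) (h : chom ctens D) (W : lsubspace D), open (W : set D) ->
      (forall a b, S a b -> W (h (ctens_tens a b))) -> forall z, R z -> W (h z).
Proof.
pose X : set (tensor A B) := [set t | exists a b, S a b /\ t = tens a b]%classic.
move=> TQ; have /gen_basic_open oQ : T (span_sub X).
  by apply: TQ => a b ab U XU; apply: XU; exists a, b.
have [R [oR RQ]] := to_completion_strict oQ.
exists R; split=> // D h W oW hX z Rz.
have [N [oN NW]] := chom_open h oW.
have [t [Nt Rt]] := to_completion_dense z (open_cap oN oR).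
apply: (lsub_shift (y := h (to_completion t))); first by rewrite -chomB; apply: NW.
have /RQ Qt : R (to_completion t) by apply: lsub_shift Rz; apply: lsubBC.
have lt : linear (fun t : tensor A B => h (to_completion (t : gen_lintop T))).
  by move=> a x y; rewrite -(chom_linear h) -(@to_completion_linear k (gen_lintop T)).
by apply: (Qt (preim_sub lt W)) => _ [a [b [ab ->]]]; apply: hX.
Qed.

(** Closed under intersection and enlargement, [T] is already the family of all the
    open subspaces of the topology that it generates. *)
Lemma ctens_open :
  T (full_sub _) -> (forall U W, T U -> T W -> T (cap_sub U W)) ->
  (forall U W : lsubspace (tensor A B), T U -> (forall t, U t -> W t) -> T W) ->
  forall W : lsubspace ctens, open (W : set ctens) ->
  exists Q : lsubspace (tensor A B), T Q /\
    forall a b, Q (tens a b) -> W (ctens_tens a b).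
Proof.
move=> T1 TI TU W /to_completion_open[Q [oQ QW]]; exists (of_gen Q); split.
  by apply: (@gen_open_ind _ _ _ T _ _ _ _ Q).
by move=> a b; apply: QW.
Qed.

End CompletedTensor.

Section StarBang.
Variables (k : fieldType) (A B : linTopType k).

(** Continuity for the star topology, read on a bilinear map: jointly at zero and
    separately in each variable. *)
Definition star_cont (D : linTopType k) (b : A -> B -> D) :=
  forall W : lsubspace D, open (W : set D) ->
  [/\ exists (U : lsubspace A) (V : lsubspace B),
        [/\ open (U : set A), open (V : set B) & forall u v, U u -> V v -> W (b u v)],
      forall x, exists V : lsubspace B, open (V : set B) /\ forall v, V v -> W (b x v) &
      forall y, exists U : lsubspace A, open (U : set A) /\ forall u, U u -> W (b u y)].

(** Unlike in [star_cont], smallness in one variable is uniform in the other. *)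
Definition bang_cont (D : linTopType k) (b : A -> B -> D) :=
  forall W : lsubspace D, open (W : set D) ->
  exists (U : lsubspace A) (V : lsubspace B),
    [/\ open (U : set A), open (V : set B),
        forall u y, U u -> W (b u y) & forall x v, V v -> W (b x v)].

Lemma star_tens_bilinear : is_bilinear (@star_tens k A B).
Proof. exact: ctens_bilinear. Qed.

Lemma bang_tens_bilinear : is_bilinear (@bang_tens k A B).
Proof. exact: ctens_bilinear. Qed.

Lemma star_complete : sep_complete (star A B).
Proof. exact: completion_complete. Qed.

Lemma bang_complete : sep_complete (bang A B).
Proof. exact: completion_complete. Qed.

Lemma star_tens_cont : star_cont (@star_tens k A B).
Proof.
rewrite /star_cont /star_tens /star => W oW.
have [| | |Q [[[U [V [oU oV UV]]] l r] QW]] :=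
  @ctens_open k A B [set Q : lsubspace (tensor A B) | star_open Q]%classic _ _ _ W oW.
- split=> [|a|b]; [exists (full_sub A), (full_sub B)|exists (full_sub B)|exists (full_sub A)];
    split=> //; exact: open_full.
- move=> Q1 Q2 [[U1 [V1 [oU1 oV1 UV1]]] l1 r1] [[U2 [V2 [oU2 oV2 UV2]]] l2 r2]; split.
  + exists (cap_sub U1 U2), (cap_sub V1 V2); split; [exact: open_cap|exact: open_cap|].
    by move=> u v [? ?] [? ?]; split; [apply: UV1|apply: UV2].
  + move=> a; have [V [oV VP]] := l1 a; have [V' [oV' VP']] := l2 a.
    exists (cap_sub V V'); split; first exact: open_cap.
    by move=> v [? ?]; split; [apply: VP|apply: VP'].
  + move=> a; have [V [oV VP]] := r1 a; have [V' [oV' VP']] := r2 a.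
    exists (cap_sub V V'); split; first exact: open_cap.
    by move=> v [? ?]; split; [apply: VP|apply: VP'].
- move=> Q1 Q2 [[U1 [V1 [oU1 oV1 UV1]]] l1 r1] Q12; split.
  + by exists U1, V1; split=> // u v Uu Vv; apply: Q12; apply: UV1.
  + by move=> a; have [V [oV VP]] := l1 a; exists V; split=> // v /VP/Q12.
  + by move=> a; have [V [oV VP]] := r1 a; exists V; split=> // v /VP/Q12.
split=> [|a|b].
- by exists U, V; split=> // u v Uu Vv; exact: (QW _ _ (UV _ _ Uu Vv)).
- by have [V' [oV' VP]] := l a; exists V'; split=> // v Vv; exact: (QW _ _ (VP _ Vv)).
- by have [V' [oV' VP]] := r b; exists V'; split=> // v Vv; exact: (QW _ _ (VP _ Vv)).
Qed.

Lemma bang_tens_cont : bang_cont (@bang_tens k A B).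
Proof.
rewrite /bang_cont /bang_tens /bang => W oW.
have [| | |Q [[U [V [oU oV l r]]] QW]] :=
  @ctens_open k A B [set Q : lsubspace (tensor A B) | bang_open Q]%classic _ _ _ W oW.
- by exists (full_sub A), (full_sub B); split=> //; exact: open_full.
- move=> Q1 Q2 [U1 [V1 [oU1 oV1 l1 r1]]] [U2 [V2 [oU2 oV2 l2 r2]]].
  exists (cap_sub U1 U2), (cap_sub V1 V2); split; [exact: open_cap|exact: open_cap| |].
    by move=> u b [? ?]; split; [apply: l1|apply: l2].
  by move=> u b [? ?]; split; [apply: r1|apply: r2].
- move=> Q1 Q2 [U1 [V1 [oU1 oV1 l1 r1]]] Q12.
  by exists U1, V1; split=> // u b H; apply: Q12; [apply: l1|apply: r1].
exists U, V; split=> // x y xy; first exact: (QW _ _ (l _ _ xy)).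
exact: (QW _ _ (r _ _ xy)).
Qed.

Section Lift.
Variable D : linTopType k.

Lemma star_lift (b : A -> B -> D) : is_bilinear b -> star_cont b -> sep_complete D ->
  exists h : chom (star A B) D, forall x y, h (star_tens x y) = b x y.
Proof.
move=> bb cb cD; apply: ctens_lift => // H lH HE W /cb[[U [V [oU oV UV]]] l r]; split.
- by exists U, V; split=> // u v Uu Vv; rewrite /= HE; apply: UV.
- move=> a; have [V' [oV' VP]] := l a; exists V'; split=> // v Vv.
  by rewrite /= HE; apply: VP.
- move=> a; have [V' [oV' VP]] := r a; exists V'; split=> // v Vv.
  by rewrite /= HE; apply: VP.
Qed.

Lemma bang_lift (b : A -> B -> D) : is_bilinear b -> bang_cont b -> sep_complete D ->
  exists h : chom (bang A B) D, forall x y, h (bang_tens x y) = b x y.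
Proof.
move=> bb cb cD; apply: ctens_lift => // H lH HE W /cb[U [V [oU oV l r]]].
by exists U, V; split=> // x y xy; rewrite /= HE; [apply: l|apply: r].
Qed.

Lemma star_dense (h : chom (star A B) D) (W : lsubspace D) :
  open (W : set D) -> (forall a b, W (h (star_tens a b))) -> forall x, W (h x).
Proof. exact: ctens_dense. Qed.

Lemma bang_dense (h : chom (bang A B) D) (W : lsubspace D) :
  open (W : set D) -> (forall a b, W (h (bang_tens a b))) -> forall x, W (h x).
Proof. exact: ctens_dense. Qed.

Lemma bang_eq (h h' : chom (bang A B) D) : separated D ->
  (forall a b, h (bang_tens a b) = h' (bang_tens a b)) -> forall x, h x = h' x.
Proof.
move=> sD hh' x; apply: separated_eq => // W oW.
apply: bang_dense => // a b; rewrite add_chomE opp_chomE hh' subrr.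
exact: subspace0.
Qed.

End Lift.

Lemma bang_approx (R : lsubspace (bang A B)) (x : bang A B) : open (R : set (bang A B)) ->
  exists s : seq (A * B), R (x - \sum_(p <- s) bang_tens p.1 p.2).
Proof. by move: R x; rewrite /bang_tens /bang; apply: ctens_approx. Qed.

(** [R] is the closure of [U (x) B + A (x) V]: on it, the size of a map can be
    tested on pure tensors. *)
Lemma bang_basic_nbhd (U : lsubspace A) (V : lsubspace B) :
  open (U : set A) -> open (V : set B) ->
  exists R : lsubspace (bang A B), open (R : set (bang A B)) /\
    forall (D : linTopType k) (h : chom (bang A B) D) (W : lsubspace D), open (W : set D) ->
      (forall x y, U x \/ V y -> W (h (bang_tens x y))) -> forall z, R z -> W (h z).
Proof.
move=> oU oV; apply: (@ctens_nbhd _ _ _ _ (fun x y => U x \/ V y)) => Q UVQ.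
by exists U, V; split=> // x y xy; apply: UVQ; [left|right].
Qed.

End StarBang.
Opaque star bang star_tens bang_tens.

Section PureTensorMaps.
Variables (k : fieldType) (A B : linTopType k).

Lemma star_tens_l_ex (a : A) : exists h : chom B (star A B), forall b, h b = star_tens a b.
Proof.
apply: build_chom; first exact: (@star_tens_bilinear _ A B).2.
by move=> W /star_tens_cont[_ H _]; apply: H.
Qed.

Lemma star_tens_r_ex (b : B) : exists h : chom A (star A B), forall a, h a = star_tens a b.
Proof.
apply: build_chom; first exact: (@star_tens_bilinear _ A B).1.
by move=> W /star_tens_cont[_ _ H]; apply: H.
Qed.

Lemma bang_tens_l_ex (a : A) : exists h : chom B (bang A B), forall b, h b = bang_tens a b.
Proof.
apply: build_chom; first exact: (@bang_tens_bilinear _ A B).2.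
by move=> W /bang_tens_cont[U [V [oU oV _ r]]]; exists V; split=> // v; apply: r.
Qed.

Lemma bang_tens_r_ex (b : B) : exists h : chom A (bang A B), forall a, h a = bang_tens a b.
Proof.
apply: build_chom; first exact: (@bang_tens_bilinear _ A B).1.
by move=> W /bang_tens_cont[U [V [oU oV l _]]]; exists U; split=> // v; apply: l.
Qed.

End PureTensorMaps.

Section UngradedMaps.
Variables (k : fieldType) (A B A' B' : linTopType k) (f : chom A A') (g : chom B B').

Lemma bilinear_comp (X : lmodType k) (b : A' -> B' -> X) :
  is_bilinear b -> is_bilinear (fun x y => b (f x) (g y)).
Proof.
by move=> [bl br]; split=> [y|x] c u v; rewrite chom_linear ?bl ?br.
Qed.

Lemma star_hom_ex : exists h : chom (star A B) (star A' B'),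
  forall x y, h (star_tens x y) = star_tens (f x) (g y).
Proof.
apply: star_lift; [exact: bilinear_comp (star_tens_bilinear _ _)| |exact: star_complete].
move=> W /star_tens_cont[[U [V [oU oV UV]]] l r]; split.
- have [U' [oU' U'U]] := chom_open f oU; have [V' [oV' V'V]] := chom_open g oV.
  by exists U', V'; split=> // u v /U'U ? /V'V ?; apply: UV.
- move=> x; have [V' [oV' VP]] := l (f x); have [V2 [oV2 V2P]] := chom_open g oV'.
  by exists V2; split=> // v /V2P/VP.
- move=> x; have [V' [oV' VP]] := r (g x); have [V2 [oV2 V2P]] := chom_open f oV'.
  by exists V2; split=> // v /V2P/VP.
Qed.

Lemma bang_hom_ex : exists h : chom (bang A B) (bang A' B'),
  forall x y, h (bang_tens x y) = bang_tens (f x) (g y).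
Proof.
apply: bang_lift; [exact: bilinear_comp (bang_tens_bilinear _ _)| |exact: bang_complete].
move=> W /bang_tens_cont[U [V [oU oV l r]]].
have [U' [oU' U'U]] := chom_open f oU; have [V' [oV' V'V]] := chom_open g oV.
by exists U', V'; split=> // x y; [move/U'U; apply: l|move/V'V; apply: r].
Qed.

Definition star_hom : chom (star A B) (star A' B') := projT1 (cid star_hom_ex).

Lemma star_homE x y : star_hom (star_tens x y) = star_tens (f x) (g y).
Proof. exact: (projT2 (cid star_hom_ex)). Qed.

Definition bang_hom : chom (bang A B) (bang A' B') := projT1 (cid bang_hom_ex).

Lemma bang_homE x y : bang_hom (bang_tens x y) = bang_tens (f x) (g y).
Proof. exact: (projT2 (cid bang_hom_ex)). Qed.

End UngradedMaps.

Section Flips.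
Variables (k : fieldType) (A B : linTopType k).

Lemma bilinear_flip (V W X : lmodType k) (b : V -> W -> X) :
  is_bilinear b -> is_bilinear (fun y x => b x y).
Proof. by case. Qed.

Lemma star_flip_ex : exists h : chom (star A B) (star B A),
  forall x y, h (star_tens x y) = star_tens y x.
Proof.
apply: star_lift; [exact: bilinear_flip (star_tens_bilinear _ _)| |exact: star_complete].
move=> W /star_tens_cont[[U [V [oU oV UV]]] l r]; split=> //.
by exists V, U; split=> // u v Uu Vv; apply: UV.
Qed.

Lemma bang_flip_ex : exists h : chom (bang A B) (bang B A),
  forall x y, h (bang_tens x y) = bang_tens y x.
Proof.
apply: bang_lift; [exact: bilinear_flip (bang_tens_bilinear _ _)| |exact: bang_complete].
move=> W /bang_tens_cont[U [V [oU oV l r]]].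
by exists V, U; split=> // u y H; [apply: r|apply: l].
Qed.

Definition star_flip : chom (star A B) (star B A) := projT1 (cid star_flip_ex).

Lemma star_flipE x y : star_flip (star_tens x y) = star_tens y x.
Proof. exact: (projT2 (cid star_flip_ex)). Qed.

Definition bang_flip : chom (bang A B) (bang B A) := projT1 (cid bang_flip_ex).

Lemma bang_flipE x y : bang_flip (bang_tens x y) = bang_tens y x.
Proof. exact: (projT2 (cid bang_flip_ex)). Qed.

End Flips.

Section Slices.
Variables (k : fieldType) (A B : linTopType k).

Lemma scalars_ker_open (f : chom A (scalars k)) :
  open (preim_sub (chom_linear f) (zero_sub _) : set A).
Proof. by apply: chom_preim_open; apply: discrete_open. Qed.

Lemma slice_ex (f : chom A (scalars k)) : sep_complete B ->
  exists h : chom (bang A B) B, forall x y, h (bang_tens x y) = (f x : k) *: y.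
Proof.
move=> cB; apply: bang_lift => //.
  split=> [y c u v|x c u v]; first by rewrite chom_linear scalerDl -scalerA.
  by rewrite scalerDr !scalerA mulrC.
move=> W oW; exists (preim_sub (chom_linear f) (zero_sub _)), W; split=> //.
- exact: scalars_ker_open.
- by move=> u y ->; rewrite scale0r; apply: subspace0.
- by move=> x v; apply: lsubZ.
Qed.

(** The map [f (x) 1 : A [!] B -> B]; letting [f] vary gives the coordinates of an
    element. *)
Definition slice (f : chom A (scalars k)) : chom (bang A B) B :=
  the_chom [set h | forall x y, h (bang_tens x y) = (f x : k) *: y]%classic.

Lemma sliceE f x y : sep_complete B -> slice f (bang_tens x y) = (f x : k) *: y.
Proof.
by move=> cB; apply: (the_chomP (slice_ex f cB)).
Qed.

End Slices.

Section ParametrizedMaps.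
Variables (k : fieldType) (A B C D : linTopType k) (h : A -> chom (bang B C) D).

Definition tens_star_cont := forall W : lsubspace D, open (W : set D) ->
  (exists (U : lsubspace A) (V : lsubspace B) (Z : lsubspace C),
     [/\ open (U : set A), open (V : set B), open (Z : set C) &
         forall u x y, U u -> V x \/ Z y -> W (h u (bang_tens x y))]) /\
  forall x y, exists U : lsubspace A, open (U : set A) /\
    forall u, U u -> W (h u (bang_tens x y)).

(** Continuity can thus be tested on pure tensors.  For the dependence on the
    parameter at a fixed [z], approximate [z] by a finite sum of pure tensors, up to
    an error that joint smallness controls. *)
Lemma param_star_cont : tens_star_cont -> star_cont (fun a => h a).
Proof.
move=> hc W oW; have [[U [V [Z [oU oV oZ H]]]] r] := hc W oW.
have [R [oR RW]] := bang_basic_nbhd oV oZ.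
have joint u z : U u -> R z -> W (h u z).
  by move=> Uu; apply: RW => // x y; apply: H.
split=> [|a|z]; first by exists U, R; split.
  exact: chom_open.
have [s zs] := bang_approx z oR.
have [|U' [oU' U'P]] := @open_caps k A _ s (fun p u => W (h u (bang_tens p.1 p.2))).
  by move=> p _; apply: r.
exists (cap_sub U U'); split; first exact: open_cap.
move=> u [Uu /U'P U'u]; apply: (lsub_shift (y := h u (\sum_(p <- s) bang_tens p.1 p.2))).
  by rewrite -chomB; apply: joint.
by rewrite chom_sum big_seq; apply: lsub_sum => p ps; apply: U'u.
Qed.

Lemma param_bilinear : separated D ->
  (forall x y, linear (fun a => h a (bang_tens x y))) -> is_bilinear (fun a => h a).
Proof.
move=> sD lh; split=> [z c a a'|a]; last exact: chom_linear.
have : h (c *: a + a') z = (c *: h a + h a' : chom (bang B C) D) z.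
  by apply: bang_eq => // x y; rewrite lh.
by [].
Qed.

End ParametrizedMaps.

Section ParametrizedBang.
Variables (k : fieldType) (A B C D : linTopType k) (h : C -> chom (bang A B) D).

Lemma param_bang_cont :
  (forall W : lsubspace D, open (W : set D) ->
     exists (U : lsubspace A) (V : lsubspace B) (Z : lsubspace C),
     [/\ open (U : set A), open (V : set B), open (Z : set C) &
         forall x y z, [\/ U x, V y | Z z] -> W (h z (bang_tens x y))]) ->
  bang_cont (fun y z => h z y).
Proof.
move=> hc W oW; have [U [V [Z [oU oV oZ H]]]] := hc W oW.
have [R [oR RW]] := bang_basic_nbhd oU oV.
exists R, Z; split=> //.
  by move=> t z Rt; apply: RW Rt => // x y [?|?]; apply: H; [apply: Or31|apply: Or32].
by move=> t z Zz; apply: bang_dense => // x y; apply: H; apply: Or33.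
Qed.

End ParametrizedBang.

(** * Topological sums and products *)

Section TopologicalSums.
Variables (k : fieldType) (I : eqType) (A : I -> linTopType k).

Let T : linTopType k := sum_top A.
Let inj (i : I) (a : A i) : T := @dsum_in k I (fun i => A i : lmodType k) i a.

Lemma sum_in_ex i : exists h : chom (A i) T, forall a, h a = inj a.
Proof.
apply: build_chom => [c a b|W oW].
  exact: (@dsum_in_linear k I (fun i => A i : lmodType k) i c a b).
pose P (X : lsubspace (dsum (fun i => A i : lmodType k))) :=
  exists U : lsubspace (A i), open (U : set (A i)) /\ forall x, U x -> X (inj x).
apply: (@gen_open_ind _ _ _ P _ _ _ _ W oW).
- by exists (full_sub (A i)); split=> //; exact: open_full.
- move=> X Y [U [oU UX]] [V [oV VY]]; exists (cap_sub U V); split; first exact: open_cap.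
  by move=> x [? ?]; split; [apply: UX|apply: VY].
- by move=> X Y [U [oU UX]] XY; exists U; split=> // x /UX/XY.
move=> X XB; exists (preim_sub (@dsum_in_linear k I (fun i => A i : lmodType k) i) X).
by split=> //; exact: (XB i).
Qed.

Lemma sum_lift (D : linTopType k) (h : forall i, chom (A i) D) :
  exists H : chom T D, forall i a, H (@inj i a) = h i a.
Proof.
have [H [lH HE]] := dsum_lift (fun i => chom_linear (h i)).
have [|G GE] := @build_chom k T D H lH.
  move=> W oW; exists (to_gen _ (preim_sub lH W)); split=> //.
  apply: gen_basic_open => i; have := chom_preim_open (h i) oW.
  by congr open; apply/funext => a; rewrite /= HE.
by exists G => i a; rewrite GE HE.
Qed.

Lemma sum_sub_ind (D : linTopType k) (h : chom T D) (W : lsubspace D) :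
  (forall i a, W (h (@inj i a))) -> forall x, W (h x).
Proof.
move=> H x; have [s ->] := @dsum_sum k I (fun i => A i : lmodType k) x.
rewrite [h _](@linf_sum k _ D (h : dsum (fun i => A i : lmodType k) -> D) (chom_linear h)).
by apply: lsub_sum => i _; apply: H.
Qed.

End TopologicalSums.

Section TopologicalProducts.
Variables (k : fieldType) (I : eqType) (A : I -> linTopType k).

Let T : linTopType k := prod_top A.
Let at_ (x : T) (i : I) : A i := (x : dprod (fun i => A i : lmodType k)) i.
Let inj (i : I) (a : A i) : T := @single k I (fun i => A i : lmodType k) i a.

Lemma prod_open_ind (P : lsubspace T -> Prop) :
  P (full_sub T) ->
  (forall U W, P U -> P W -> P (cap_sub U W)) ->
  (forall U W : lsubspace T, P U -> (forall x, U x -> W x) -> P W) ->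
  (forall (U : lsubspace T) i (X : lsubspace (A i)), open (X : set (A i)) ->
    (forall x, U x <-> X (at_ x i)) -> P U) ->
  forall U : lsubspace T, open (U : set T) -> P U.
Proof.
move=> P1 PI PU PB U oU.
have := @gen_open_ind _ _ _ (fun X => P (to_gen _ X)) _ _ _ _ U oU.
have -> : to_gen _ (of_gen U) = U by case: U {oU}.
apply.
- by apply: (PU (full_sub T)).
- by move=> X Y PX PY; apply: (PU _ _ (PI _ _ PX PY)).
- by move=> X Y PX XY; apply: (PU _ _ PX).
move=> X [i [Z [oZ XZ]]]; apply: (PB _ i Z oZ) => x.
by rewrite /to_gen /= /subspace_mem /= XZ.
Qed.

Lemma prod_cyl_open i (X : lsubspace (A i)) : open (X : set (A i)) ->
  exists U : lsubspace T, open (U : set T) /\ forall x, U x <-> X (at_ x i).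
Proof.
move=> oX.
have la : linear (fun x : dprod (fun i => A i : lmodType k) => x i : A i) by [].
exists (to_gen _ (preim_sub la X)); split=> //.
by apply: gen_basic_open; exists i, X.
Qed.

Lemma prod_at_ex i : exists h : chom T (A i), forall x, h x = at_ x i.
Proof.
apply: build_chom => // X oX; have [U [oU UX]] := prod_cyl_open oX.
by exists U; split=> // x /UX.
Qed.

Lemma prod_lift (D : linTopType k) (h : forall i, chom D (A i)) :
  exists H : chom D T, forall i y, at_ (H y) i = h i y.
Proof.
pose H (y : D) : T := (fun i => h i y) : dprod (fun i => A i : lmodType k).
have lH : linear H.
  move=> c x y; apply/functional_extensionality_dep => i; exact: chom_linear.
have [|G GE] := build_chom lH; last by exists G => i y; rewrite GE.
apply: prod_open_ind.
- by exists (full_sub D); split=> //; exact: open_full.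
- move=> X Y [U [oU UX]] [V [oV VY]]; exists (cap_sub U V); split; first exact: open_cap.
  by move=> x [? ?]; split; [apply: UX|apply: VY].
- by move=> X Y [U [oU UX]] XY; exists U; split=> // x /UX/XY.
move=> U i X oX UX; have [V [oV VX]] := chom_open (h i) oX.
by exists V; split=> // x Vx; apply/UX; exact: VX.
Qed.

Lemma prod_in_ex i : exists h : chom (A i) T, forall a, h a = inj a.
Proof.
have inE a j : at_ (@inj i a) j = dfwith (fun j => 0 : A j) a j by [].
apply: build_chom => [c a b|].
  apply/functional_extensionality_dep => j.
  change (at_ (inj (c *: a + b)) j = c *: at_ (inj a) j + at_ (inj b) j); rewrite !inE.
  have [ij|nij] := eqVneq i j; first by subst j; rewrite !dfwith_in.
  by rewrite !dfwith_out // scaler0 addr0.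
apply: prod_open_ind.
- by exists (full_sub (A i)); split=> //; exact: open_full.
- move=> X Y [U [oU UX]] [V [oV VY]]; exists (cap_sub U V); split; first exact: open_cap.
  by move=> x [? ?]; split; [apply: UX|apply: VY].
- by move=> X Y [U [oU UX]] XY; exists U; split=> // x /UX/XY.
move=> U j X oX UX; have [ij|nij] := eqVneq i j.
  by subst j; exists X; split=> // x Xx; apply/UX; rewrite inE dfwith_in.
exists (full_sub (A i)); split; first exact: open_full.
by move=> x _; apply/UX; rewrite inE dfwith_out //; apply: subspace0.
Qed.

Lemma prod_open_supp (W : lsubspace T) : open (W : set T) ->
  exists s : seq I, forall x, (forall i, i \in s -> at_ x i = 0) -> W x.
Proof.
move: W; apply: prod_open_ind.
- by exists [::].
- move=> X Y [s sX] [t tY]; exists (s ++ t) => x x0.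
  by split; [apply: sX|apply: tY] => i H; apply: x0; rewrite mem_cat H ?orbT.
- by move=> X Y [s sX] XY; exists s => x /sX/XY.
move=> U i X oX UX; exists [:: i] => x x0; apply/UX; rewrite x0 ?inE //.
exact: subspace0.
Qed.

(** An open subspace constrains finitely many coordinates, so a point is
    approximated by the finite sums of its coordinates. *)
Lemma prod_dense (D : linTopType k) (h : chom T D) (W : lsubspace D) :
  open (W : set D) -> (forall i a, W (h (@inj i a))) -> forall x, W (h x).
Proof.
move=> oW H x; have [V [oV VW]] := chom_open h oW.
have [s sV] := prod_open_supp oV.
apply: (lsub_shift (y := h (\sum_(i <- undup s) inj (at_ x i)))).
  rewrite -chomB; apply/VW/sV => i.
  rewrite -mem_undup => si; have [p pE] := prod_at_ex i.
  rewrite -pE chomB chom_sum (bigD1_seq i) ?undup_uniq //= !pE.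
  have inE j a : at_ (@inj j a) i = dfwith (fun j => 0 : A j) a i by [].
  rewrite inE dfwith_in big1 ?addr0 ?subrr // => j ji.
  by rewrite pE inE dfwith_out.
by rewrite chom_sum; apply: lsub_sum.
Qed.

Lemma prod_separated : (forall i, separated (A i)) -> separated T.
Proof.
move=> sA x H; apply/functional_extensionality_dep => i; apply: (sA i) => X oX.
by have [U [oU UX]] := prod_cyl_open oX; apply/UX/H.
Qed.

(** Limits are taken coordinatewise, along the cylinders over the open subspaces of
    each factor. *)
Lemma prod_complete : (forall i, sep_complete (A i)) -> sep_complete T.
Proof.
move=> cA; split; first by apply: prod_separated => i; have [] := cA i.
move=> x Hx.
have [C CP] : exists C : forall i, lsubspace (A i) -> lsubspace T,
    forall i (X : lsubspace (A i)), open (X : set (A i)) ->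
      open (C i X : set T) /\ forall z, C i X z <-> X (at_ z i).
  have cyl i (X : lsubspace (A i)) : exists U : lsubspace T, open (X : set (A i)) ->
      open (U : set T) /\ forall z, U z <-> X (at_ z i).
    have [oX|nX] := pselect (open (X : set (A i))); last by exists (full_sub T).
    by have [U UX] := prod_cyl_open oX; exists U.
  by exists (fun i => projT1 (choice (cyl i))) => i; exact: (projT2 (choice (cyl i))).
have lim i : exists y : A i, forall X : lsubspace (A i), open (X : set (A i)) ->
    X (y - at_ (x (C i X)) i).
  apply: (cA i).2 => X Y oX oY XY.
  have [oCX CX] := CP i X oX; have [oCY CY] := CP i Y oY.
  apply: (CY (x (C i X) - x (C i Y))).1; apply: Hx => // z Cz.
  by apply/CY/XY/CX.
pose y : T := (fun i => projT1 (cid (lim i))) : dprod (fun i => A i : lmodType k).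
exists y => U oU; suff [] : open (U : set T) /\ U (y - x U) by [].
move: U oU; apply: prod_open_ind.
- by split=> //; exact: open_full.
- move=> U V [oU Uy] [oV Vy]; have oUV := open_cap oU oV; split=> //.
  split; [apply: (lsub_trans Uy)|apply: (lsub_trans Vy)]; apply: lsubBC.
    by apply: Hx => // z [].
  by apply: Hx => // z [].
- move=> U V [oU Uy] UV; have oV := open_upward oU UV; split=> //.
  by apply: (lsub_trans (UV _ Uy)); apply: Hx.
move=> U i X oX UX; have [oC CX] := CP i X oX.
have oU : open (U : set T) by apply: (open_upward oC) => z Cz; apply/UX/CX.
split=> //; apply: (lsub_trans (y := x (C i X))).
  apply: (UX (y - x (C i X))).2; exact: (projT2 (cid (lim i)) X oX).
by apply: Hx => // z Cz; apply/UX/CX.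
Qed.

End TopologicalProducts.

(** * Graded tensor products *)

Lemma int_eq_irr (i j : int) (e e' : i = j) : e = e'.
Proof. exact: eq_irrelevance. Qed.

Section GradedStar.
Variables (k : fieldType) (A B : gspace k) (n : int).

Lemma gstar_in_ex (i j : int) (e : i + j = n) : exists h : chom (star (A i) (B j)) (gstar A B n),
  forall a b, h (star_tens a b) = gstar_tens e a b.
Proof.
have [h hE] := @sum_in_ex k (bideg n) (fun p => star (A (sval p).1) (B (sval p).2)) (mk_bideg e).
by exists h => a b; rewrite hE.
Qed.

Definition gstar_in (i j : int) (e : i + j = n) : chom (star (A i) (B j)) (gstar A B n) :=
  projT1 (cid (gstar_in_ex e)).

Lemma gstar_inE (i j : int) (e : i + j = n) a b : gstar_in e (star_tens a b) = gstar_tens e a b.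
Proof. exact: (projT2 (cid (gstar_in_ex e))). Qed.

Lemma gstar_lift (D : linTopType k) (h : forall i j : int, i + j = n -> chom (star (A i) (B j)) D) :
  exists H : chom (gstar A B n) D,
    forall (i j : int) (e : i + j = n) a b, H (gstar_tens e a b) = h i j e (star_tens a b).
Proof.
have [H HE] := @sum_lift k (bideg n) (fun p => star (A (sval p).1) (B (sval p).2)) D
  (fun p => h _ _ (eqP (svalP p))).
exists H => i j e a b; rewrite /gstar_tens HE /=.
by rewrite (int_eq_irr (eqP _) e).
Qed.

Lemma gstar_dense (D : linTopType k) (h : chom (gstar A B n) D) (W : lsubspace D) :
  open (W : set D) ->
  (forall (i j : int) (e : i + j = n) a b, W (h (gstar_tens e a b))) -> forall x, W (h x).
Proof.
move=> oW H.
apply: (@sum_sub_ind k (bideg n) (fun p => star (A (sval p).1) (B (sval p).2)) D h).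
move=> [[i j] e] /=; move: (eqP e) => /= e'; rewrite (eq_irrelevance e (introT eqP e')) => x.
have [f fE] := @sum_in_ex k (bideg n) (fun p => star (A (sval p).1) (B (sval p).2)) (mk_bideg e').
rewrite -fE; apply: (star_dense (h := chom_comp h f)) => // a b.
rewrite chom_compE fE.
exact: H.
Qed.

End GradedStar.

Section GradedBang.
Variables (k : fieldType) (A B : gspace k) (n : int).

Let BM (p : bideg n) := bang (A (sval p).1) (B (sval p).2).

Lemma gbang_at_ex (i j : int) (e : i + j = n) : exists h : chom (gbang A B n) (bang (A i) (B j)),
  forall x, h x = (x : dprod (fun p => BM p : lmodType k)) (mk_bideg e).
Proof. exact: (@prod_at_ex k (bideg n) BM (mk_bideg e)). Qed.

Definition gbang_at (i j : int) (e : i + j = n) : chom (gbang A B n) (bang (A i) (B j)) :=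
  projT1 (cid (gbang_at_ex e)).

Lemma gbang_atE (i j : int) (e : i + j = n) x :
  gbang_at e x = (x : dprod (fun p => BM p : lmodType k)) (mk_bideg e).
Proof. exact: (projT2 (cid (gbang_at_ex e))). Qed.

Lemma gbang_at_tens (i j : int) (e e' : i + j = n) a b : gbang_at e (gbang_tens e' a b) = bang_tens a b.
Proof. by rewrite (int_eq_irr e e') gbang_atE /gbang_tens /single dfwith_in. Qed.

Lemma gbang_at_tens0 (i j i' j' : int) (e : i + j = n) (e' : i' + j' = n) a b : i != i' ->
  gbang_at e (gbang_tens e' a b) = 0.
Proof.
move=> ii'; rewrite gbang_atE /gbang_tens /single dfwith_out //.
by apply: contra ii' => /eqP[->].
Qed.

Lemma gbang_in_ex (i j : int) (e : i + j = n) : exists h : chom (bang (A i) (B j)) (gbang A B n),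
  forall a b, h (bang_tens a b) = gbang_tens e a b.
Proof.
have [h hE] := @prod_in_ex k (bideg n) BM (mk_bideg e).
by exists h => a b; rewrite hE.
Qed.

Lemma gbang_ext (x y : gbang A B n) :
  (forall (i j : int) (e : i + j = n), gbang_at e x = gbang_at e y) -> x = y.
Proof.
move=> xy; apply/functional_extensionality_dep => -[[i j] e].
move: (eqP e) => /= e'; rewrite (eq_irrelevance e (introT eqP e')).
by have := xy i j e'; rewrite !gbang_atE.
Qed.

Lemma gbang_lift (D : linTopType k) (h : forall i j : int, i + j = n -> chom D (bang (A i) (B j))) :
  exists H : chom D (gbang A B n),
    forall (i j : int) (e : i + j = n) y, gbang_at e (H y) = h i j e y.
Proof.
have [H HE] := @prod_lift k (bideg n) BM D (fun p => h _ _ (eqP (svalP p))).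
exists H => i j e y; rewrite gbang_atE; have := HE (mk_bideg e) y.
by rewrite /= (int_eq_irr (eqP _) e).
Qed.

Lemma gbang_build (h : forall i j : int, i + j = n -> bang (A i) (B j)) :
  exists y : gbang A B n, forall (i j : int) (e : i + j = n), gbang_at e y = h i j e.
Proof.
exists ((fun p => h _ _ (eqP (svalP p))) : dprod (fun p => BM p : lmodType k)) => i j e.
by rewrite gbang_atE /= (int_eq_irr (eqP _) e).
Qed.

Lemma gbang_dense (D : linTopType k) (h : chom (gbang A B n) D) (W : lsubspace D) :
  open (W : set D) ->
  (forall (i j : int) (e : i + j = n) a b, W (h (gbang_tens e a b))) -> forall x, W (h x).
Proof.
move=> oW H; apply: (@prod_dense k (bideg n) BM D h) => // -[[i j] e].
move: (eqP e) => /= e'; rewrite (eq_irrelevance e (introT eqP e')) => x.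
have [f fE] := @prod_in_ex k (bideg n) BM (mk_bideg e').
rewrite -fE; apply: (bang_dense (h := chom_comp h f)) => // a b.
rewrite chom_compE fE.
exact: H.
Qed.

Lemma gbang_complete : sep_complete (gbang A B n).
Proof. by apply: prod_complete => p; exact: bang_complete. Qed.

Lemma gbang_open_supp (W : lsubspace (gbang A B n)) : open (W : set (gbang A B n)) ->
  exists s : seq int,
    forall x, (forall (i j : int) (e : i + j = n), i \in s -> gbang_at e x = 0) -> W x.
Proof.
move=> /(@prod_open_supp k (bideg n) BM)[s sW]; exists [seq (sval p).1 | p <- s] => x x0.
apply: sW => -[[i j] e].
move: (eqP e) => /= e'; rewrite (eq_irrelevance e (introT eqP e')) => ps.
by have := x0 i j e' (map_f (fun p => (sval p).1) ps); rewrite gbang_atE.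
Qed.

End GradedBang.

Lemma gstar_eq (k : fieldType) (A B : gspace k) n (D : linTopType k)
    (h h' : chom (gstar A B n) D) : separated D ->
  (forall (i j : int) (e : i + j = n) a b, h (gstar_tens e a b) = h' (gstar_tens e a b)) ->
  forall x, h x = h' x.
Proof.
move=> sD hh' x; apply: separated_eq => // W oW.
apply: gstar_dense => // i j e a b; rewrite add_chomE opp_chomE hh' subrr.
exact: subspace0.
Qed.

Lemma gbang_eq (k : fieldType) (A B : gspace k) n (D : linTopType k)
    (h h' : chom (gbang A B n) D) : separated D ->
  (forall (i j : int) (e : i + j = n) a b, h (gbang_tens e a b) = h' (gbang_tens e a b)) ->
  forall x, h x = h' x.
Proof.
move=> sD hh' x; apply: separated_eq => // W oW.
apply: gbang_dense => // i j e a b; rewrite add_chomE opp_chomE hh' subrr.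
exact: subspace0.
Qed.

Opaque gstar gbang gstar_tens gbang_tens.

Section GradedPureTensors.
Variables (k : fieldType) (A B : gspace k) (i j n : int) (e : i + j = n).

Lemma gstar_tens_l_ex (a : A i) :
  exists h : chom (B j) (gstar A B n), forall b, h b = gstar_tens e a b.
Proof.
have [g gE] := star_tens_l_ex (B j) a.
by exists (chom_comp (gstar_in A B e) g) => b; rewrite -gstar_inE -gE.
Qed.

Lemma gstar_tens_r_ex (b : B j) :
  exists h : chom (A i) (gstar A B n), forall a, h a = gstar_tens e a b.
Proof.
have [g gE] := star_tens_r_ex (A i) b.
by exists (chom_comp (gstar_in A B e) g) => a; rewrite -gstar_inE -gE.
Qed.

Lemma gbang_tens_l_ex (a : A i) :
  exists h : chom (B j) (gbang A B n), forall b, h b = gbang_tens e a b.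
Proof.
have [f fE] := gbang_in_ex A B e; have [g gE] := bang_tens_l_ex (B j) a.
by exists (chom_comp f g) => b; rewrite -fE -gE.
Qed.

Lemma gbang_tens_r_ex (b : B j) :
  exists h : chom (A i) (gbang A B n), forall a, h a = gbang_tens e a b.
Proof.
have [f fE] := gbang_in_ex A B e; have [g gE] := bang_tens_r_ex (A i) b.
by exists (chom_comp f g) => a; rewrite -fE -gE.
Qed.

Definition gstar_tens_l a : chom (B j) (gstar A B n) := projT1 (cid (gstar_tens_l_ex a)).
Definition gstar_tens_r b : chom (A i) (gstar A B n) := projT1 (cid (gstar_tens_r_ex b)).
Definition gbang_tens_l a : chom (B j) (gbang A B n) := projT1 (cid (gbang_tens_l_ex a)).
Definition gbang_tens_r b : chom (A i) (gbang A B n) := projT1 (cid (gbang_tens_r_ex b)).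

Lemma gstar_tens_lE a b : gstar_tens_l a b = gstar_tens e a b.
Proof. exact: (projT2 (cid (gstar_tens_l_ex a))). Qed.
Lemma gstar_tens_rE a b : gstar_tens_r b a = gstar_tens e a b.
Proof. exact: (projT2 (cid (gstar_tens_r_ex b))). Qed.
Lemma gbang_tens_lE a b : gbang_tens_l a b = gbang_tens e a b.
Proof. exact: (projT2 (cid (gbang_tens_l_ex a))). Qed.
Lemma gbang_tens_rE a b : gbang_tens_r b a = gbang_tens e a b.
Proof. exact: (projT2 (cid (gbang_tens_r_ex b))). Qed.

Lemma gstar_tens_bilinear : is_bilinear (@gstar_tens k A B i j n e).
Proof.
split=> [b c x y|a c x y]; first by rewrite -!gstar_tens_rE chom_linear.
by rewrite -!gstar_tens_lE chom_linear.
Qed.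

Lemma gbang_tens_bilinear : is_bilinear (@gbang_tens k A B i j n e).
Proof.
split=> [b c x y|a c x y]; first by rewrite -!gbang_tens_rE chom_linear.
by rewrite -!gbang_tens_lE chom_linear.
Qed.

Lemma gstar_tensZl c a b : @gstar_tens k A B i j n e (c *: a) b = c *: gstar_tens e a b.
Proof. exact: linfZ (gstar_tens_bilinear.1 b) _ _. Qed.
Lemma gstar_tensZr c a b : @gstar_tens k A B i j n e a (c *: b) = c *: gstar_tens e a b.
Proof. exact: linfZ (gstar_tens_bilinear.2 a) _ _. Qed.
Lemma gbang_tens0l b : @gbang_tens k A B i j n e 0 b = 0.
Proof. exact: linf0 (gbang_tens_bilinear.1 b). Qed.
Lemma gbang_tens0r a : @gbang_tens k A B i j n e a 0 = 0.
Proof. exact: linf0 (gbang_tens_bilinear.2 a). Qed.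
Lemma gbang_tensZl c a b : @gbang_tens k A B i j n e (c *: a) b = c *: gbang_tens e a b.
Proof. exact: linfZ (gbang_tens_bilinear.1 b) _ _. Qed.
Lemma gbang_tensZr c a b : @gbang_tens k A B i j n e a (c *: b) = c *: gbang_tens e a b.
Proof. exact: linfZ (gbang_tens_bilinear.2 a) _ _. Qed.

End GradedPureTensors.

(** * Canonical maps between graded tensor products *)

(** Reduces a formula for a map defined by its values to the existence of a map
    with these values. *)
Ltac exhibit_chom :=
  rewrite /=; match goal with |- context [the_chom ?P] => apply: (@the_chomP _ _ _ P) end.

Section SummableFamilies.
Variables (k : fieldType) (I : eqType) (Y D : linTopType k) (h : I -> chom Y D).

Lemma sum_chomE (s : seq I) y : (\sum_(i <- s) h i : chom Y D) y = \sum_(i <- s) h i y.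
Proof. by elim/big_ind2: _ => // f u g v fu gv; rewrite add_chomE fu gv. Qed.

Lemma partial_sum_widen (W : lsubspace D) (s t : seq I) y : uniq s -> uniq t ->
  {subset s <= t} -> (forall i, i \notin s -> W (h i y)) ->
  W (\sum_(i <- t) h i y - \sum_(i <- s) h i y).
Proof.
move=> us ut st sW; rewrite (bigID (mem s)) /= -big_filter.
rewrite (perm_big s) /=; last first.
  apply: uniq_perm => //; first exact: filter_uniq.
  by move=> i; rewrite mem_filter; apply/andP/idP => [[]//|si]; split=> //; apply: st.
by rewrite addrAC subrr add0r; apply: lsub_sum => i; apply: sW.
Qed.

(** An infinite sum of maps, convergent because almost all terms lie in any given
    open subspace.  The conclusion evaluates it only where a single term survives,
    which is the case for pure tensors. *)
Lemma summable_chom : sep_complete D ->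
  (forall W : lsubspace D, open (W : set D) ->
     exists s : seq I, forall i, i \notin s -> forall y, W (h i y)) ->
  exists H : chom Y D, forall y i0, (forall i, i != i0 -> h i y = 0) -> H y = h i0 y.
Proof.
move=> [sD cD] hs.
have sex (W : lsubspace D) : exists s : seq I, uniq s /\
    (open (W : set D) -> forall i, i \notin s -> forall y, W (h i y)).
  have [oW|nW] := pselect (open (W : set D)); last by exists [::].
  have [s sW] := hs W oW; exists (undup s); split; first exact: undup_uniq.
  by move=> _ i; rewrite mem_undup; apply: sW.
have [s sP] := choice sex.
have lim y : exists c, forall W : lsubspace D, open (W : set D) ->
    W (c - \sum_(i <- s W) h i y).
  apply: cD => U V oU oV UV; have [us sU] := sP U; have [vs sV] := sP V.
  pose t := undup (s U ++ s V).
  apply: (lsub_trans (y := \sum_(i <- t) h i y)).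
    apply: lsubBC; apply: partial_sum_widen => //; first exact: undup_uniq.
      by move=> i it; rewrite mem_undup mem_cat it.
    by move=> i /sU; move=> /(_ oU y)/UV.
  apply: partial_sum_widen => //; first exact: undup_uniq.
    by move=> i it; rewrite mem_undup mem_cat it orbT.
  by move=> i /sV; apply.
have [c cP] := choice lim.
have lc : linear c.
  move=> a x y; apply/eqP; rewrite -subr_eq0; apply/eqP; apply: sD => W oW.
  apply: lsub_trans (cP (a *: x + y) W oW) _; apply: lsubBC.
  rewrite -!sum_chomE chom_linear !sum_chomE opprD addrACA -scalerBr.
  by apply: lsubD; [apply/lsubZ/cP|apply/cP].
have [|H HE] := build_chom lc.
  move=> W oW; have [U [oU UW]] := chom_open (\sum_(i <- s W) h i) oW.
  exists U; split=> // y /UW; rewrite sum_chomE; apply: lsub_shift; exact: cP.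
exists H => y i0 y0; rewrite HE; apply/eqP; rewrite -subr_eq0; apply/eqP; apply: sD => W oW.
apply: lsub_trans (cP y W oW) _; have [us sW] := sP W.
have [is0|nis0] := boolP (i0 \in s W).
  by rewrite (bigD1_seq i0) //= big1 ?addr0 ?subrr //; apply: subspace0.
rewrite big1_seq; last by move=> i /= si; apply: y0; apply: contraNneq nis0 => <-.
by rewrite sub0r; apply/lsubN/sW.
Qed.

End SummableFamilies.

Section GradedMaps.
Variables (k : fieldType) (A A' B B' : gspace k) (d d' : int).
Variables (f : ghom A A' d) (g : ghom B B' d').

Lemma gstar_mapE (n n' : int) (e0 : n + (d + d') = n') (i j i' j' : int) (e : i + j = n)
    (e' : i' + j' = n') (ei : i + d = i') (ej : j + d' = j') a b :
  (f *og g) n n' e0 (gstar_tens e a b) =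
  (-1) ^ (d' * i) *: gstar_tens e' (f i i' ei a) (g j j' ej b).
Proof.
move: i j i' j' e e' ei ej a b; exhibit_chom.
have e1 i j : i + j = n -> (i + d) + (j + d') = n' by lia.
have [H HE] := gstar_lift (n := n) (fun i j e =>
  (-1) ^ (d' * i) *: chom_comp (gstar_in A' B' (e1 i j e))
    (star_hom (f i _ erefl) (g j _ erefl))).
exists H => i j i' j' e e' ei ej a b; subst i' j'; rewrite HE scale_chomE; congr (_ *: _).
rewrite chom_compE star_homE gstar_inE.
by rewrite (int_eq_irr (e1 i j e) e').
Qed.

Lemma gbang_mapE (n n' : int) (e0 : n + (d + d') = n') (i j i' j' : int) (e : i + j = n)
    (e' : i' + j' = n') (ei : i + d = i') (ej : j + d' = j') a b :
  (f !og g) n n' e0 (gbang_tens e a b) =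
  (-1) ^ (d' * i) *: gbang_tens e' (f i i' ei a) (g j j' ej b).
Proof.
move: i j i' j' e e' ei ej a b; exhibit_chom.
have e1 i j : i + j = n' -> (i - d) + (j - d') = n by lia.
have [H HE] := gbang_lift (n := n') (fun i j e =>
  (-1) ^ (d' * (i - d)) *: chom_comp (bang_hom (f _ _ (subrK d i)) (g _ _ (subrK d' j)))
    (gbang_at A B (e1 i j e))).
exists H => i j i' j' e e' ei ej a b; apply: gbang_ext => p q e2.
rewrite HE chomZ scale_chomE chom_compE.
move: (p - d) (q - d') (subrK d p) (subrK d' q) (e1 p q e2) => i1 j1 ei1 ej1 e3.
have [ii1|ni] := eqVneq i1 i; last first.
  rewrite gbang_at_tens0 // gbang_at_tens0 ?chom0 ?scaler0 //.
  by apply: contraNneq ni => pi; apply/eqP; lia.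
have jj1 : j1 = j by lia.
by subst i1 j1 i' j' p q; rewrite gbang_at_tens bang_homE gbang_at_tens.
Qed.

End GradedMaps.

Section GradedSwaps.
Variables (k : fieldType) (A B : gspace k).

Lemma star_swapE (n n' : int) (e0 : n + 0 = n') (i j : int) (e : i + j = n) (e' : j + i = n') a b :
  star_swap A B n n' e0 (gstar_tens e a b) = (-1) ^ (i * j) *: gstar_tens e' b a.
Proof.
move: i j e e' a b; exhibit_chom.
have e1 i j : i + j = n -> j + i = n' by lia.
have [H HE] := gstar_lift (n := n) (fun i j e =>
  (-1) ^ (i * j) *: chom_comp (gstar_in B A (e1 i j e)) (star_flip (A i) (B j))).
exists H => i j e e' a b; rewrite HE scale_chomE; congr (_ *: _).
rewrite chom_compE star_flipE gstar_inE.
by rewrite (int_eq_irr (e1 i j e) e').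
Qed.

Lemma bang_swapE (n n' : int) (e0 : n + 0 = n') (i j : int) (e : i + j = n) (e' : j + i = n') a b :
  bang_swap A B n n' e0 (gbang_tens e a b) = (-1) ^ (i * j) *: gbang_tens e' b a.
Proof.
move: i j e e' a b; exhibit_chom.
have e1 i j : i + j = n' -> j + i = n by lia.
have [H HE] := gbang_lift (n := n') (fun j i e =>
  (-1) ^ (i * j) *: chom_comp (bang_flip (A i) (B j)) (gbang_at A B (e1 j i e))).
exists H => i j e e' a b; apply: gbang_ext => q p e2.
rewrite HE chomZ scale_chomE chom_compE.
have [qj|nq] := eqVneq q j; last first.
  rewrite [in RHS]gbang_at_tens0 // gbang_at_tens0 ?chom0 ?scaler0 //.
  by apply: contraNneq nq => pi; apply/eqP; lia.
have pi : p = i by lia.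
by subst p q; rewrite !gbang_at_tens bang_flipE.
Qed.

End GradedSwaps.

Section GradedUnits.
Variables (k : fieldType) (A : gspace k).

Lemma star_lunitE (n n' : int) (e0 : n + 0 = n') (e : 0 + n = n') a :
  star_lunit A n n' e0 a = gstar_tens e (gunit1 k) a.
Proof.
move: a; exhibit_chom.
exists (@gstar_tens_l k (gunit k) A _ _ _ e (gunit1 k)) => e' a.
by rewrite gstar_tens_lE (int_eq_irr e e').
Qed.

Lemma star_runitE (n n' : int) (e0 : n + 0 = n') (e : n + 0 = n') a :
  star_runit A n n' e0 a = gstar_tens e a (gunit1 k).
Proof.
move: a; exhibit_chom.
exists (@gstar_tens_r k A (gunit k) _ _ _ e (gunit1 k)) => e' a.
by rewrite gstar_tens_rE (int_eq_irr e e').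
Qed.

Lemma gunit_val_linear i : linear (@gunit_val k i : gunit k i -> k^o).
Proof. by []. Qed.

Lemma gunit_valZ i c (x : gunit k i) : gunit_val (c *: x) = c * gunit_val x.
Proof. by []. Qed.

Lemma gunit_val_0 i : gunit_val (0 : gunit k i) = 0.
Proof. by []. Qed.

Lemma gunit_chom_ex i (D : linTopType k) (h : gunit k i -> D) : linear h ->
  exists H : chom (gunit k i) D, forall x, H x = h x.
Proof.
move=> lh; apply: (build_chom lh) => W oW; exists (preim_sub lh W); split=> //.
exact: discrete_open.
Qed.

Definition gunit_valc i : chom (gunit k i) (scalars k) :=
  projT1 (cid (gunit_chom_ex (D := scalars k) (@gunit_val_linear i))).

Lemma gunit_valcE i x : gunit_valc i x = gunit_val x.
Proof. exact: (projT2 (cid (gunit_chom_ex (D := scalars k) (@gunit_val_linear i)))). Qed.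

Lemma gunit_val1 : gunit_val (gunit1 k) = 1.
Proof. by []. Qed.

Lemma gunit_inj i (x y : gunit k i) : gunit_val x = gunit_val y -> x = y.
Proof. by move=> xy; apply: val_inj. Qed.

Lemma gunit_val0 i (x : gunit k i) : i <> 0 -> gunit_val x = 0.
Proof. by move: (valP (x : {y | y \in sub_pred (unit_sub k i)})) => /asboolP; apply. Qed.

Lemma gunit_eq1 (x : gunit k 0) : x = gunit_val x *: gunit1 k.
Proof. by apply: gunit_inj; rewrite gunit_valZ gunit_val1 mulr1. Qed.

Hypothesis cA : forall i, sep_complete (A i).

Lemma bang_lunitE (n n' : int) (e0 : n + 0 = n') (i : int) (e : i + n' = n) u a :
  bang_lunit A n n' e0 (gbang_tens e u a) = gunit_val u *: a.
Proof.
have [i0|/eqP ni0] := eqVneq i 0; last first.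
  have -> : u = 0 by apply: gunit_inj; rewrite gunit_val0.
  by rewrite gbang_tens0l chom0 gunit_val_0 scale0r.
subst i; rewrite [in LHS](gunit_eq1 u) gbang_tensZl chomZ; congr (_ *: _).
move: a; exhibit_chom.
exists (chom_comp (slice (A n') (gunit_valc 0)) (gbang_at (gunit k) A e)) => e' a.
rewrite chom_compE gbang_at_tens sliceE //.
by rewrite gunit_valcE gunit_val1 scale1r.
Qed.

Lemma bang_runitE (n n' : int) (e0 : n + 0 = n') (i : int) (e : n' + i = n) u a :
  bang_runit A n n' e0 (gbang_tens e a u) = gunit_val u *: a.
Proof.
have [i0|/eqP ni0] := eqVneq i 0; last first.
  have -> : u = 0 by apply: gunit_inj; rewrite gunit_val0.
  by rewrite gbang_tens0r chom0 gunit_val_0 scale0r.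
subst i; rewrite [in LHS](gunit_eq1 u) gbang_tensZr chomZ; congr (_ *: _).
move: a; exhibit_chom.
exists (chom_comp (slice (A n') (gunit_valc 0)) (chom_comp (bang_flip (A n') (gunit k 0)) (gbang_at A (gunit k) e))) => e' a.
rewrite !chom_compE gbang_at_tens bang_flipE sliceE //.
by rewrite gunit_valcE gunit_val1 scale1r.
Qed.

End GradedUnits.

Section MixedLifts.
Variables (k : fieldType) (A B C G : linTopType k).

(** In this and the two following lifts, [g] is a parameter rather than the pure
    tensor map, so as to reach a graded tensor product [G] in one step. *)
Lemma star_bang_lift (g : A -> chom B G) : is_bilinear (fun a => g a) ->
  star_cont (fun a => g a) ->
  exists h : chom (star A (bang B C)) (bang G C),
    forall a b c, h (star_tens a (bang_tens b c)) = bang_tens (g a b) c.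
Proof.
move=> bg cg; have [sD cD] := bang_complete G C.
pose h a := bang_hom (g a) (chom_id C).
have [|||H HE] := @star_lift k A (bang B C) (bang G C) (fun a => h a).
- apply: param_bilinear => // x y c u v; rewrite !bang_homE bg.1.
  exact: (bang_tens_bilinear _ _).1.
- apply: param_star_cont => W /bang_tens_cont[U [Z [oU oZ UW ZW]]].
  have [[U1 [V1 [oU1 oV1 UV1]]] _ r] := cg U oU; split.
    exists U1, V1, Z; split=> // u x y Uu [Vx|Zy]; rewrite bang_homE; last exact: ZW.
    by apply: UW; apply: UV1.
  move=> x y; have [U2 [oU2 U2P]] := r x; exists U2; split=> // u /U2P ?.
  by rewrite bang_homE; apply: UW.
- exact: bang_complete.
by exists H => a b c; rewrite HE bang_homE.
Qed.

Lemma bang_star_lift (g : C -> chom B G) : is_bilinear (fun c => g c) ->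
  star_cont (fun c => g c) ->
  exists h : chom (star (bang A B) C) (bang A G),
    forall a b c, h (star_tens (bang_tens a b) c) = bang_tens a (g c b).
Proof.
move=> bg cg; have [sD cD] := bang_complete A G.
pose h c := bang_hom (chom_id A) (g c).
have [|||H HE] := @star_lift k C (bang A B) (bang A G) (fun c => h c).
- apply: param_bilinear => // x y c u v; rewrite !bang_homE bg.1.
  exact: (bang_tens_bilinear _ _).2.
- apply: param_star_cont => W /bang_tens_cont[Z [U [oZ oU ZW UW]]].
  have [[U1 [V1 [oU1 oV1 UV1]]] _ r] := cg U oU; split.
    exists U1, Z, V1; split=> // u x y Uu [Zx|Vy]; rewrite bang_homE; first exact: ZW.
    by apply: UW; apply: UV1.
  move=> x y; have [U2 [oU2 U2P]] := r y; exists U2; split=> // u /U2P ?.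
  by rewrite bang_homE; apply: UW.
- exact: bang_complete.
exists (chom_comp H (star_flip (bang A B) C)) => a b c.
by rewrite chom_compE star_flipE HE bang_homE.
Qed.

Lemma bang_assoc_lift (g : C -> chom B G) : is_bilinear (fun c => g c) ->
  bang_cont (fun c => g c) ->
  exists h : chom (bang (bang A B) C) (bang A G),
    forall a b c, h (bang_tens (bang_tens a b) c) = bang_tens a (g c b).
Proof.
move=> bg cg; have [sD cD] := bang_complete A G.
pose h c := bang_hom (chom_id A) (g c).
have [|||H HE] := @bang_lift k (bang A B) C (bang A G) (fun y c => h c y).
- apply: (@bilinear_flip _ _ _ _ (fun c y => h c y)).
  apply: param_bilinear => // x y c u v; rewrite !bang_homE bg.1.
  exact: (bang_tens_bilinear _ _).2.
- apply: param_bang_cont => W /bang_tens_cont[Z [U [oZ oU ZW UW]]].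
  have [U1 [V1 [oU1 oV1 U1P V1P]]] := cg U oU.
  exists Z, V1, U1; split=> // x y z; rewrite bang_homE => -[Zx|Vy|Uz]; first exact: ZW.
    by apply/UW/V1P.
  by apply/UW/U1P.
- exact: bang_complete.
by exists H => a b c; rewrite HE bang_homE.
Qed.

Lemma bang_bang_dense (D : linTopType k) (h : chom (bang (bang A B) C) D) (W : lsubspace D) :
  open (W : set D) -> (forall a b c, W (h (bang_tens (bang_tens a b) c))) -> forall z, W (h z).
Proof.
move=> oW H; apply: bang_dense => // y c; have [r rE] := bang_tens_r_ex (bang A B) c.
rewrite -rE; apply: (bang_dense (h := chom_comp h r)) => // a b.
by rewrite chom_compE rE.
Qed.

End MixedLifts.

Section GradedMixed.
Variables (k : fieldType) (A B C : gspace k).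

Lemma gstar_tens_cont i j n (e : i + j = n) : star_cont (@gstar_tens k A B i j n e).
Proof.
move=> W oW; have [U [oU UW]] := chom_open (gstar_in A B e) oW.
have [[V [Z [oV oZ VZ]]] l r] := star_tens_cont oU; split=> [|a|b].
- by exists V, Z; split=> // u v Vu Zv; rewrite -gstar_inE; apply: UW; apply: VZ.
- have [X [oX XP]] := l a; exists X; split=> // v Xv.
  by rewrite -gstar_inE; apply: UW; apply: XP.
- have [X [oX XP]] := r b; exists X; split=> // v Xv.
  by rewrite -gstar_inE; apply: UW; apply: XP.
Qed.

Lemma gbang_tens_cont i j n (e : i + j = n) : bang_cont (@gbang_tens k A B i j n e).
Proof.
have [f fE] := gbang_in_ex A B e.
move=> W oW; have [U [oU UW]] := chom_open f oW.
have [V [Z [oV oZ l r]]] := bang_tens_cont oU; exists V, Z; split=> // x y xy.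
  by rewrite -fE; apply: UW; apply: l.
by rewrite -fE; apply: UW; apply: r.
Qed.

End GradedMixed.

Section GradedAssociators.
Variables (k : fieldType) (A B C : gspace k).

Lemma gstar_tens_l_fun (A' B' : gspace k) i j n (e : i + j = n) :
  (fun a : A' i => (@gstar_tens_l k A' B' i j n e a : B' j -> _)) = gstar_tens e.
Proof. by apply/funext => a; apply/funext => b; rewrite gstar_tens_lE. Qed.

(** The component of [star_bang] from bidegree [(i, q)] to bidegree [(p, l)]. *)
Lemma star_bang_at_ex (i j l p q : int) (e1 : j + l = q) (e3 : i + j = p) :
  exists h : chom (star (A i) (gbang B C q)) (bang (gstar A B p) (C l)),
    forall a y, h (star_tens a y) = bang_hom (gstar_tens_l B e3 a) (chom_id (C l)) (gbang_at B C e1 y).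
Proof.
have [||h hE] := @star_bang_lift k (A i) (B j) (C l) _ (@gstar_tens_l k A B i j p e3).
- by rewrite gstar_tens_l_fun; exact: gstar_tens_bilinear.
- by rewrite gstar_tens_l_fun; exact: gstar_tens_cont.
exists (chom_comp h (star_hom (chom_id (A i)) (gbang_at B C e1))) => a y.
rewrite chom_compE star_homE chom_idE.
have [r rE] := star_tens_l_ex (bang (B j) (C l)) a.
rewrite -rE -chom_compE; apply: bang_eq => [|b c].
  by have [] := bang_complete (gstar A B p) (C l).
by rewrite chom_compE rE hE bang_homE gstar_tens_lE chom_idE; reflexivity.
Qed.

Lemma star_bangE (n n' : int) (e0 : n + 0 = n') (i j l p q : int) (e1 : j + l = q) (e2 : i + q = n)
    (e3 : i + j = p) (e4 : p + l = n') a b c :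
  star_bang A B C n n' e0 (gstar_tens e2 a (gbang_tens e1 b c)) =
  gbang_tens e4 (gstar_tens e3 a b) c.
Proof.
move: i j l p q e1 e2 e3 e4 a b c; exhibit_chom.
have e1 (p l i q : int) : p + l = n' -> i + q = n -> (p - i) + l = q by lia.
have e3 (i p : int) : i + (p - i) = p by lia.
have [H HE] := gbang_lift (n := n') (fun p l e4 =>
  projT1 (cid (gstar_lift (n := n) (fun i q e2 =>
    projT1 (cid (star_bang_at_ex (e1 p l i q e4 e2) (e3 i p))))))).
exists H => i j l p q e1' e2 e3' e4 a b c; apply: gbang_ext => p1 l1 e4'; rewrite HE.
case: (cid (gstar_lift _)) => /= F FE; rewrite FE => {F FE}.
case: (cid (star_bang_at_ex _ _)) => /= h hE; rewrite hE => {h hE}.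
move: (e1 p1 l1 i q e4' e2) (e3 i p1).
have [pp1|np] := eqVneq p1 p; last first.
  move=> e5 e6; rewrite gbang_at_tens0 ?gbang_at_tens0 ?chom0 //.
  by apply: contraNneq np => ?; apply/eqP; lia.
have pij : p1 - i = j by lia.
have ll1 : l1 = l by lia.
subst p1 l1; rewrite pij => e5 e6; rewrite !gbang_at_tens bang_homE gstar_tens_lE chom_idE.
by rewrite (int_eq_irr e6 e3').
Qed.

Lemma bang_star_at_ex (i j l p q : int) (e1 : i + j = p) (e3 : j + l = q) :
  exists h : chom (star (gbang A B p) (C l)) (bang (A i) (gstar B C q)),
    forall y c, h (star_tens y c) = bang_hom (chom_id (A i)) (@gstar_tens_r k B C _ _ _ e3 c) (gbang_at A B e1 y).
Proof.
have eg : (fun c : C l => (@gstar_tens_r k B C j l q e3 c : B j -> _)) = fun c b => gstar_tens e3 b c.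
  by apply/funext => c; apply/funext => b; rewrite gstar_tens_rE.
have [||h hE] := @bang_star_lift k (A i) (B j) (C l) _ (@gstar_tens_r k B C j l q e3).
- by rewrite eg; apply: bilinear_flip; exact: gstar_tens_bilinear.
- rewrite eg => W /gstar_tens_cont-/(_ _ _ e3)[[U [V [oU oV UV]]] L R].
  by split=> //; exists V, U; split=> // u v Uu Vv; apply: UV.
exists (chom_comp h (star_hom (gbang_at A B e1) (chom_id (C l)))) => y c.
rewrite chom_compE star_homE chom_idE.
have [r rE] := star_tens_r_ex (bang (A i) (B j)) c.
rewrite -rE -chom_compE; apply: bang_eq => [|a b].
  by have [] := bang_complete (A i) (gstar B C q).
by rewrite chom_compE rE hE bang_homE gstar_tens_rE chom_idE; reflexivity.
Qed.

Lemma bang_starE (n n' : int) (e0 : n + 0 = n') (i j l p q : int) (e1 : i + j = p) (e2 : p + l = n)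
    (e3 : j + l = q) (e4 : i + q = n') a b c :
  bang_star A B C n n' e0 (gstar_tens e2 (gbang_tens e1 a b) c) =
  gbang_tens e4 a (gstar_tens e3 b c).
Proof.
move: i j l p q e1 e2 e3 e4 a b c; exhibit_chom.
have e1 (i q p l : int) : i + q = n' -> p + l = n -> i + (p - i) = p by lia.
have e3 (i q p l : int) : i + q = n' -> p + l = n -> (p - i) + l = q by lia.
have [H HE] := gbang_lift (n := n') (fun i q e4 =>
  projT1 (cid (gstar_lift (n := n) (fun p l e2 =>
    projT1 (cid (bang_star_at_ex (e1 i q p l e4 e2) (e3 i q p l e4 e2))))))).
exists H => i j l p q e1' e2 e3' e4 a b c; apply: gbang_ext => i1 q1 e4'; rewrite HE.
case: (cid (gstar_lift _)) => /= F FE; rewrite FE => {F FE}.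
case: (cid (bang_star_at_ex _ _)) => /= h hE; rewrite hE => {h hE}.
move: (e1 i1 q1 p l e4' e2) (e3 i1 q1 p l e4' e2).
have [ii1|ni] := eqVneq i1 i; last first.
  by move=> e5 e6; rewrite gbang_at_tens0 ?gbang_at_tens0 ?chom0.
have pij : p - i1 = j by lia.
have qq1 : q1 = q by lia.
subst i1 q1; rewrite pij => e5 e6; rewrite !gbang_at_tens bang_homE gstar_tens_rE chom_idE.
by rewrite (int_eq_irr e6 e3').
Qed.

(** The second clause bounds the whole image of the component, as needed for the
    summation in [bang_assocE]. *)
Lemma bang_assoc_at_ex (i j l p q : int) (e1 : i + j = p) (e3 : j + l = q) :
  exists h : chom (bang (gbang A B p) (C l)) (bang (A i) (gbang B C q)),
    (forall y c, h (bang_tens y c) =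
       bang_hom (chom_id (A i)) (@gbang_tens_r k B C _ _ _ e3 c) (gbang_at A B e1 y)) /\
    forall W : lsubspace (bang (A i) (gbang B C q)), open (W : set (bang (A i) (gbang B C q))) ->
      (forall a b c, W (bang_tens a (gbang_tens e3 b c))) -> forall z, W (h z).
Proof.
have eg : (fun c : C l => (@gbang_tens_r k B C j l q e3 c : B j -> _)) = fun c b => gbang_tens e3 b c.
  by apply/funext => c; apply/funext => b; rewrite gbang_tens_rE.
have [||h hE] := @bang_assoc_lift k (A i) (B j) (C l) _ (@gbang_tens_r k B C j l q e3).
- by rewrite eg; apply: bilinear_flip; exact: gbang_tens_bilinear.
- rewrite eg => W /gbang_tens_cont-/(_ _ _ e3)[U [V [oU oV L R]]].
  by exists V, U; split=> // x y xy; [apply: R|apply: L].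
exists (chom_comp h (bang_hom (gbang_at A B e1) (chom_id (C l)))); split=> [y c|W oW HW z].
  rewrite chom_compE bang_homE chom_idE.
  have [r rE] := bang_tens_r_ex (bang (A i) (B j)) c.
  rewrite -rE -chom_compE; apply: bang_eq => [|a b].
    by have [] := bang_complete (A i) (gbang B C q).
  by rewrite chom_compE rE hE bang_homE gbang_tens_rE chom_idE; reflexivity.
rewrite chom_compE; apply: bang_bang_dense => // a b c.
by rewrite hE gbang_tens_rE.
Qed.

(** Both the source and its factors are products, so each component of the target
    receives contributions from infinitely many degrees [l] of the last factor.
    They are summable: an open subspace of the target contains the tensors of [A]
    with all but finitely many of the components of [B [!] C]. *)
Lemma bang_assocE (n n' : int) (e0 : n + 0 = n') (i j l p q : int) (e1 : i + j = p) (e2 : p + l = n)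
    (e3 : j + l = q) (e4 : i + q = n') a b c :
  bang_assoc A B C n n' e0 (gbang_tens e2 (gbang_tens e1 a b) c) =
  gbang_tens e4 a (gbang_tens e3 b c).
Proof.
move: i j l p q e1 e2 e3 e4 a b c; exhibit_chom.
have e1 (i l : int) : i + (n - l - i) = n - l by lia.
have e2 (l : int) : n - l + l = n by lia.
have e3 (i q l : int) : i + q = n' -> (n - l - i) + l = q by lia.
pose F i q (e : i + q = n') l := chom_comp (projT1 (cid (bang_assoc_at_ex (e1 i l) (e3 i q l e))))
  (gbang_at (gbang A B) C (e2 l)).
have Fsum i q e : exists H : chom (gbang (gbang A B) C n) (bang (A i) (gbang B C q)),
    forall y l0, (forall l, l != l0 -> F i q e l y = 0) -> H y = F i q e l0 y.
  apply: summable_chom; first exact: bang_complete.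
  move=> W oW; have [U [V [oU oV UW VW]]] := bang_tens_cont oW.
  have [s sV] := gbang_open_supp oV; exists [seq q - j | j <- s] => l ls y.
  rewrite /F chom_compE.
  case: (cid _) => /= h [_]; apply=> // a b c; apply/VW/sV => j1 l1 e' j1s.
  apply: gbang_at_tens0; apply: contraNneq ls => j1E; apply/mapP.
  by exists j1 => //; lia.
have [H HE] := gbang_lift (fun i q e => projT1 (cid (Fsum i q e))).
exists H => i j l p q e1' e2' e3' e4 a b c; apply: gbang_ext => i1 q1 e4'; rewrite HE.
case: (cid (Fsum i1 q1 e4')) => /= G GE; rewrite (GE _ l) {G GE}; last first.
  move=> l1 nl; rewrite /F chom_compE.
  by rewrite gbang_at_tens0 ?chom0 //; apply: contraNneq nl => ?; apply/eqP; lia.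
rewrite /F chom_compE.
have pE : p = n - l by lia.
move: e1' e2'; rewrite pE => e1' e2'; rewrite gbang_at_tens; case: (cid _) => /= h [hE _]; rewrite hE => {h hE}.
move: (e1 i1 l) (e3 i1 q1 l e4').
have [ii1|ni] := eqVneq i1 i; last first.
  by move=> e5 e6; rewrite gbang_at_tens0 ?gbang_at_tens0 ?chom0.
have pij : n - l - i1 = j by lia.
have qq1 : q1 = q by lia.
subst i1 q1; rewrite pij => e5 e6; rewrite !gbang_at_tens bang_homE gbang_tens_rE chom_idE.
by rewrite (int_eq_irr e6 e3').
Qed.

End GradedAssociators.

(** * Slices of completed tensor products *)

(** A subspace that is maximal among those containing [W] and avoiding [x] is a
    complement of the line of [x]. *)
Lemma separating_functional (k : fieldType) (V : lmodType k) (W : lsubspace V) x :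
  ~ W x -> exists f : V -> k^o, [/\ linear f, forall w, W w -> f w = 0 & f x = 1].
Proof.
move=> nWx.
pose T := {U : lsubspace V | (forall w, W w -> U w) /\ ~ U x}.
pose R (U U' : T) := `[< forall v, sval U v -> sval U' v >].
have t0 : T by exists W.
have [||C totC|[M [WM nMx]] maxM] := @ZL_preorder T t0 R.
- by move=> U; apply/asboolP.
- by move=> U1 U2 U3 /asboolP H1 /asboolP H2; apply/asboolP => v /H1/H2.
- pose Y v := W v \/ exists2 U : T, C U & sval U v.
  have Y0 : Y 0 by left; apply: subspace0.
  have YP (a : k) u v : Y u -> Y v -> Y (a *: u + v).
    move=> [Wu|[U CU Uu]] [Wv|[U' CU' U'v]].
    + by left; apply: subspaceP.
    + by right; exists U' => //; apply: subspaceP => //; apply: (svalP U').1.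
    + by right; exists U => //; apply: subspaceP => //; apply: (svalP U).1.
    have [/asboolP UU'|/asboolP U'U] := totC _ _ CU CU'.
      by right; exists U' => //; apply: subspaceP => //; apply: UU'.
    by right; exists U => //; apply: subspaceP => //; apply: U'U.
  have YT : (forall w, W w -> Subspace Y0 YP w) /\ ~ Subspace Y0 YP x.
    split=> [w Ww|[//|[U CU Ux]]]; first by left.
    exact: (svalP U).2.
  exists (exist _ (Subspace Y0 YP) YT) => U CU; apply/asboolP => v Uv.
  by right; exists U.
have proj v : exists a : k, M (v - a *: x).
  apply: contrapT => nv.
  (* The span of [M] and [v] contains [x], or else it is [M] by maximality. *)
  pose Y u := exists c : k, M (u - c *: v).
  have Y0 : Y 0 by exists 0; rewrite scale0r subr0; apply: subspace0.
  have YP (a : k) u w : Y u -> Y w -> Y (a *: u + w).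
    move=> [c Mu] [c' Mw]; exists (a * c + c').
    have -> : a *: u + w - (a * c + c') *: v = a *: (u - c *: v) + (w - c' *: v).
      by rewrite scalerBr scalerDl scalerA opprD addrACA.
    exact: subspaceP.
  have MY u : M u -> Subspace Y0 YP u by exists 0; rewrite scale0r subr0.
  have nYx : ~ Subspace Y0 YP x.
    move=> [c Mc]; have [c0|c0] := eqVneq c 0.
      by move: Mc; rewrite c0 scale0r subr0.
    apply: nv; exists c^-1; have := lsubZ (- c^-1) Mc.
    by rewrite scalerBr !scaleNr scalerA mulVf // scale1r opprK addrC.
  have YT : (forall w, W w -> Subspace Y0 YP w) /\ ~ Subspace Y0 YP x.
    by split=> // w /WM/MY.
  have /asboolP/(_ v) := maxM (exist _ (Subspace Y0 YP) YT) (asboolT MY).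
  move=> /= H; apply: nv; exists 0; rewrite scale0r subr0; apply: H.
  by exists 1; rewrite scale1r subrr; apply: subspace0.
have [f fP] := choice proj.
have uniqf v (a : k) : M (v - a *: x) -> f v = a.
  move=> Ma; apply/eqP; rewrite -subr_eq0; apply/negPn/negP => nz; apply: (nMx).
  have : M ((f v - a) *: x).
    have := lsubB Ma (fP v); rewrite opprD addrACA subrr add0r opprK addrC -scaleNr.
    by rewrite -scalerDl.
  by move=> /(lsubZ (f v - a)^-1); rewrite scalerA mulVf // scale1r.
exists f; split.
- move=> a u v; apply: uniqf.
  have -> : a *: u + v - (a * f u + f v : k) *: x = a *: (u - f u *: x) + (v - f v *: x).
    by rewrite scalerBr scalerDl scalerA opprD addrACA.
  exact: subspaceP (fP u) (fP v).
- by move=> w /WM Mw; apply: uniqf; rewrite scale0r subr0.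
- by apply: uniqf; rewrite scale1r subrr; apply: subspace0.
Qed.

Section FiniteExtension.
Variables (k : fieldType) (V : lmodType k) (U : lsubspace V) (n : nat) (a : nat -> V).

(** Only the first [n] values of [a] matter; functions on [nat] keep the type of
    the family independent of [n]. *)
Definition adjoin : lsubspace V.
Proof.
exists (fun v => exists u c, U u /\ v = u + \sum_(i < n) (c i : k) *: a i).
  exists 0, (fun=> 0); split; first exact: subspace0.
  by rewrite big1 ?addr0 // => i _; rewrite scale0r.
move=> b _ _ [u [c [Uu ->]]] [u' [c' [Uu' ->]]].
exists (b *: u + u'), (fun i => b * c i + c' i); split; first exact: subspaceP.
rewrite scalerDr addrACA scaler_sumr -big_split /=; congr (_ + _).
by apply: eq_bigr => i _; rewrite scalerDl scalerA.
Defined.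

Lemma adjoin_sub u : U u -> adjoin u.
Proof.
by move=> Uu; exists u, (fun=> 0); rewrite big1 ?addr0 // => i _; rewrite scale0r.
Qed.

Lemma adjoin_gen i : (i < n)%N -> adjoin (a i).
Proof.
move=> ni; exists 0, (fun j : 'I_n => (j == Ordinal ni)%:R); split; first exact: subspace0.
rewrite (bigD1 (Ordinal ni)) //= eqxx scale1r add0r big1 ?addr0 // => j /negPf ->.
by rewrite scale0r.
Qed.

End FiniteExtension.

(** Algebraic core of the injectivity of slicing, by induction on the number of
    terms.  If the last [x i] depends on the others modulo [U], it is absorbed into
    them; otherwise a functional that separates it shows that the last [y i] lies
    in [W]. *)
Lemma slices_separate (k : fieldType) (A B X : lmodType k) (b : A -> B -> X)
    (U : lsubspace A) (W : lsubspace B) (Q : lsubspace X) :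
  is_bilinear b ->
  (forall u y, U u -> Q (b u y)) -> (forall x w, W w -> Q (b x w)) ->
  forall (n : nat) (x : nat -> A) (y : nat -> B),
  (forall f : A -> k^o, linear f -> (forall u, U u -> f u = 0) ->
     W (\sum_(i < n) f (x i) *: y i)) ->
  Q (\sum_(i < n) b (x i) (y i)).
Proof.
move=> [bl br] QU QW; elim=> [|n IH] x y H; first by rewrite big_ord0; apply: subspace0.
rewrite big_ord_recr /=.
have [[u [c [Uu xnE]]]|nK] := pselect (adjoin U n x (x n)).
  rewrite xnE (linfD (bl _)) (linf_sum (bl _)) addrCA -big_split /=.
  apply: lsubD; first exact: QU.
  (* [insub] extends the coefficients [c] from ordinals to [nat]. *)
  rewrite (eq_bigr (fun i : 'I_n => b (x i) (if insub (i : nat) is Some j then y i + (c : 'I_n -> k) j *: y n else 0))).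
    apply: (IH x (fun i => if insub i is Some j then y i + c j *: y n else 0)) => f lf fU.
    have := H f lf fU; rewrite big_ord_recr /= xnE (linfD lf) (linf_sum lf) fU // add0r.
    rewrite scaler_suml -big_split /=; congr (W _); apply: eq_bigr => i _.
    by rewrite (linfZ lf) (valK i) scalerDr scalerA [_ * c i]mulrC addrC.
  move=> i _; rewrite (valK i).
  by rewrite (linfD (br _)) (linfZ (br _)) (linfZ (bl _)).
have [f [lf fK fx]] := separating_functional nK.
have Wyn : W (y n).
  have := H f lf (fun u Uu => fK u (adjoin_sub n x Uu)).
  rewrite big_ord_recr /= fx scale1r big1 ?add0r // => i _.
  by rewrite fK ?scale0r //; apply: adjoin_gen.
apply: lsubD; last exact: QW.
apply: IH => g lg gU; have := H g lg gU; rewrite big_ord_recr /= => Wg.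
by have := lsubB Wg (lsubZ (g (x n) : k) Wyn); rewrite addrK.
Qed.

Section SliceTheory.
Variables (k : fieldType) (A B : linTopType k).
Hypothesis cB : sep_complete B.

Lemma functional_chom (f : A -> k^o) (U : lsubspace A) : linear f -> open (U : set A) ->
  (forall u, U u -> f u = 0) -> exists h : chom A (scalars k), forall x, h x = f x.
Proof.
move=> lf oU fU; apply: (build_chom (B := scalars k) lf) => W _; exists U; split=> // u /fU ->.
exact: subspace0.
Qed.

Lemma functional_linear (c : k) (f g : chom A (scalars k)) a :
  (c *: f + g : chom A (scalars k)) a = c * (f a : k) + (g a : k) :> k.
Proof. by rewrite add_chomE scale_chomE. Qed.

Lemma slice_linear (y : bang A B) : linear (fun f => slice B f y).
Proof.
suff H (c : k) (f g : chom A (scalars k)) :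
    slice B (c *: f + g) y = (c *: slice B f + slice B g : chom _ _) y by move=> c f g; exact: H.
apply: bang_eq => [|a b]; first by case: cB.
have -> : (c *: slice B f + slice B g : chom _ _) (bang_tens a b) =
    c *: slice B f (bang_tens a b) + slice B g (bang_tens a b) by [].
by rewrite !sliceE // functional_linear scalerDl scalerA; reflexivity.
Qed.

Lemma sum_pairsE (I : Type) (x0 : I) (X : lmodType k) (s : seq I) (F : I -> X) :
  \sum_(p <- s) F p = \sum_(i < size s) F (nth x0 s i).
Proof. by rewrite (big_nth x0) big_mkord. Qed.

(** Modulo an open subspace the element is a finite sum of tensors, to which
    [slices_separate] applies. *)
Lemma slice_separated (y : bang A B) : (forall f, slice B f y = 0) -> y = 0.
Proof.
move=> y0; have [sD _] := bang_complete A B; apply: sD => W oW.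
pose z : A * B := (0, 0).
have [U [V [oU oV UW VW]]] := bang_tens_cont oW.
have [R [oR RP]] := bang_basic_nbhd oU oV.
have [s ys] := bang_approx y oR.
apply: (lsub_shift (y := \sum_(p <- s) bang_tens p.1 p.2)).
  apply: (RP _ (chom_id _) W oW _ _ ys) => a b [Ua|Vb]; [exact: UW|exact: VW].
rewrite (sum_pairsE z).
apply: (slices_separate (U := U) (W := V) (bang_tens_bilinear A B) UW VW
  (x := fun i => (nth z s i).1) (y := fun i => (nth z s i).2)) => f lf fU.
have [h hE] := functional_chom lf oU fU.
have := RP _ (slice B h) V oV _ _ ys.
rewrite chomB y0 sub0r chom_sum (sum_pairsE z).
rewrite (eq_bigr (fun i : 'I_(size s) => (f (nth z s i).1 : k) *: (nth z s i).2)).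
  move=> H; have := lsubN (H _); rewrite opprK; apply=> a b [Ua|Vb]; rewrite sliceE //.
    by rewrite hE fU // scale0r; apply: subspace0.
  exact: lsubZ.
by move=> i _; rewrite sliceE // hE.
Qed.

(** Where elements with prescribed slices come from.  Continuity on the dual makes
    [phi] small on the functionals that vanish on [U] and kill finitely many
    vectors.  These vectors are removed one at a time, by subtracting the tensor of
    [a] with the value of [phi] on a functional dual to [a]. *)
Lemma finite_rank_approx (U : lsubspace A) (W : lsubspace B) (s : seq A)
    (phi : chom A (scalars k) -> B) : linear phi ->
  (forall f : chom A (scalars k),
     (forall u, U u -> f u = 0) -> (forall a, a \in s -> f a = 0) -> W (phi f)) ->
  exists r : seq (A * B), forall f : chom A (scalars k), (forall u, U u -> f u = 0) ->
    W (phi f - \sum_(p <- r) (f p.1 : k) *: p.2).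
Proof.
elim: s phi => [|a s IH] phi lphi H.
  by exists [::] => f fU; rewrite big_nil subr0; apply: H.
have [[f0 [f0U f0s f0a]]|nf] := pselect (exists f0 : chom A (scalars k),
    [/\ forall u, U u -> f0 u = 0, forall a, a \in s -> f0 a = 0 & f0 a <> 0]); last first.
  apply: IH => // f fU fs; apply: H => // x; rewrite inE => /predU1P[->|/fs//].
  by apply: contrapT => fa; apply: nf; exists f.
pose c := (f0 a : k)^-1.
have [|f fU fs|r rP] := IH (fun f : chom A (scalars k) => phi f - (f a : k) *: phi (c *: f0)).
- suff H' (e : k) (f g : chom A (scalars k)) :
      phi (e *: f + g) - ((e *: f + g : chom A (scalars k)) a : k) *: phi (c *: f0) =
      e *: (phi f - (f a : k) *: phi (c *: f0)) + (phi g - (g a : k) *: phi (c *: f0)).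
    by move=> e f g; exact: H'.
  by rewrite functional_linear lphi !scalerBr scalerDl -!scalerA opprD addrACA.
- have -> : phi f - (f a : k) *: phi (c *: f0) = phi (f - (f a : k) *: (c *: f0)).
    by rewrite (linfB lphi) !(linfZ lphi).
  have E x : (f - (f a : k) *: (c *: f0) : chom A (scalars k)) x = f x - (f a : k) *: (c *: f0 x).
    by rewrite add_chomE opp_chomE !scale_chomE.
  apply: H => [u Uu|x]; first by rewrite E fU // f0U // !scaler0 subr0.
  rewrite E inE => /predU1P[->|xs]; last by rewrite fs // f0s // !scaler0 subr0.
  have -> : c *: f0 a = 1 :> k^o by apply: mulVf; apply/eqP.
  by apply/eqP; rewrite subr_eq0; apply/eqP; rewrite [RHS]mulr1.
exists ((a, phi (c *: f0)) :: r) => f fU; rewrite big_cons /= opprD addrA; exact: rP.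
Qed.

(** The converse of [slice_chom].  For every open [W] a finite sum of tensors has
    the slices of [phi] modulo [W], by [finite_rank_approx]; these sums form a Cauchy
    family by [slices_separate], and the element is its limit. *)
Lemma slices_surjective (phi : chom (dual A) B) :
  exists y : bang A B, forall f : chom A (scalars k), slice B f y = phi f.
Proof.
have lphi : linear (phi : chom A (scalars k) -> B) by exact: (chom_linear phi).
have fin (U : lsubspace A) (W : lsubspace B) : open (U : set A) -> open (W : set B) ->
    exists s : seq A, forall f : chom A (scalars k),
      (forall u, U u -> f u = 0) -> (forall a, a \in s -> f a = 0) -> W (phi f).
  move=> oU oW.
  pose P (X : lsubspace (chom A (scalars k))) := exists s : seq A, forall f : chom A (scalars k),
      (forall u, U u -> f u = 0) -> (forall a, a \in s -> f a = 0) -> X f.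
  suff [s sP] : P (of_gen (preim_sub (chom_linear phi) W)) by exists s.
  apply: (@gen_open_ind _ _ _ P _ _ _ _ _ (chom_preim_open phi oW)).
  - by exists [::].
  - move=> X Y [s sX] [t tY]; exists (s ++ t) => f fU fst.
    by split; [apply: sX|apply: tY] => // a H; apply: fst; rewrite mem_cat H ?orbT.
  - by move=> X Y [s sX] XY; exists s => f fU fs; apply/XY/sX.
  move=> X [L [[_ finL] XL]].
  pose v (x : sub_top L) : A := \val (x : subsp L).
  have lv : linear v by [].
  pose UL := preim_sub lv U.
  have oUL : open (UL : set (sub_top L)) by apply: gen_basic_open; exists U.
  have [n [e eP]] := finL _ oUL.
  have [r rP] := choice (fun i => ex_intro (fun w => quo_pi UL w = e i) _ (quo_pi_repr (e i))).
  exists [seq v (r i) | i <- enum 'I_n] => f fU fr.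
  rewrite /subspace_mem XL /= => a La.
  have [c cP] := eP (quo_pi UL (mk_subsp La)).
  have lq : linear (quo_pi UL) by move=> x u w; rewrite quo_piD quo_pi_scale.
  have /quo_piP : quo_pi UL (mk_subsp La) = quo_pi UL (\sum_(i < n) c i *: r i).
    rewrite cP (linf_sum lq); apply: eq_bigr => i _; rewrite (linfZ lq) rP //.
  move=> /fU; rewrite (linfB lv) (linf_sum lv) -[v (mk_subsp La)]/a.
  rewrite chomB chom_sum big1 ?subr0 // => i _.
  rewrite (linfZ lv) chomZ fr ?scaler0 //; apply/mapP; exists i => //; exact: mem_enum.
(* [UW W] and [VW W] are the largest subspaces with [UW W (x) B] and
   [A (x) VW W] inside [W]. *)
pose UW (W : lsubspace (bang A B)) : lsubspace A :=
  @Subspace k A (fun x => forall y, W (bang_tens x y))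
    (fun y => eq_ind_r W (subspace0 W) (linf0 ((bang_tens_bilinear A B).1 y)))
    (fun a u v Hu Hv y => eq_ind_r W (subspaceP a (Hu y) (Hv y)) ((bang_tens_bilinear A B).1 y a u v)).
pose VW (W : lsubspace (bang A B)) : lsubspace B :=
  @Subspace k B (fun y => forall x, W (bang_tens x y))
    (fun x => eq_ind_r W (subspace0 W) (linf0 ((bang_tens_bilinear A B).2 x)))
    (fun a u v Hu Hv x => eq_ind_r W (subspaceP a (Hu x) (Hv x)) ((bang_tens_bilinear A B).2 x a u v)).
have oUVW (W : lsubspace (bang A B)) : open (W : set (bang A B)) ->
    open (UW W : set A) /\ open (VW W : set B).
  move=> /bang_tens_cont[U [V [oU oV UW' VW']]].
  by split; [apply: (open_upward oU) => u Uu y|apply: (open_upward oV) => v Vv x]; auto.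
have [r rP] : exists r : lsubspace (bang A B) -> seq (A * B),
    forall W : lsubspace (bang A B), open (W : set (bang A B)) ->
    forall f : chom A (scalars k), (forall u, UW W u -> f u = 0) ->
      VW W (phi f - \sum_(p <- r W) (f p.1 : k) *: p.2).
  have rex (W : lsubspace (bang A B)) : exists r : seq (A * B), open (W : set (bang A B)) ->
      forall f : chom A (scalars k), (forall u, UW W u -> f u = 0) ->
        VW W (phi f - \sum_(p <- r) (f p.1 : k) *: p.2).
    have [oW|nW] := pselect (open (W : set (bang A B))); last by exists [::].
    have [oU oV] := oUVW W oW; have [s sP] := fin _ _ oU oV.
    by have [r rP] := finite_rank_approx lphi sP; exists r.
  by have [r rP] := choice rex; exists r.
have [|y yP] := (bang_complete A B).2 (fun W => \sum_(p <- r W) bang_tens p.1 p.2).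
  move=> W W' oW oW' WW'; pose z : A * B := (0, 0).
  have -> : \sum_(p <- r W) bang_tens p.1 p.2 - \sum_(p <- r W') bang_tens p.1 p.2 =
      \sum_(p <- r W ++ [seq (- p.1, p.2) | p <- r W']) bang_tens p.1 p.2.
    rewrite big_cat big_map /= -sumrN; congr (_ + _); apply: eq_bigr => p _.
    by rewrite (linfN ((bang_tens_bilinear A B).1 p.2)).
  rewrite (sum_pairsE z).
  set t := _ ++ _.
  apply: (slices_separate (U := UW W') (W := VW W') (bang_tens_bilinear A B) (Q := W')
    (fun u b H => H b) (fun a w H => H a)
    (x := fun i => (nth z t i).1) (y := fun i => (nth z t i).2)) => f lf fU.
  have [h hE] := functional_chom lf (oUVW W' oW').1 fU.
  have hU' u : UW W' u -> h u = 0 by move=> Uu; rewrite hE fU.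
  have hU u : UW W u -> h u = 0 by move=> Uu; apply: hU' => b; apply/WW'/Uu.
  have VV v : VW W v -> VW W' v by move=> Vv x; apply/WW'/Vv.
  have -> : \sum_(i < size t) (f (nth z t i).1 : k) *: (nth z t i).2 =
      (phi h - \sum_(p <- r W') (h p.1 : k) *: p.2) -
      (phi h - \sum_(p <- r W) (h p.1 : k) *: p.2).
    rewrite opprB [RHS]addrC addrA subrK.
    transitivity (\sum_(p <- t) (h p.1 : k) *: p.2).
      by rewrite (sum_pairsE z); apply: eq_bigr => i _; rewrite hE.
    rewrite /t big_cat big_map /= -sumrN; congr (_ + _); apply: eq_bigr => p _.
    by rewrite chomN scaleNr.
  exact: lsubB (rP W' oW' h hU') (VV _ (rP W oW h hU)).
exists y => f; apply/eqP; rewrite -subr_eq0; apply/eqP; apply: cB.1 => V oV.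
have [f0|/existsNP[x0 fx0]] := pselect (forall x, f x = 0).
  have -> : f = 0 by apply: chom_ext => x; rewrite f0.
  by rewrite (linf0 lphi) subr0 (linf0 (slice_linear y)); apply: subspace0.
have [Vfull|/existsNP[b0 nVb0]] := pselect (forall b, V b); first exact: Vfull.
(* The slice by [f] is compared with [phi f] modulo [V] by means of the finite
   sum attached to the open subspace [W] that this slice sends into [V]. *)
have lf := chom_linear (slice B f); pose W := preim_sub lf V.
have oW : open (W : set (bang A B)) by apply: chom_preim_open.
have fU u : UW W u -> f u = 0.
  move=> Uu; apply: contrapT => fu; apply: nVb0.
  have := Uu ((f u : k)^-1 *: b0); rewrite /W /subspace_mem /= sliceE // scalerA.
  by rewrite mulfV ?scale1r //; apply/eqP.
have := yP W oW; rewrite /W /subspace_mem /= chomB chom_sum => H.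
apply: (lsub_trans H); apply: lsubBC.
have := rP W oW f fU x0; rewrite /subspace_mem /= sliceE // => /(lsubZ (f x0 : k)^-1).
rewrite scalerA mulVf ?scale1r; last by apply/eqP.
by congr (V (_ - _)); apply: eq_bigr => p _; rewrite sliceE.
Qed.

End SliceTheory.

(** * Continuity for the dual topology *)

Section SubspaceTopology.
Variables (k : fieldType) (A : linTopType k).

Definition sub_incl (L : lsubspace A) (x : sub_top L) : A := \val (x : subsp L).

Lemma sub_incl_linear L : linear (@sub_incl L).
Proof. by []. Qed.

Lemma sub_inclP L (x : sub_top L) : L (sub_incl x).
Proof. by apply/asboolP; exact: (valP (x : {x | x \in sub_pred L})). Qed.

Lemma sub_incl_inj L : injective (@sub_incl L).
Proof. exact: val_inj. Qed.

Lemma sub_inclE (L : lsubspace A) a (La : L a) : sub_incl (mk_subsp La : sub_top L) = a.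
Proof. by []. Qed.

Lemma sub_incl_open L (X : lsubspace A) : open (X : set A) ->
  open (preim_sub (@sub_incl_linear L) X : set (sub_top L)).
Proof. by move=> oX; apply: gen_basic_open; exists X. Qed.

Lemma sub_open_incl L (U : lsubspace (sub_top L)) : open (U : set (sub_top L)) ->
  exists X : lsubspace A, open (X : set A) /\ forall x : sub_top L, X (sub_incl x) -> U x.
Proof.
pose P (U : lsubspace (subsp L)) :=
  exists X : lsubspace A, open (X : set A) /\ forall x : sub_top L, X (sub_incl x) -> U x.
move=> oU; suff : P (of_gen U) by [].
apply: (@gen_open_ind _ _ _ P _ _ _ _ U oU).
- by exists (full_sub A); split=> //; exact: open_full.
- move=> X Y [V [oV VX]] [W [oW WY]]; exists (cap_sub V W); split; first exact: open_cap.
  by move=> x [? ?]; split; [apply: VX|apply: WY].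
- by move=> X Y [V [oV VX]] XY; exists V; split=> // x /VX/XY.
by move=> X [V [oV XV]]; exists V; split=> // x; rewrite /subspace_mem XV.
Qed.

Lemma open_sub_complete (L : lsubspace A) : sep_complete A -> open (L : set A) ->
  sep_complete (sub_top L).
Proof.
move=> [sA cA] oL; split.
  move=> x H; apply: sub_incl_inj; rewrite (linf0 (@sub_incl_linear L)); apply: sA => X oX.
  exact: (H (preim_sub (@sub_incl_linear L) X) (sub_incl_open oX)).
move=> x Hx; pose pre := preim_sub (@sub_incl_linear L).
have lv := @sub_incl_linear L.
have [|a aP] := cA (fun X => sub_incl (x (pre X))).
  move=> X Y oX oY XY; rewrite -(linfB lv).
  by apply: (Hx (pre X) (pre Y) (sub_incl_open oX) (sub_incl_open oY)) => u; apply: XY.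
have La : L a by apply: lsub_shift (aP L oL) (sub_inclP _).
exists (mk_subsp La) => U oU; have [X [oX XU]] := sub_open_incl oU.
apply: (lsub_trans (y := x (pre X))).
  by apply: XU; rewrite (linfB lv) sub_inclE; apply: aP.
by apply: Hx => //; apply: sub_incl_open.
Qed.

(** Finite dimension of the quotients of a linearly compact subspace, in terms of
    vectors of the ambient space. *)
Lemma lin_compact_gens (L X : lsubspace A) : lin_compact (sub_top L) -> open (X : set A) ->
  exists n (a : nat -> A), (forall i, L (a i)) /\ forall v, L v -> adjoin X n a v.
Proof.
move=> [_ fL] oX; have [n [e eP]] := fL _ (sub_incl_open oX).
set Y := preim_sub _ X in e eP.
have [r rP] := choice (fun i => ex_intro (fun w => quo_pi Y w = e i) _ (quo_pi_repr (e i))).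
pose a (i : nat) : A := if insub i is Some j then sub_incl (r j) else 0.
exists n, a; split=> [i|v Lv].
  by rewrite /a; case: insubP => [j _ _|_]; [exact: sub_inclP|exact: subspace0].
have [c cP] := eP (quo_pi Y (mk_subsp Lv)).
have lq : linear (quo_pi Y) by move=> x u w; rewrite quo_piD quo_pi_scale.
have /quo_piP : quo_pi Y (mk_subsp Lv) = quo_pi Y (\sum_(i < n) c i *: r i).
  by rewrite cP (linf_sum lq); apply: eq_bigr => i _; rewrite (linfZ lq) rP.
rewrite /Y /subspace_mem /= (linfB (@sub_incl_linear L)) (linf_sum (@sub_incl_linear L)).
rewrite -[sub_incl (mk_subsp Lv)]/v => Xv.
exists (v - \sum_(i < n) sub_incl (c i *: r i)), c; split=> //.
rewrite -[LHS](subrK (\sum_(i < n) sub_incl (c i *: r i))); congr (_ + _).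
by apply: eq_bigr => i _; rewrite (linfZ (@sub_incl_linear L)) /a valK.
Qed.

Lemma gens_lin_compact (L : lsubspace A) : sep_complete A -> open (L : set A) ->
  (forall X : lsubspace A, open (X : set A) -> exists n (a : nat -> A),
     (forall i, (i < n)%N -> L (a i)) /\ forall v, L v -> adjoin X n a v) ->
  lin_compact (sub_top L).
Proof.
move=> cA oL gens; split.
  by apply/complete_sep_complete; apply: open_sub_complete.
move=> U oU; have [X [oX XU]] := sub_open_incl oU.
have [n [a [La aP]]] := gens X oX.
pose b (i : 'I_n) : sub_top L := mk_subsp (La i (ltn_ord i)).
exists n, (fun i => quo_pi U (b i)) => w.
rewrite -[w]quo_pi_repr; set v : sub_top L := repr _.
have [u [c [Xu vE]]] := aP _ (sub_inclP v); exists c.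
have lq : linear (quo_pi U) by move=> x y z; rewrite quo_piD quo_pi_scale.
have lv := @sub_incl_linear L.
transitivity (quo_pi U (\sum_(i < n) c i *: b i)); last first.
  by rewrite (linf_sum lq); apply: eq_bigr => i _; rewrite (linfZ lq).
apply/quo_piP/XU; rewrite (linfB lv) (linf_sum lv) vE.
rewrite (eq_bigr (fun i : 'I_n => c i *: a i)) ?addrK //.
Qed.

Lemma adjoin_adjoin (X L : lsubspace A) n m (a b : nat -> A) :
  (forall v, L v -> adjoin X n a v) ->
  forall v, adjoin L m b v -> adjoin X (n + m) (fun i => if (i < n)%N then a i else b (i - n)%N) v.
Proof.
move=> LX _ [u [c [Lu ->]]]; apply: lsubD.
  have [x [d [Xx ->]]] := LX u Lu; apply: lsubD; first exact: adjoin_sub.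
  apply: lsub_sum => i _; apply: lsubZ.
  have -> : a i = if (i < n)%N then a i else b (i - n)%N by rewrite ltn_ord.
  by apply: adjoin_gen; rewrite ltn_addr.
apply: lsub_sum => i _; apply: lsubZ.
have -> : b i = if (n + i < n)%N then a (n + i)%N else b (n + i - n)%N.
  by rewrite ltnNge leq_addr /= addKn.
by apply: adjoin_gen; rewrite ltn_add2l.
Qed.

(** Used to enlarge an open linearly compact subspace so that it contains the
    vectors of an approximation of a tensor. *)
Lemma adjoin_lin_compact (L : lsubspace A) m (b : nat -> A) : sep_complete A ->
  open (L : set A) -> lin_compact (sub_top L) -> lin_compact (sub_top (adjoin L m b)).
Proof.
move=> cA oL cL; apply: gens_lin_compact => //.
  by apply: (open_upward oL) => u Lu; apply: adjoin_sub.
move=> X oX; have [n [a [La aP]]] := lin_compact_gens cL oX.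
exists (n + m)%N, (fun i => if (i < n)%N then a i else b (i - n)%N); split.
  move=> i inm; case: ifP => [_|/negbT]; first exact/adjoin_sub/La.
  by rewrite -leqNgt => ni; apply: adjoin_gen; lia.
exact: adjoin_adjoin.
Qed.

End SubspaceTopology.

Section DualContinuity.
Variables (k : fieldType) (A B : linTopType k).

Lemma tate_complete : tate A -> sep_complete A.
Proof. by move=> [_ /complete_sep_complete]. Qed.

(** Modulo an open subspace the element lies in [L (x) B] for a linearly compact
    [L], so its slice is small when the functional vanishes on [L]. *)
Lemma slice_chom (y : bang A B) : tate A -> sep_complete B ->
  exists phi : chom (dual A) B, forall f : chom A (scalars k), phi f = slice B f y.
Proof.
move=> tA cB; have cA := tate_complete tA.
apply: (build_chom (A := dual A) (slice_linear cB y)) => V oV.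
have [_ _ [L [oL cL]]] := tA.
have [R [oR RP]] := bang_basic_nbhd oL oV.
have [s ys] := bang_approx y oR.
pose z : A * B := (0, 0).
pose b i := (nth z s i).1.
pose L' := adjoin L (size s) b.
have cL' : lin_compact (sub_top L') by apply: adjoin_lin_compact.
have ann0 : forall a, L' a -> (0 : chom A (scalars k)) a = 0 by [].
have annP (c : k) (f g : chom A (scalars k)) : (forall a, L' a -> f a = 0) ->
    (forall a, L' a -> g a = 0) -> forall a, L' a -> (c *: f + g : chom A (scalars k)) a = 0.
  by move=> f0 g0 a La; rewrite functional_linear f0 // g0 // mulr0 addr0.
pose ann := @Subspace k (chom A (scalars k))
  (fun f : chom A (scalars k) => forall a, L' a -> f a = 0) ann0 annP.
exists (to_gen _ ann); split; first by apply: gen_basic_open; exists L'.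
move=> f0 fL0; pose f : chom A (scalars k) := f0.
have fL' a : L' a -> f a = 0 := fL0 a; rewrite -[f0]/f.
apply: (lsub_shift (y := slice B f (\sum_(p <- s) bang_tens p.1 p.2))).
  rewrite -chomB; apply: (RP _ (slice B f) V oV _ _ ys) => x w [Lx|Vw]; rewrite sliceE //.
    by rewrite fL' ?scale0r; [apply: subspace0|apply: adjoin_sub].
  exact: lsubZ.
rewrite chom_sum (sum_pairsE z) big1; first exact: subspace0.
move=> i _; rewrite sliceE // fL' ?scale0r //.
exact: (adjoin_gen L b (ltn_ord i)).
Qed.

(** A linearly compact subspace of [B] is finite-dimensional modulo the open
    subspace on which [b] is jointly small, so [b a] vanishes on it when [a] is small
    and [b a] kills finitely many vectors. *)
Lemma pairing_chom (b : A -> chom B (scalars k)) : is_bilinear (fun a => b a) ->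
  star_cont (fun a => b a) -> exists P : chom A (dual B), forall a, P a = b a.
Proof.
move=> [bl br] cb.
have lb : linear (b : A -> dual B).
  suff H (c : k) x y : b (c *: x + y) = c *: b x + b y by move=> c x y; exact: H.
  by apply: chom_ext => z; rewrite bl functional_linear.
apply: (build_chom lb) => W.
pose P (X : lsubspace (chom B (scalars k))) :=
  exists U : lsubspace A, open (U : set A) /\ forall a, U a -> X (b a).
move=> oW; suff : P (of_gen W) by [].
apply: (@gen_open_ind _ _ _ P _ _ _ _ W oW).
- by exists (full_sub A); split=> //; exact: open_full.
- move=> X Y [V [oV VX]] [V' [oV' VY]]; exists (cap_sub V V'); split; first exact: open_cap.
  by move=> x [? ?]; split; [apply: VX|apply: VY].
- by move=> X Y [V [oV VX]] XY; exists V; split=> // x /VX/XY.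
move=> X [L [cL XL]]; rewrite /P /subspace_mem XL /=.
have o0 : open (zero_sub (scalars k) : set (scalars k)) by apply: discrete_open.
have [[U [V [oU oV UV]]] _ r] := cb _ o0.
have [n [e [_ eP]]] := lin_compact_gens cL oV.
have [|U' [oU' U'P]] := @open_caps k A _ (enum 'I_n) (fun i a => b a (e i) = 0).
  by move=> i _; have [U' [oU' U'P]] := r (e i); exists U'.
exists (cap_sub U U'); split; first exact: open_cap.
move=> a [Ua U'a] v /eP[w [c [Vw ->]]].
rewrite chomD (UV _ _ Ua Vw) add0r chom_sum big1 // => i _.
by rewrite chomZ (U'P _ U'a) ?scaler0 // mem_enum.
Qed.

End DualContinuity.

(** * Signs, and evaluation of the structural maps by slices *)

Section Signs.
Variable k : fieldType.

Definition parity (z : int) : bool := odd `|z|%N.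

Lemma parityD x y : parity (x + y) = parity x (+) parity y.
Proof. by rewrite /parity; lia. Qed.

Lemma parityM x y : parity (x * y) = parity x && parity y.
Proof. by rewrite /parity abszM oddM. Qed.

Lemma parityN x : parity (- x) = parity x.
Proof. by rewrite /parity abszN. Qed.

Lemma parity0 : parity 0 = false. Proof. by []. Qed.
Lemma parity1 : parity 1 = true. Proof. by []. Qed.

Lemma signE (z : int) : (-1 : k) ^ z = (-1) ^+ parity z.
Proof.
case: z => n; rewrite /parity ?signr_odd // NegzE abszN /=.
by rewrite -invr_expz -exprnP -signr_odd invr_sign.
Qed.

Lemma sign_eq x y : parity x = parity y -> (-1 : k) ^ x = (-1) ^ y.
Proof. by rewrite !signE => ->. Qed.

Lemma scale_sign (V : lmodType k) x y (v : V) : parity x = parity y ->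
  (-1 : k) ^ x *: v = (-1 : k) ^ y *: v.
Proof. by move=> /sign_eq ->. Qed.

Lemma even_sign_mul x (v : k) : parity x = false -> (-1 : k) ^ x * v = v.
Proof. by rewrite signE => ->; rewrite mul1r. Qed.

Lemma even_sign_scale (V : lmodType k) x (v : V) : parity x = false -> (-1 : k) ^ x *: v = v.
Proof. by rewrite signE => ->; rewrite scale1r. Qed.

Lemma signD x y : (-1 : k) ^ x * (-1) ^ y = (-1) ^ (x + y).
Proof. by rewrite !signE parityD signr_addb. Qed.

Lemma signZ (V : lmodType k) x y (v : V) :
  (-1 : k) ^ x *: ((-1 : k) ^ y *: v) = (-1 : k) ^ (x + y) *: v.
Proof. by rewrite scalerA signD. Qed.

Lemma signK (V : lmodType k) x (v : V) : (-1 : k) ^ x *: ((-1 : k) ^ x *: v) = v.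
Proof. by rewrite signZ signE parityD addbb scale1r. Qed.

Lemma sign_mulK x (v : k) : (-1 : k) ^ x * ((-1 : k) ^ x * v) = v.
Proof. by rewrite mulrA signD signE parityD addbb mul1r. Qed.

End Signs.

(** Decides an equality of signs whose exponents are polynomials in the degrees,
    by reduction modulo 2. *)
Ltac sign_parity :=
  rewrite ?(parityD, parityM, parityN, parity0, parity1);
  repeat match goal with |- context [parity ?z] => case: (parity z) => //= end.

Section GradedComposition.
Variables (k : fieldType) (A B C : gspace k).

(** The intermediate degree [j'] is free, so that it can take whatever form the
    evaluation of [g] expects. *)
Lemma gcompE d d' (g : ghom B C d') (f : ghom A B d) (i j' j : int) (e : i + (d + d') = j)
    (e1 : i + d = j') (e2 : j' + d' = j) x :
  (g \og f) i j e x = g j' j e2 (f i j' e1 x).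
Proof. by subst j'; rewrite /gcomp /= chom_compE; congr (g _ _ _ _); exact: int_eq_irr. Qed.

Lemma gscaleE d c (f : ghom A B d) (i j : int) (e : i + d = j) x :
  (c *g f) i j e x = c *: f i j e x.
Proof. by []. Qed.

Lemma gidE (i : int) (e : i + 0 = i) x : gid A i i e x = x.
Proof. by rewrite /gid /= (int_eq_irr (etrans _ _) erefl). Qed.

Lemma ghom_ext d (f g : ghom A B d) : f =g g -> f = g.
Proof.
case: f g => f [g] fg; congr GHom; apply/functional_extensionality_dep => i.
apply/functional_extensionality_dep => j; apply/functional_extensionality_dep => e.
exact: fg.
Qed.

Lemma geqP d d' (f : ghom A B d) (g : ghom A B d') :
  (forall (i j : int) (e : i + d = j) (e' : i + d' = j) x, f i j e x = g i j e' x) -> f =g g.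
Proof. by move=> fg i j e e'; apply: chom_ext => x; apply: fg. Qed.

End GradedComposition.

Section GradedSlices.
Variables (k : fieldType) (A B : gspace k).
Hypothesis cB : forall i, sep_complete (B i).

Lemma gslice_ex (i j n : int) (e : i + j = n) (f : chom (A i) (scalars k)) :
  exists h : chom (gbang A B n) (B j), forall y, h y = slice (B j) f (gbang_at A B e y).
Proof. by exists (chom_comp (slice (B j) f) (gbang_at A B e)). Qed.

Definition gslice (i j n : int) (e : i + j = n) (f : chom (A i) (scalars k)) :
  chom (gbang A B n) (B j) := projT1 (cid (gslice_ex e f)).

Lemma gsliceE (i j n : int) (e : i + j = n) f y :
  gslice e f y = slice (B j) f (gbang_at A B e y).
Proof. exact: (projT2 (cid (gslice_ex e f))). Qed.

Lemma gslice_tens (i j n : int) (e e' : i + j = n) f a b :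
  gslice e f (gbang_tens e' a b) = (f a : k) *: b.
Proof. by rewrite gsliceE gbang_at_tens sliceE. Qed.

Lemma gslice_tens0 (i j n i' j' : int) (e : i + j = n) (e' : i' + j' = n) f a b : i != i' ->
  gslice e f (gbang_tens e' a b) = 0.
Proof. by move=> ii'; rewrite gsliceE gbang_at_tens0 // chom0. Qed.

Lemma gsliceZ (i j n : int) (e : i + j = n) (c : k) f y :
  gslice e (c *: f) y = c *: gslice e f y.
Proof. by rewrite !gsliceE; exact: linfZ (slice_linear (cB j) _) _ _. Qed.

Lemma gslice0 (i j n : int) (e : i + j = n) y : gslice e 0 y = 0.
Proof. by rewrite gsliceE; exact: linf0 (slice_linear (cB j) _). Qed.

Lemma gslice_ext n (y z : gbang A B n) :
  (forall (i j : int) (e : i + j = n) f, gslice e f y = gslice e f z) -> y = z.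
Proof.
move=> yz; apply: gbang_ext => i j e; apply/eqP; rewrite -subr_eq0; apply/eqP.
apply: (slice_separated (cB j)) => f; rewrite chomB.
by have := yz i j e f; rewrite !gsliceE => ->; rewrite subrr.
Qed.

End GradedSlices.

Arguments gslice {k A B i j n} e f.

Section Evaluations.
Variables (k : fieldType) (A : gspace k).
Hypothesis cA : forall i, sep_complete (A i).

Let sA i : separated (A i) := (cA i).1.

(** As a continuous functional, so that it can be used for slicing. *)
Definition pair_fun d (p : ghom (gstar A A) (gunit k) d) (i : int) (a : A i) (j : int) :
    chom (A j) (scalars k) :=
  chom_comp (gunit_valc k (i + j + d)) (chom_comp (p (i + j) _ erefl) (gstar_tens_l A erefl a)).

Lemma pair_funE d (p : ghom (gstar A A) (gunit k) d) (i j n n' : int) (e : i + j = n)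
    (e' : n + d = n') (a : A i) (b : A j) :
  gunit_val (p n n' e' (gstar_tens e a b)) = pair_fun p a j b.
Proof.
by subst n n'; rewrite /pair_fun !chom_compE gunit_valcE gstar_tens_lE.
Qed.

Lemma gunit_eq0 (i : int) (x : gunit k i) : i <> 0 -> x = 0.
Proof. by move=> i0; apply: gunit_inj; rewrite gunit_val0. Qed.

Definition counit_fun d (eps : ghom A (gunit k) d) (i : int) : chom (A i) (scalars k) :=
  chom_comp (gunit_valc k (i + d)) (eps i _ erefl).

Lemma counit_funE d (eps : ghom A (gunit k) d) (i j : int) (e : i + d = j) a :
  gunit_val (eps i j e a) = counit_fun eps i a.
Proof. by subst j; rewrite chom_compE gunit_valcE. Qed.

Lemma counit_fun0 d (eps : ghom A (gunit k) d) (i : int) a :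
  i + d <> 0 -> counit_fun eps i a = 0.
Proof. by move=> id; rewrite -(counit_funE eps erefl) gunit_val0. Qed.

Definition gmul m (mu : ghom (gstar A A) A m) (i j n : int) (e : i + j + m = n)
    (a : A i) (b : A j) : A n := mu (i + j) n e (gstar_tens erefl a b).

Lemma gmulE m (mu : ghom (gstar A A) A m) (i j n n' : int) (e : i + j = n) (e' : n + m = n')
    (e1 : i + j + m = n') a b :
  mu n n' e' (gstar_tens e a b) = gmul mu e1 a b.
Proof. by subst n; rewrite /gmul (int_eq_irr e' e1). Qed.

Lemma gmul_l_ex m (mu : ghom (gstar A A) A m) (i j n : int) (e : i + j + m = n) (a : A i) :
  exists h : chom (A j) (A n), forall b, h b = gmul mu e a b.
Proof.
exists (chom_comp (mu (i + j) n e) (gstar_tens_l A erefl a)) => b.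
by rewrite chom_compE gstar_tens_lE.
Qed.

Definition gmul_l m (mu : ghom (gstar A A) A m) (i j n : int) (e : i + j + m = n) (a : A i) :
  chom (A j) (A n) := projT1 (cid (gmul_l_ex mu e a)).

Lemma gmul_lE m (mu : ghom (gstar A A) A m) (i j n : int) (e : i + j + m = n) a b :
  gmul_l mu e a b = gmul mu e a b.
Proof. exact: (projT2 (cid (gmul_l_ex mu e a))). Qed.

Lemma gmul_r_ex m (mu : ghom (gstar A A) A m) (i j n : int) (e : i + j + m = n) (b : A j) :
  exists h : chom (A i) (A n), forall a, h a = gmul mu e a b.
Proof.
exists (chom_comp (mu (i + j) n e) (gstar_tens_r A erefl b)) => a.
by rewrite chom_compE gstar_tens_rE.
Qed.

Lemma gmulZl m (mu : ghom (gstar A A) A m) (i j n : int) (e : i + j + m = n) c a b :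
  gmul mu e (c *: a) b = c *: gmul mu e a b.
Proof. by rewrite /gmul gstar_tensZl chomZ. Qed.

Lemma gmulZr m (mu : ghom (gstar A A) A m) (i j n : int) (e : i + j + m = n) c a b :
  gmul mu e a (c *: b) = c *: gmul mu e a b.
Proof. by rewrite /gmul gstar_tensZr chomZ. Qed.

(** Here and in the evaluations below, both sides are continuous in the element of
    the completed tensor product, so it may be taken to be a pure tensor; if its
    bidegree is not the one selected by the slice, both sides vanish. *)
Lemma left_pairing_slice d (p : ghom (gstar A A) (gunit k) d) (i q n n1 n2 n' i1 : int)
    (e : i + q = n) (e1 : n + 0 = n1) (e2 : n1 + (d + 0) = n2) (e3 : n2 + 0 = n')
    (ei : i1 + n' = q) (a : A i) (y : gbang A A q) :
  bang_lunit A n2 n' e3 ((p !og gid A) n1 n2 e2 (star_bang A A A n n1 e1 (gstar_tens e a y))) =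
  gslice ei (pair_fun p a i1) y.
Proof.
(* The composite as a single continuous map of [y]. *)
pose h := chom_comp (bang_lunit A n2 n' e3) (chom_comp ((p !og gid A) n1 n2 e2)
  (chom_comp (star_bang A A A n n1 e1) (gstar_tens_l (gbang A A) e a))).
have hE z : bang_lunit A n2 n' e3 ((p !og gid A) n1 n2 e2
    (star_bang A A A n n1 e1 (gstar_tens e a z))) = h z by rewrite /h !chom_compE gstar_tens_lE.
rewrite hE; move: y; apply: gbang_eq => // ix iz exz x z; rewrite -hE {h hE}.
have e4 : i + ix + iz = n1 by lia.
have e5 : i + ix + d + iz = n2 by lia.
have e6 : iz + 0 = iz by lia.
rewrite (star_bangE _ _ _ erefl e4) (gbang_mapE _ _ _ _ e5 erefl e6) gidE mul0r expr0z scale1r.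
have [ii|ni] := eqVneq i1 ix; last first.
  rewrite gslice_tens0 // [p _ _ _ _](gunit_eq0 _ (i := i + ix + d)).
    by rewrite gbang_tens0l chom0.
  by move/eqP: ni => ni H; apply: ni; lia.
have zz : iz = n' by lia.
subst ix iz; rewrite (gslice_tens cA) // (bang_lunitE cA) (pair_funE p); reflexivity.
Qed.

End Evaluations.

Lemma scalars_scaleE (k : fieldType) (c : k) (x : scalars k) : c *: x = c * (x : k) :> k.
Proof. by []. Qed.

Section SliceEvaluations.
Variables (k : fieldType) (A : gspace k).
Hypothesis cA : forall i, sep_complete (A i).

Let sA i : separated (A i) := (cA i).1.

Lemma right_pairing_slice d (p : ghom (gstar A A) (gunit k) d)
    (q j n n1 n2 n' i1 : int) (e : q + j = n) (e1 : n + 0 = n1) (e2 : n1 + (0 + d) = n2)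
    (e3 : n2 + 0 = n') (ei : n' + i1 = q) (g : chom (A n') (scalars k))
    (y : gbang A A q) (b : A j) :
  (g (bang_runit A n2 n' e3 ((gid A !og p) n1 n2 e2
       (bang_star A A A n n1 e1 (gstar_tens e y b)))) : k) =
  (-1) ^ (d * n') * pair_fun p (gslice ei g y) j b.
Proof.
pose h := chom_comp g (chom_comp (bang_runit A n2 n' e3) (chom_comp ((gid A !og p) n1 n2 e2)
  (chom_comp (bang_star A A A n n1 e1) (gstar_tens_r (gbang A A) e b)))).
have hE z : g (bang_runit A n2 n' e3 ((gid A !og p) n1 n2 e2
       (bang_star A A A n n1 e1 (gstar_tens e z b)))) = h z.
  by rewrite /h !chom_compE gstar_tens_rE.
pose h1 := chom_comp (gunit_valc k (i1 + j + d)) (chom_comp (p (i1 + j) _ erefl) (gstar_tens_r A erefl b)).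
have h1E x : pair_fun p x j b = h1 x by rewrite /h1 /pair_fun !chom_compE gstar_tens_rE gstar_tens_lE.
rewrite hE h1E.
have -> : (-1) ^ (d * n') * h1 (gslice ei g y) = chom_comp ((-1) ^ (d * n') *: h1) (gslice ei g) y.
  by rewrite [RHS]chom_compE scale_chomE.
move: y; apply: (@gbang_eq _ _ _ _ (scalars k)) => [|ix iz exz x z]; first exact: discrete_separated.
rewrite -hE chom_compE {h hE}.
have e4 : iz + j + d + ix = n2 by lia.
have e5 : ix + (iz + j) = n1 by lia.
have e6 : ix + 0 = ix by lia.
have e7 : ix + (iz + j + d) = n2 by lia.
rewrite (bang_starE _ _ _ erefl e5) (gbang_mapE _ _ _ _ e7 e6 erefl) gidE.
have [ii|ni] := eqVneq n' ix; last first.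
  rewrite gslice_tens0 // [p _ _ _ _](gunit_eq0 _ (i := iz + j + d)).
    by rewrite gbang_tens0r scaler0 !chom0.
  by move/eqP: ni => ni H; apply: ni; lia.
have zz : iz = i1 by lia.
subst ix iz; rewrite (gslice_tens cA) // !chomZ (bang_runitE cA) chomZ scale_chomE -h1E.
by rewrite (pair_funE p) !scalars_scaleE mulrA mulrC.
Qed.

Lemma comul_left_slice m (mu : ghom (gstar A A) A m) (q j n n1 n' i j1 j' : int)
    (e : q + j = n) (e1 : n + 0 = n1) (e2 : n1 + (0 + m) = n') (ei : i + j1 = q)
    (ej : j1 + j + m = j') (e' : i + j' = n') (f : chom (A i) (scalars k)) (y : gbang A A q) (x : A j) :
  gslice e' f ((gid A !og mu) n1 n' e2 (bang_star A A A n n1 e1 (gstar_tens e y x))) =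
  (-1) ^ (m * i) *: gmul mu ej (gslice ei f y) x.
Proof.
pose h := chom_comp (gslice e' f) (chom_comp ((gid A !og mu) n1 n' e2)
  (chom_comp (bang_star A A A n n1 e1) (gstar_tens_r (gbang A A) e x))).
have hE z : gslice e' f ((gid A !og mu) n1 n' e2
    (bang_star A A A n n1 e1 (gstar_tens e z x))) = h z.
  by rewrite /h !chom_compE gstar_tens_rE.
have [g gE] := gmul_r_ex mu ej x.
rewrite hE -gE.
have -> : (-1) ^ (m * i) *: g (gslice ei f y) = chom_comp ((-1) ^ (m * i) *: g) (gslice ei f) y.
  by rewrite [RHS]chom_compE scale_chomE.
move: y; apply: gbang_eq => // iy iz eyz y z; rewrite -hE chom_compE {h hE}.
have e3 : iy + (iz + j) = n1 by lia.
have e4 : iy + 0 = iy by lia.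
have e5 : iy + (iz + j + m) = n' by lia.
rewrite (bang_starE _ _ _ erefl e3) (gbang_mapE _ _ _ _ e5 e4 erefl) gidE.
rewrite chomZ scale_chomE.
have [ii|ni] := eqVneq i iy; last by rewrite !gslice_tens0 // chom0 !scaler0.
have zz : iz = j1 by lia.
subst iy iz; rewrite (gslice_tens cA) chomZ gE; subst j'.
by rewrite (gslice_tens cA) (gmulE _ _ _ erefl); reflexivity.
Qed.

Lemma comul_right_slice m (mu : ghom (gstar A A) A m) (q j n n1 n' i i' j1 : int)
    (e : j + q = n) (e1 : n + 0 = n1) (e2 : n1 + (m + 0) = n') (ei : i + j1 = q)
    (ej : j + i + m = i') (e' : i' + j1 = n') (f : chom (A i') (scalars k)) (x : A j) (y : gbang A A q) :
  gslice e' f ((mu !og gid A) n1 n' e2 (star_bang A A A n n1 e1 (gstar_tens e x y))) =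
  gslice ei (chom_comp f (gmul_l mu ej x)) y.
Proof.
pose h := chom_comp (gslice e' f) (chom_comp ((mu !og gid A) n1 n' e2)
  (chom_comp (star_bang A A A n n1 e1) (gstar_tens_l (gbang A A) e x))).
have hE z : gslice e' f ((mu !og gid A) n1 n' e2
    (star_bang A A A n n1 e1 (gstar_tens e x z))) = h z.
  by rewrite /h !chom_compE gstar_tens_lE.
rewrite hE; move: y; apply: gbang_eq => // iy iz eyz y z; rewrite -hE {h hE}.
have e3 : j + iy + iz = n1 by lia.
have e4 : iz + 0 = iz by lia.
have e5 : j + iy + m + iz = n' by lia.
rewrite (star_bangE _ _ _ erefl e3) (gbang_mapE _ _ _ _ e5 erefl e4) gidE mul0r expr0z scale1r.
have [ii|ni] := eqVneq i iy; last first.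
  by rewrite !gslice_tens0 //; apply: contraNneq ni => ?; apply/eqP; lia.
have zz : iz = j1 by lia.
subst iy iz i'; rewrite !(gslice_tens cA) chom_compE gmul_lE (gmulE _ _ _ erefl); reflexivity.
Qed.

Lemma comul_map_left_slice l (lam : ghom A (gbang A A) l) (q n' i j j1 : int)
    (e : q + (0 + l) = n') (ei : i + j = q) (ej : j + l = j1) (e' : i + j1 = n')
    (f : chom (A i) (scalars k)) (y : gbang A A q) :
  gslice e' f ((gid A !og lam) q n' e y) = (-1) ^ (l * i) *: lam j j1 ej (gslice ei f y).
Proof.
have -> : (-1) ^ (l * i) *: lam j j1 ej (gslice ei f y) =
    chom_comp ((-1) ^ (l * i) *: lam j j1 ej) (gslice ei f) y.
  by rewrite [RHS]chom_compE scale_chomE.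
rewrite -[LHS]chom_compE; move: y.
apply: gbang_eq => [|iy iz eyz y z]; first exact: (gbang_complete A A j1).1.
rewrite !chom_compE scale_chomE.
have e4 : iy + 0 = iy by lia.
have e5 : iy + (iz + l) = n' by lia.
rewrite (gbang_mapE _ _ _ _ e5 e4 erefl) gidE chomZ.
have [ii|ni] := eqVneq i iy; last by rewrite !gslice_tens0 // chom0 !scaler0.
have zz : iz = j by lia.
subst iy iz j1; rewrite (gslice_tens cA) chomZ.
by rewrite (gslice_tens (fun i => gbang_complete A A i)); reflexivity.
Qed.

Lemma assoc_slice (p l n n' i j q : int) (e : p + l = n) (e0 : n + 0 = n') (ei : i + j = p)
    (e' : i + q = n') (e2 : j + l = q) (f : chom (A i) (scalars k)) (g : chom (A j) (scalars k))
    (z : gbang A A p) (c : A l) :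
  gslice e2 g (gslice e' f (bang_assoc A A A n n' e0 (gbang_tens e z c))) =
  (g (gslice ei f z) : k) *: c.
Proof.
pose h := chom_comp (gslice e2 g) (chom_comp (gslice e' f)
  (chom_comp (bang_assoc A A A n n' e0) (gbang_tens_r (gbang A A) e c))).
have hE y : gslice e2 g (gslice e' f (bang_assoc A A A n n' e0 (gbang_tens e y c))) = h y.
  by rewrite /h !chom_compE gbang_tens_rE.
have lc : linear (fun x : scalars k => (x : k) *: c).
  by move=> b x y; rewrite scalerDl -scalerA.
have [s sE] : exists s : chom (scalars k) (A l), forall x, s x = (x : k) *: c.
  apply: (build_chom lc) => W oW; exists (zero_sub _); split; first exact: discrete_open.
  by move=> x ->; rewrite scale0r; apply: subspace0.
rewrite hE -sE.
have -> : s (g (gslice ei f z)) = chom_comp s (chom_comp g (gslice ei f)) z by rewrite !chom_compE.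
move: z; apply: gbang_eq => // ix iy exy x y; rewrite -hE {h hE}.
have e3 : iy + l = n' - ix by lia.
have e4 : ix + (n' - ix) = n' by lia.
rewrite (bang_assocE _ _ _ e3 e4) [RHS]chom_compE [in RHS]chom_compE sE.
have [ii|ni] := eqVneq i ix; last first.
  by rewrite !gslice_tens0 // !chom0 scale0r.
have yj : iy = j by lia.
have qE : q = n' - ix by lia.
subst ix iy; move: e' e2; rewrite qE => e' e2.
rewrite (gslice_tens (fun i => gbang_complete A A i)) chomZ !(gslice_tens cA) chomZ scalerA.
reflexivity.
Qed.

(** After rebracketing, the value of [lam] on the left factor occupies the first
    two positions, whence the two slices. *)
Lemma comul_map_right_slice l (lam : ghom A (gbang A A) l) (q n1 n' i i1 j j1 j2 r : int)
    (e : q + (l + 0) = n1) (e1 : n1 + 0 = n') (ei : i + i1 = j) (ej : j2 + l = j)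
    (eq : j2 + j1 = q) (e2 : i1 + j1 = r) (e' : i + r = n')
    (f : chom (A i) (scalars k)) (g : chom (A i1) (scalars k)) (y : gbang A A q) :
  gslice e2 g (gslice e' f (bang_assoc A A A n1 n' e1 ((lam !og gid A) q n1 e y))) =
  gslice eq (chom_comp g (chom_comp (gslice ei f) (lam j2 j ej))) y.
Proof.
pose h := chom_comp (gslice e2 g) (chom_comp (gslice e' f)
  (chom_comp (bang_assoc A A A n1 n' e1) ((lam !og gid A) q n1 e))).
have hE z : gslice e2 g (gslice e' f (bang_assoc A A A n1 n' e1 ((lam !og gid A) q n1 e z))) = h z.
  by rewrite /h !chom_compE.
rewrite hE; move: y; apply: gbang_eq => // ix iz exz x z; rewrite -hE {h hE}.
have e4 : iz + 0 = iz by lia.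
have e5 : ix + l + iz = n1 by lia.
rewrite (gbang_mapE _ _ _ _ e5 erefl e4) gidE mul0r expr0z scale1r.
have [ii|ni] := eqVneq ix j2; last first.
  rewrite gslice_tens0; last by rewrite eq_sym.
  move: (lam ix (ix + l) erefl x) => w.
  pose h := chom_comp (gslice e2 g) (chom_comp (gslice e' f)
    (chom_comp (bang_assoc A A A n1 n' e1) (gbang_tens_r (gbang A A) e5 z))).
  transitivity (h w); first by rewrite /h !chom_compE gbang_tens_rE.
  transitivity ((0 : chom (gbang A A (ix + l)) (A j1)) w); last by [].
  move: w; apply: gbang_eq => // iu iv euv u v.
  have e6 : iv + iz = n' - iu by lia.
  have e7 : iu + (n' - iu) = n' by lia.
  rewrite /h !chom_compE gbang_tens_rE (bang_assocE _ _ _ e6 e7) [RHS]/= {h}.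
  have [iiu|niu] := eqVneq i iu; last by rewrite gslice_tens0 ?chom0.
  subst iu; have rE : r = n' - i by lia.
  move: e2 e'; rewrite rE => e2 e'.
  rewrite (gslice_tens (fun i => gbang_complete A A i)) chomZ gslice_tens0 ?scaler0 //.
  by apply: contraNneq ni => ?; apply/eqP; lia.
have zz : iz = j1 by lia.
subst ix iz; case: _ / ej ei => ei; rewrite (gslice_tens cA) !chom_compE.
exact: assoc_slice.
Qed.

Lemma counit_left_slice d (eps : ghom A (gunit k) d) (q n1 n' i : int)
    (e : q + (d + 0) = n1) (e1 : n1 + 0 = n') (ei : i + n' = q) (y : gbang A A q) :
  bang_lunit A n1 n' e1 ((eps !og gid A) q n1 e y) = gslice ei (counit_fun eps i) y.
Proof.
rewrite -[LHS]chom_compE; move: y; apply: gbang_eq => // ix iz exz x z.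
rewrite chom_compE.
have e4 : iz + 0 = iz by lia.
have e5 : ix + d + iz = n1 by lia.
rewrite (gbang_mapE _ _ _ _ e5 erefl e4) gidE mul0r expr0z scale1r.
have [ii|ni] := eqVneq i ix; last first.
  rewrite gslice_tens0 // [eps _ _ _ _](gunit_eq0 _ (i := ix + d)).
    by rewrite gbang_tens0l chom0.
  by move/eqP: ni => ni H; apply: ni; lia.
have zz : iz = n' by lia.
subst ix iz; rewrite (gslice_tens cA) (bang_lunitE cA) counit_funE; reflexivity.
Qed.

Lemma counit_right_slice d (eps : ghom A (gunit k) d) (q n1 n' i : int)
    (e : q + (0 + d) = n1) (e1 : n1 + 0 = n') (ei : n' + i = q) (g : chom (A n') (scalars k))
    (y : gbang A A q) :
  (g (bang_runit A n1 n' e1 ((gid A !og eps) q n1 e y)) : k) =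
  (-1) ^ (d * n') * counit_fun eps i (gslice ei g y).
Proof.
have -> : (-1) ^ (d * n') * counit_fun eps i (gslice ei g y) =
    chom_comp ((-1) ^ (d * n') *: counit_fun eps i) (gslice ei g) y.
  by rewrite [RHS]chom_compE scale_chomE.
pose h := chom_comp g (chom_comp (bang_runit A n1 n' e1) ((gid A !og eps) q n1 e)).
have hE z : g (bang_runit A n1 n' e1 ((gid A !og eps) q n1 e z)) = h z by rewrite /h !chom_compE.
rewrite hE; move: y; apply: (@gbang_eq _ _ _ _ (scalars k)) => [|ix iz exz x z]; first exact: discrete_separated.
rewrite -hE chom_compE scale_chomE {h hE}.
have e4 : ix + 0 = ix by lia.
have e5 : ix + (iz + d) = n1 by lia.
rewrite (gbang_mapE _ _ _ _ e5 e4 erefl) gidE.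
have [ii|ni] := eqVneq n' ix; last first.
  rewrite gslice_tens0 // [eps _ _ _ _](gunit_eq0 _ (i := iz + d)).
    by rewrite gbang_tens0r scaler0 !chom0 scaler0.
  by move/eqP: ni => ni H; apply: ni; lia.
have zz : iz = i by lia.
subst ix iz; rewrite (gslice_tens cA) // !chomZ (bang_runitE cA) chomZ.
rewrite counit_funE !scalars_scaleE; congr (_ * _); exact: mulrC.
Qed.

Lemma swap_slice (n n' i j : int) (e0 : n + 0 = n') (e : i + j = n) (e' : j + i = n')
    (f : chom (A j) (scalars k)) (g : chom (A i) (scalars k)) (y : gbang A A n) :
  (g (gslice e' f (bang_swap A A n n' e0 y)) : k) = (-1) ^ (i * j) * (f (gslice e g y) : k).
Proof.
have -> : (-1) ^ (i * j) * (f (gslice e g y) : k) = chom_comp ((-1) ^ (i * j) *: f) (gslice e g) y.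
  by rewrite [RHS]chom_compE scale_chomE.
pose h := chom_comp g (chom_comp (gslice e' f) (bang_swap A A n n' e0)).
have hE z : g (gslice e' f (bang_swap A A n n' e0 z)) = h z by rewrite /h !chom_compE.
rewrite hE; move: y; apply: (@gbang_eq _ _ _ _ (scalars k)) => [|ix iy exy x y]; first exact: discrete_separated.
rewrite -hE chom_compE scale_chomE {h hE}.
have e3 : iy + ix = n' by lia.
rewrite (bang_swapE _ _ e3) !chomZ.
have [ii|ni] := eqVneq i ix; last first.
  rewrite [in RHS]gslice_tens0 // gslice_tens0 ?chom0 ?scaler0 //.
  by apply: contraNneq ni => ?; apply/eqP; lia.
have yj : iy = j by lia.
subst ix iy; rewrite !(gslice_tens cA) !chomZ; congr (_ *: _).
by rewrite !scalars_scaleE mulrC.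
Qed.

End SliceEvaluations.

(** The sides of the axioms of a coFrobenius bialgebra, evaluated on elements and
    slices. *)
Section Composites.
Variables (k : fieldType) (A : gspace k).
Hypothesis cA : forall i, sep_complete (A i).
Variables (m l d : int) (mu : ghom (gstar A A) A m) (lam : ghom A (gbang A A) l).
Variables (p : ghom (gstar A A) (gunit k) d) (c : ghom (gunit k) (gbang A A) d).

Definition unit_elt d (eta : ghom (gunit k) A d) : A d := eta 0 d (add0r d) (gunit1 k).

Lemma unit_eltE d' (eta : ghom (gunit k) A d') (e : 0 + d' = d') : eta 0 d' e (gunit1 k) = unit_elt eta.
Proof. by rewrite /unit_elt (int_eq_irr e (add0r d')). Qed.

Lemma mul_mul_l (i j q r n n' p1 : int) (e1 : i + j = r) (e2 : r + q = n)
    (e : n + (m + 0 + m) = n') (e4 : i + j + m = p1) (e5 : p1 + q + m = n') a b x :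
  (mu \og (mu *og gid A)) n n' e (gstar_tens e2 (gstar_tens e1 a b) x) =
  gmul mu e5 (gmul mu e4 a b) x.
Proof.
have e6 : n + (m + 0) = n + m by lia.
have e7 : n + m + m = n' by lia.
have e8 : p1 + q = n + m by lia.
have e9 : q + 0 = q by lia.
have e10 : r + m = p1 by lia.
rewrite (gcompE _ _ _ e6 e7) (gstar_mapE _ _ _ _ e8 e10 e9) gidE mul0r expr0z scale1r.
by rewrite (gmulE _ _ _ e5) (gmulE _ _ _ e4).
Qed.

Lemma mul_mul_r (i j q r n n' p1 : int) (e1 : j + q = r) (e2 : i + r = n)
    (e : n + (0 + m + m) = n') (e4 : j + q + m = p1) (e5 : i + p1 + m = n') a b x :
  (mu \og (gid A *og mu)) n n' e (gstar_tens e2 a (gstar_tens e1 b x)) =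
  (-1) ^ (m * i) *: gmul mu e5 a (gmul mu e4 b x).
Proof.
have e6 : n + (0 + m) = n + m by lia.
have e7 : n + m + m = n' by lia.
have e8 : i + p1 = n + m by lia.
have e9 : i + 0 = i by lia.
have e10 : r + m = p1 by lia.
rewrite (gcompE _ _ _ e6 e7) (gstar_mapE _ _ _ _ e8 e9 e10) gidE chomZ.
by rewrite (gmulE _ _ _ e5) (gmulE _ _ _ e4).
Qed.

Lemma unit_mul (d' : int) (eta : ghom (gunit k) A d') (i i' : int)
    (e : i + (0 + (d' + 0 + m)) = i') (e1 : d' + i + m = i') (a : A i) :
  (mu \og (eta *og gid A) \og star_lunit A) i i' e a = gmul mu e1 (unit_elt eta) a.
Proof.
have e2 : i + 0 = i by lia.
have e3 : i + (d' + 0 + m) = i' by lia.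
have e4 : i + (d' + 0) = d' + i by lia.
have e5 : 0 + d' = d' by lia.
have e6 : 0 + i = i by lia.
rewrite (gcompE _ _ _ e2 e3) (gcompE _ _ _ e4 e1) (star_lunitE _ e6).
rewrite (gstar_mapE _ _ _ _ erefl e5 e2) gidE mul0r expr0z scale1r unit_eltE.
by rewrite (gmulE _ _ _ e1).
Qed.

Lemma mul_unit (d' : int) (eta : ghom (gunit k) A d') (i i' : int)
    (e : i + (0 + (0 + d' + m)) = i') (e1 : i + d' + m = i') (a : A i) :
  (mu \og (gid A *og eta) \og star_runit A) i i' e a =
  (-1) ^ (d' * i) *: gmul mu e1 a (unit_elt eta).
Proof.
have e2 : i + 0 = i by lia.
have e3 : i + (0 + d' + m) = i' by lia.
have e4 : i + (0 + d') = i + d' by lia.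
have e5 : 0 + d' = d' by lia.
rewrite (gcompE _ _ _ e2 e3) (gcompE _ _ _ e4 e1) (star_runitE _ e2).
rewrite (gstar_mapE _ _ _ _ erefl e2 e5) gidE chomZ unit_eltE.
by rewrite (gmulE _ _ _ e1).
Qed.

Lemma pairing_comul (i j n n' q i1 : int) (e0 : i + j = n) (e : n + (0 + l + (0 + (d + 0 + 0))) = n')
    (eq : j + l = q) (ei : i1 + n' = q) (a : A i) (b : A j) :
  (bang_lunit A \og (p !og gid A) \og star_bang A A A \og (gid A *og lam)) n n' e
     (gstar_tens e0 a b) =
  (-1) ^ (l * i) *: gslice ei (pair_fun p a i1) (lam j q eq b).
Proof.
have e1 : n + (0 + l) = n + l by lia.
have e2 : n + l + (0 + (d + 0 + 0)) = n' by lia.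
have e3 : i + 0 = i by lia.
have e4 : i + q = n + l by lia.
have e5 : n + l + 0 = n + l by lia.
have e6 : n + l + (d + 0 + 0) = n' by lia.
have e7 : n + l + (d + 0) = n + l + d by lia.
have e8 : n + l + d + 0 = n' by lia.
rewrite (gcompE _ _ _ e1 e2) (gstar_mapE _ _ _ _ e4 e3 eq) gidE chomZ.
rewrite (gcompE _ _ _ e5 e6) (gcompE _ _ _ e7 e8).
by rewrite (left_pairing_slice cA _ _ _ _ _ ei).
Qed.

Lemma comul_pairing (i j n n' q i1 : int) (e0 : i + j = n) (e : n + (l + 0 + (0 + (0 + d + 0))) = n')
    (eq : i + l = q) (ei : n' + i1 = q) (g : chom (A n') (scalars k)) (a : A i) (b : A j) :
  (g ((bang_runit A \og (gid A !og p) \og bang_star A A A \og (lam *og gid A)) n n' e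
     (gstar_tens e0 a b)) : k) =
  (-1) ^ (d * n') * pair_fun p (gslice ei g (lam i q eq a)) j b.
Proof.
have e1 : n + (l + 0) = n + l by lia.
have e2 : n + l + (0 + (0 + d + 0)) = n' by lia.
have e3 : j + 0 = j by lia.
have e4 : q + j = n + l by lia.
have e5 : n + l + 0 = n + l by lia.
have e6 : n + l + (0 + d + 0) = n' by lia.
have e7 : n + l + (0 + d) = n + l + d by lia.
have e8 : n + l + d + 0 = n' by lia.
rewrite (gcompE _ _ _ e1 e2) (gstar_mapE _ _ _ _ e4 eq e3) gidE mul0r expr0z scale1r.
rewrite (gcompE _ _ _ e5 e6) (gcompE _ _ _ e7 e8).
by rewrite (right_pairing_slice cA _ _ _ _ _ ei).
Qed.

Definition copair_elt (c : ghom (gunit k) (gbang A A) d) : gbang A A d := c 0 d (add0r d) (gunit1 k).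

Lemma copair_mul (i j j' i1 n' : int) (e : j + (0 + (d + 0 + (0 + (0 + m)))) = n')
    (ei : i + i1 = d) (ej : i1 + j + m = j') (e' : i + j' = n') (f : chom (A i) (scalars k)) (x : A j) :
  gslice e' f (((gid A !og mu) \og bang_star A A A \og (c *og gid A) \og star_lunit A) j n' e x) =
  (-1) ^ (m * i) *: gmul mu ej (gslice ei f (copair_elt c)) x.
Proof.
have e1 : j + 0 = j by lia.
have e2 : j + (d + 0 + (0 + (0 + m))) = n' by lia.
have e3 : j + (d + 0) = d + j by lia.
have e4 : d + j + (0 + (0 + m)) = n' by lia.
have e5 : d + j + 0 = d + j by lia.
have e6 : d + j + (0 + m) = n' by lia.
have e7 : 0 + j = j by lia.
have e8 : 0 + d = d by lia.
rewrite (gcompE _ _ _ e1 e2) (star_lunitE _ e7) (gcompE _ _ _ e3 e4).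
rewrite (gstar_mapE _ _ _ _ erefl e8 e1) gidE mul0r expr0z scale1r.
rewrite (gcompE _ _ _ e5 e6) (comul_left_slice cA _ _ _ _ ei ej).
by rewrite (int_eq_irr e8 (add0r d)).
Qed.

Lemma mul_copair (i i' j j1 n' : int) (e : j + (0 + (0 + d + (0 + (m + 0)))) = n')
    (ei : i + j1 = d) (ej : j + i + m = i') (e' : i' + j1 = n')
    (f : chom (A i') (scalars k)) (x : A j) :
  gslice e' f (((mu !og gid A) \og star_bang A A A \og (gid A *og c) \og star_runit A) j n' e x) =
  (-1) ^ (d * j) *: gslice ei (chom_comp f (gmul_l mu ej x)) (copair_elt c).
Proof.
have e1 : j + 0 = j by lia.
have e2 : j + (0 + d + (0 + (m + 0))) = n' by lia.
have e3 : j + (0 + d) = j + d by lia.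
have e4 : j + d + (0 + (m + 0)) = n' by lia.
have e5 : j + d + 0 = j + d by lia.
have e6 : j + d + (m + 0) = n' by lia.
have e8 : 0 + d = d by lia.
rewrite (gcompE _ _ _ e1 e2) (star_runitE _ e1) (gcompE _ _ _ e3 e4).
rewrite (gstar_mapE _ _ _ _ erefl e1 e8) gidE !chomZ; congr (_ *: _).
rewrite (gcompE _ _ _ e5 e6) (comul_right_slice cA _ _ _ _ ei ej).
by rewrite (int_eq_irr e8 (add0r d)).
Qed.

Lemma coassoc_l (i i1 x q j j1 j2 r n' : int) (e : x + (l + (l + 0 + 0)) = n') (eq : x + l = q)
    (ei : i + i1 = j) (ej : j2 + l = j) (eqq : j2 + j1 = q) (e2 : i1 + j1 = r) (e' : i + r = n')
    (f : chom (A i) (scalars k)) (g : chom (A i1) (scalars k)) (a : A x) :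
  gslice e2 g (gslice e' f ((bang_assoc A A A \og (lam !og gid A) \og lam) x n' e a)) =
  gslice eqq (chom_comp g (chom_comp (gslice ei f) (lam j2 j ej))) (lam x q eq a).
Proof.
have e3 : q + (l + 0 + 0) = n' by lia.
have e4 : q + (l + 0) = q + l by lia.
have e5 : q + l + 0 = n' by lia.
rewrite (gcompE _ _ _ eq e3) (gcompE _ _ _ e4 e5).
exact: comul_map_right_slice.
Qed.

Lemma coassoc_r (i x q j j1 n' : int) (e : x + (l + (0 + l)) = n') (eq : x + l = q)
    (ei : i + j = q) (ej : j + l = j1) (e' : i + j1 = n')
    (f : chom (A i) (scalars k)) (a : A x) :
  gslice e' f (((gid A !og lam) \og lam) x n' e a) =
  (-1) ^ (l * i) *: lam j j1 ej (gslice ei f (lam x q eq a)).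
Proof.
have e3 : q + (0 + l) = n' by lia.
by rewrite (gcompE _ _ _ eq e3) (comul_map_left_slice cA _ _ ei ej).
Qed.

Lemma counit_comul_l d' (eps : ghom A (gunit k) d') (x q i n' : int)
    (e : x + (l + (d' + 0 + 0)) = n') (eq : x + l = q) (ei : i + n' = q) (a : A x) :
  (bang_lunit A \og (eps !og gid A) \og lam) x n' e a =
  gslice ei (counit_fun eps i) (lam x q eq a).
Proof.
have e3 : q + (d' + 0 + 0) = n' by lia.
have e4 : q + (d' + 0) = q + d' by lia.
have e5 : q + d' + 0 = n' by lia.
by rewrite (gcompE _ _ _ eq e3) (gcompE _ _ _ e4 e5) (counit_left_slice cA _ _ _ ei).
Qed.

Lemma counit_comul_r d' (eps : ghom A (gunit k) d') (x q i n' : int)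
    (e : x + (l + (0 + d' + 0)) = n') (eq : x + l = q) (ei : n' + i = q)
    (g : chom (A n') (scalars k)) (a : A x) :
  (g ((bang_runit A \og (gid A !og eps) \og lam) x n' e a) : k) =
  (-1) ^ (d' * n') * counit_fun eps i (gslice ei g (lam x q eq a)).
Proof.
have e3 : q + (0 + d' + 0) = n' by lia.
have e4 : q + (0 + d') = q + d' by lia.
have e5 : q + d' + 0 = n' by lia.
by rewrite (gcompE _ _ _ eq e3) (gcompE _ _ _ e4 e5) (counit_right_slice cA _ _ _ ei).
Qed.

Lemma pairing_swap (i j n n' : int) (e0 : i + j = n) (e : n + (0 + d) = n') (a : A i) (b : A j) :
  gunit_val ((p \og star_swap A A) n n' e (gstar_tens e0 a b)) =
  (-1) ^ (i * j) * pair_fun p b i a.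
Proof.
have e1 : n + 0 = n by lia.
have e2 : n + d = n' by lia.
have e3 : j + i = n by lia.
by rewrite (gcompE _ _ _ e1 e2) (star_swapE _ _ e3) chomZ gunit_valZ pair_funE.
Qed.

End Composites.

(** * Frobenius structures on elements *)

Section ElementForm.
Variables (k : fieldType) (A : gspace k) (m l : int).
Variables (mu : ghom (gstar A A) A m) (eta : ghom (gunit k) A (- m)) (eps : ghom A (gunit k) (- l)).

(** [eps (a b)] as a continuous functional of [b]; it is the pairing up to the sign
    [(-1)^l]. *)
Definition frob_form (i : int) (a : A i) (j : int) : chom (A j) (scalars k) :=
  chom_comp (counit_fun eps (i + j + m)) (gmul_l mu erefl a).

Local Notation form := frob_form.

Lemma frob_formE (i j n : int) (e : i + j + m = n) (a : A i) (b : A j) :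
  counit_fun eps n (gmul mu e a b) = form a j b.
Proof. by subst n; rewrite /frob_form chom_compE gmul_lE. Qed.

Lemma frob_form0 (i j : int) (a : A i) (b : A j) : i + j + m <> l -> form a j b = 0.
Proof. by move=> ne; rewrite -(frob_formE erefl) counit_fun0 //; lia. Qed.

Lemma frob_formZl (i j : int) c (a : A i) (b : A j) : form (c *: a) j b = c * (form a j b : k) :> k.
Proof.
by rewrite -[form (c *: a) _ _](frob_formE erefl) -[form a _ _](frob_formE erefl) gmulZl chomZ scalars_scaleE.
Qed.

Lemma frob_formBl (i j : int) (a a' : A i) (b : A j) : form (a - a') j b = (form a j b : k) - form a' j b :> k.
Proof.
have [h hE] := gmul_r_ex mu (erefl (i + j + m)) b.
rewrite -[form (a - a') _ _](frob_formE erefl) -[form a _ _](frob_formE erefl) -[form a' _ _](frob_formE erefl).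
by rewrite -!hE !chomB.
Qed.

(** A graded symmetric Frobenius algebra with product of arbitrary degree, in terms
    of elements.  The last two conditions say that the form is perfect; the signs in
    the others are those of the Koszul rule and of the axioms for a product of
    degree [m]. *)
Record elt_frobenius : Prop := {
  ef_assoc : forall (i j q p1 p2 n : int) (e1 : i + j + m = p1) (e2 : p1 + q + m = n)
      (e3 : j + q + m = p2) (e4 : i + p2 + m = n) a b c,
    gmul mu e2 (gmul mu e1 a b) c = (-1) ^ (m * (i + 1)) *: gmul mu e4 a (gmul mu e3 b c);
  ef_unit_l : forall (i : int) (e : - m + i + m = i) a,
    gmul mu e (unit_elt eta) a = (-1) ^ m *: a;
  ef_unit_r : forall (i : int) (e : i + - m + m = i) a,
    gmul mu e a (unit_elt eta) = (-1) ^ (m * i) *: a;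
  ef_sym : forall (i j : int) (a : A i) (b : A j),
    form a j b = (-1) ^ (m + i * j) * (form b i a : k) :> k;
  ef_dual : forall i j : int, i + j + m = l ->
    exists phi : chom (dual (A j)) (A i), forall (f : chom (A j) (scalars k)) b,
      form (phi f) j b = f b;
  ef_nondeg : forall (i : int) (a : A i), (forall (j : int) (b : A j), form a j b = 0) -> a = 0 }.

End ElementForm.

Section ElementTheory.
Variables (k : fieldType) (A : gspace k) (m l : int).
Hypothesis cA : forall i, sep_complete (A i).
Variables (mu : ghom (gstar A A) A m) (eta : ghom (gunit k) A (- m)) (eps : ghom A (gunit k) (- l)).

Local Notation form := (frob_form mu eps).

Hypothesis efA : elt_frobenius mu eta eps.

(** Invariance of the form, a consequence of associativity. *)
Lemma frob_form_mul (i j n r : int) (e : i + j + m = n) (e1 : j + r + m = l - m - i) (a : A i) (x : A j) :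
  chom_comp (form a (l - m - i)) (gmul_l mu e1 x) = (-1) ^ (m * (i + 1)) *: form (gmul mu e a x) r.
Proof.
apply: chom_ext => y; rewrite chom_compE gmul_lE scale_chomE.
have e2 : i + (l - m - i) + m = l by lia.
have e3 : n + r + m = l by lia.
rewrite -(frob_formE _ _ e2) -(frob_formE _ _ e3) (ef_assoc efA e e3 e1 e2) chomZ.
by rewrite signK.
Qed.

Lemma form_inj_l (i : int) (a a' : A i) :
  (forall (j : int) (b : A j), form a j b = form a' j b) -> a = a'.
Proof.
move=> aa'; apply/eqP; rewrite -subr_eq0; apply/eqP; apply: (ef_nondeg efA) => j b.
by rewrite frob_formBl aa' subrr.
Qed.

Lemma form_inj_r (j : int) (b b' : A j) :
  (forall (i : int) (a : A i), form a j b = form a j b') -> b = b'.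
Proof.
move=> bb'; apply: form_inj_l => i a.
by rewrite !(ef_sym efA b) !(ef_sym efA b') bb'.
Qed.

(** This lets slices by the form replace slices by arbitrary functionals. *)
Lemma form_surj (j : int) (f : chom (A j) (scalars k)) :
  exists a : A (l - m - j), f = form a j.
Proof.
have e : l - m - j + j + m = l by lia.
by have [phi phiE] := ef_dual efA e; exists (phi f); apply: chom_ext => b; rewrite phiE.
Qed.

Lemma form_slices_ext (B : gspace k) n (y z : gbang A B n) : (forall i, sep_complete (B i)) ->
  (forall (i j : int) (e : l - m - i + j = n) (a : A i),
     gslice e (form a (l - m - i)) y = gslice e (form a (l - m - i)) z) -> y = z.
Proof.
move=> cB yz; apply: (gslice_ext cB) => i j e f; have [a ->] := form_surj f.
move: (yz (l - m - i) j); have -> : l - m - (l - m - i) = i by lia.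
by move=> /(_ e a).
Qed.

Lemma counit_fun_form (i : int) : counit_fun eps i = (-1) ^ m *: form (unit_elt eta) i.
Proof.
apply: chom_ext => x; rewrite scale_chomE.
have e : - m + i + m = i by lia.
by rewrite -(frob_formE _ _ e) (ef_unit_l efA) chomZ signK.
Qed.

End ElementTheory.

Section Coproduct.
Variables (k : fieldType) (A : gspace k) (m l : int).
Hypothesis cA : forall i, sep_complete (A i).
Variable S : cofrob_data A m l.

Local Notation mu := (cofrob_mul S).
Local Notation lam := (cofrob_comul S).
Local Notation eta := (cofrob_unit S).
Local Notation eps := (cofrob_counit S).

Local Notation form := (frob_form mu eps).

(** With [lam b = sum b' (x) b''], this is [sum eps (a b') b'' = a b] up to sign: the
    coproduct is the transpose of the product. *)
Definition comul_adjoint := forall (i j n q i1 : int) (e : i + j + m = n) (eq : j + l = q)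
    (ei : i1 + n = q) (a : A i) (b : A j),
  gslice ei (form a i1) (lam j q eq b) = (-1) ^ (m * l + l * i) *: gmul mu e a b.

Lemma pair_fun_pairing (i j : int) (a : A i) :
  pair_fun (pairing S) a j = (-1) ^ l *: form a j.
Proof.
apply: chom_ext => b; rewrite scale_chomE scalars_scaleE -(pair_funE (pairing S) erefl erefl).
have e1 : i + j + m = i + j + m by [].
have e2 : i + j + m + - l = i + j + (m + - l) by lia.
rewrite /pairing gscaleE gunit_valZ (gcompE _ _ _ e1 e2) counit_funE.
by rewrite (gmulE _ _ _ e1) frob_formE.
Qed.

Lemma copair_elt_copairing (e : - m + l = - m + l) :
  copair_elt (copairing S) = (-1) ^ (l * m + m) *: lam (- m) (- m + l) e (unit_elt eta).
Proof.
have e1 : 0 + - m = - m by lia.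
rewrite /copair_elt /copairing gscaleE (gcompE _ _ _ e1 e).
by rewrite unit_eltE.
Qed.

(** [(p (x) 1)(1 (x) lam)] evaluated at [a (x) b] is a slice of [lam b] by the form. *)
Lemma mul_l_adjoint : cofrob_mul S =g
    (-1) ^ (m * l + l) *g (bang_lunit A \og (pairing S !og gid A)
      \og star_bang A A A \og (gid A *og cofrob_comul S)) <-> comul_adjoint.
Proof.
split=> [H i j n q i1 e eq ei a b|H].
  have e1 : i + j + (0 + l + (0 + (m + - l + 0 + 0))) = n by lia.
  have := congr1 (fun h : chom _ _ => h (gstar_tens erefl a b)) (H _ _ e e1).
  rewrite gscaleE (pairing_comul cA _ _ _ _ eq ei) pair_fun_pairing (gsliceZ cA).
  rewrite -[cofrob_mul S _ _ _ _]/(gmul mu e a b) => ->; rewrite !signZ.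
  by apply/esym/even_sign_scale; sign_parity.
move=> n n' e e1; apply: chom_ext; apply: gstar_eq => [|i j e0 a b]; first by have [] := cA n'.
have e2 : i + j + m = n' by lia.
have e3 : j + l - n' + n' = j + l by lia.
rewrite gscaleE (pairing_comul cA _ _ _ _ erefl e3) pair_fun_pairing (gsliceZ cA).
rewrite (H _ _ _ _ _ e2) (gmulE _ _ _ e2) !signZ.
by apply/esym/even_sign_scale; sign_parity.
Qed.

End Coproduct.

(** * From coFrobenius structures to Frobenius forms *)

Section ProductAxioms.
Variables (k : fieldType) (A : gspace k) (m : int) (mu : ghom (gstar A A) A m).

Lemma star_associativeP : star_associative mu <->
  forall (i j q p1 p2 n : int) (e1 : i + j + m = p1) (e2 : p1 + q + m = n)
      (e3 : j + q + m = p2) (e4 : i + p2 + m = n) a b c,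
    gmul mu e2 (gmul mu e1 a b) c = (-1) ^ (m * (i + 1)) *: gmul mu e4 a (gmul mu e3 b c).
Proof.
split=> [H i j q p1 p2 n e1 e2 e3 e4 a b c|H i j r p q n n' e1 e2 e3 e4 e e' a b c].
  have f1 : i + (j + q) = i + j + q by lia.
  have f2 : i + j + q + (m + 0 + m) = n by lia.
  have f3 : i + j + q + (0 + m + m) = n by lia.
  apply: etrans (esym (mul_mul_l mu erefl erefl f2 e1 e2 a b c)) _.
  apply: etrans (H _ _ _ _ _ _ _ erefl erefl erefl f1 f2 f3 a b c) _.
  apply: etrans (congr1 _ (mul_mul_r mu erefl f1 f3 e3 e4 a b c)) _.
  by rewrite signZ; apply: scale_sign; sign_parity.
have f1 : i + j + m = p + m by lia.
have f2 : p + m + r + m = n' by lia.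
have f3 : j + r + m = q + m by lia.
have f4 : i + (q + m) + m = n' by lia.
apply: etrans (mul_mul_l mu e1 e2 e f1 f2 a b c) _.
apply: etrans (H _ _ _ _ _ _ f1 f2 f3 f4 a b c) _.
apply/esym; apply: etrans (congr1 _ (mul_mul_r mu e3 e4 e' f3 f4 a b c)) _.
by rewrite signZ; apply: scale_sign; sign_parity.
Qed.

Lemma star_unitP (eta : ghom (gunit k) A (- m)) : star_unit mu eta <->
  (forall (i : int) (e : - m + i + m = i) a, gmul mu e (unit_elt eta) a = (-1) ^ m *: a) /\
  (forall (i : int) (e : i + - m + m = i) a, gmul mu e a (unit_elt eta) = (-1) ^ (m * i) *: a).
Proof.
split=> [[Hl Hr]|[Hl Hr]]; split.
- move=> i e a; have f1 : i + (0 + (- m + 0 + m)) = i by lia.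
  have f2 : i + 0 = i by lia.
  have := congr1 (fun h : chom _ _ => h a) (Hl _ _ f1 f2).
  by rewrite gscaleE (unit_mul _ _ _ e) gidE => Ha; rewrite -[in RHS]Ha signK; reflexivity.
- move=> i e a; have f1 : i + (0 + (0 + - m + m)) = i by lia.
  have f2 : i + 0 = i by lia.
  have := congr1 (fun h : chom _ _ => h a) (Hr _ _ f1 f2).
  rewrite (mul_unit _ _ _ e) gidE => Ha; rewrite -[in RHS]Ha signZ.
  by apply/esym/even_sign_scale; sign_parity.
- move=> i j e e'; apply: chom_ext => a; have ij : j = i by lia.
  move: e e'; rewrite ij => e e' {j ij}; have f : - m + i + m = i by lia.
  by rewrite gscaleE (unit_mul _ _ _ f) gidE Hl signK.
- move=> i j e e'; apply: chom_ext => a; have ij : j = i by lia.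
  move: e e'; rewrite ij => e e' {j ij}; have f : i + - m + m = i by lia.
  rewrite (mul_unit _ _ _ f) gidE Hr signZ.
  by apply: even_sign_scale; sign_parity.
Qed.

End ProductAxioms.

Section CoFrobenius.
Variables (k : fieldType) (A : gspace k) (m l : int).
Hypothesis tA : gtate A.
Variable S : cofrob_data A m l.

Let cA i : sep_complete (A i) := tate_complete (tA i).
Local Notation mu := (cofrob_mul S).
Local Notation lam := (cofrob_comul S).
Local Notation eta := (cofrob_unit S).
Local Notation eps := (cofrob_counit S).

Local Notation form := (frob_form mu eps).

Lemma pairing_symP : (pairing S \og star_swap A A =g (-1) ^ m *g pairing S) <->
  forall (i j : int) (a : A i) (b : A j),
    form a j b = (-1) ^ (m + i * j) * (form b i a : k) :> k.
Proof.
have pfE i j (a : A i) (b : A j) : (pair_fun (pairing S) a j b : k) = (-1) ^ l * (form a j b : k).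
  by rewrite pair_fun_pairing scale_chomE scalars_scaleE.
split=> [H i j a b|H].
  have f1 : i + j + (0 + (m + - l)) = i + j + (m - l) by lia.
  have := congr1 (fun h : chom _ _ => gunit_val (h (gstar_tens erefl a b))) (H _ _ f1 erefl).
  rewrite (pairing_swap (pairing S) erefl) gscaleE gunit_valZ (pair_funE (pairing S)) !pfE => H1.
  have {}H1 := congr1 (fun x => (-1) ^ l * ((-1) ^ m * x)) H1.
  move: H1; rewrite /= !(mulrCA _ ((-1) ^ l)) !sign_mulK => <-.
  by rewrite mulrA signD.
move=> n n' e e'; apply: chom_ext; apply: gstar_eq => [|i j e0 a b].
  exact: discrete_separated.
apply: gunit_inj; rewrite (pairing_swap (pairing S) e0) gscaleE gunit_valZ (pair_funE (pairing S)) !pfE H.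
rewrite !mulrA !signD; congr (_ * _); apply: sign_eq; sign_parity.
Qed.

(** By the unit law, the slices of the copairing invert the pairing. *)
Lemma copair_slice (i j : int) (e : j + i = - m + l) (e1 : i + j + m = l) (a : A i) :
  (forall (i : int) (e : i + - m + m = i) a, gmul mu e a (unit_elt eta) = (-1) ^ (m * i) *: a) ->
  comul_adjoint S ->
  gslice e (form a j) (copair_elt (copairing S)) = (-1) ^ (m + (l + m) * i) *: a.
Proof.
move=> Hr adj; have e2 : i + - m + m = i by lia.
rewrite (copair_elt_copairing S erefl) chomZ (adj _ _ _ _ _ e2) Hr !signZ.
by apply: scale_sign; sign_parity.
Qed.

(** Perfectness of the form comes from the copairing.  Its slices recover [a] from
    [eps (a -)], whence non-degeneracy.  By [slice_chom] slicing the copairing is a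
    continuous map on the dual, and the relation [mu = (1 (x) p)(lam (x) 1)], up to
    sign, says that it is a right inverse of the pairing. *)
Lemma cofrobenius_elt : is_cofrobenius S -> elt_frobenius mu eta eps /\ comul_adjoint S.
Proof.
move=> CS; have adj := (mul_l_adjoint cA S).1 (cofrob_mul_l CS).
have [Hl Hr] := (star_unitP _ _).1 (cofrob_unitP CS).
split=> //; split=> //.
- exact: (star_associativeP _).1 (cofrob_assoc CS).
- exact: pairing_symP.1 (cofrob_pairing_sym CS).
- move=> i j ijm.
  have e1 : j + i = - m + l by lia.
  pose y := lam (- m) (- m + l) erefl (unit_elt eta).
  have [phi phiE] := slice_chom (gbang_at A A e1 y) (tA j) (cA i).
  exists ((-1) ^ (m + m * l + (m + l) * j + l) *: phi) => f b.
  rewrite scale_chomE phiE -gsliceE frob_formZl.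
  have e2 : - m + j + m = j by lia.
  have e3 : - m + j + (l + 0 + (0 + (0 + (m + - l) + 0))) = j by lia.
  have := congr1 (fun h : chom _ _ => f (h (gstar_tens erefl (unit_elt eta) b)))
    (cofrob_mul_r CS e2 e3).
  rewrite gscaleE chomZ (comul_pairing cA _ _ _ _ erefl e1) pair_fun_pairing.
  rewrite -[cofrob_mul S _ _ _ _]/(gmul mu e2 _ b) Hl chomZ !scalars_scaleE.
  rewrite scale_chomE scalars_scaleE -/y => H1.
  have {}H1 := congr1 (fun x => (-1) ^ m * x) H1.
  rewrite /= sign_mulK in H1; rewrite [in RHS]H1 !mulrA !signD.
  by congr (_ * _); apply: sign_eq; sign_parity.
- move=> i a a0.
  have e1 : l - m - i + i = - m + l by lia.
  have e2 : i + (l - m - i) + m = l by lia.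
  have := copair_slice e1 e2 a Hr adj.
  have -> : form a (l - m - i) = 0 by apply: chom_ext => b; exact: a0.
  rewrite (gslice0 cA) => /(congr1 (fun x => (-1) ^ (m + (l + m) * i) *: x)).
  by rewrite signK scaler0.
Qed.

End CoFrobenius.

(** * From Frobenius forms to coFrobenius structures *)

Section ElementToCoFrobenius.
Variables (k : fieldType) (A : gspace k) (m l : int).
Hypothesis tA : gtate A.
Variable S : cofrob_data A m l.

Let cA i : sep_complete (A i) := tate_complete (tA i).
Local Notation mu := (cofrob_mul S).
Local Notation lam := (cofrob_comul S).
Local Notation eta := (cofrob_unit S).
Local Notation eps := (cofrob_counit S).
Let cAA n : sep_complete (gbang A A n) := gbang_complete A A n.

Local Notation form := (frob_form mu eps).

Hypothesis efA : elt_frobenius mu eta eps.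
Hypothesis adj : comul_adjoint S.

Let Hr := ef_unit_r efA.

Lemma elt_comul_l : cofrob_comul S =g
    (gid A !og cofrob_mul S) \og bang_star A A A
      \og (copairing S *og gid A) \og star_lunit A.
Proof.
move=> j n' eq e; apply: chom_ext => x; apply: (form_slices_ext efA) => // i r e' a.
have e1 : i + j + m = r by lia.
have e2 : l - m - i + i = - m + l by lia.
have e3 : i + (l - m - i) + m = l by lia.
rewrite (copair_mul cA mu (copairing S) e e2 e1 e') (copair_slice e2 e3 _ Hr adj).
rewrite (adj e1 eq e') gmulZl signZ; apply: scale_sign; sign_parity.
Qed.

Lemma elt_comul_r : cofrob_comul S =g
    (-1) ^ m *g ((cofrob_mul S !og gid A) \og star_bang A A A
      \og (gid A *og copairing S) \og star_runit A).
Proof.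
move=> j n' eq e; apply: chom_ext => x; apply: (form_slices_ext efA) => // i r e' a.
have e1 : i + j + m = r by lia.
have e2 : l - m - r + r = - m + l by lia.
have e3 : j + (l - m - r) + m = l - m - i by lia.
have e4 : r + (l - m - r) + m = l by lia.
rewrite gscaleE chomZ (mul_copair cA mu (copairing S) e e2 e3 e').
rewrite (frob_form_mul efA e1) (gsliceZ cA) (copair_slice e2 e4 _ Hr adj).
rewrite (adj e1 eq e') !signZ; apply: scale_sign; rewrite -e1; sign_parity.
Qed.

Lemma elt_mul_r : cofrob_mul S =g
    (-1) ^ (m * l) *g (bang_runit A \og (gid A !og pairing S)
      \og bang_star A A A \og (cofrob_comul S *og gid A)).
Proof.
move=> n n' e e'; apply: chom_ext; apply: gstar_eq => [|i j e0 a b]; first by have [] := cA n'.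
have e1 : i + j + m = n' by lia.
rewrite gscaleE (gmulE _ _ _ e1); apply: (form_inj_r efA) => q x.
have [e2|ne2] := pselect (q + n' + m = l); last by rewrite !frob_form0.
have e3 : n' + (i + l - n') = i + l by lia.
have e4 : q + i + m = i + l - n' by lia.
have e5 : i + l - n' + j + m = l by lia.
rewrite chomZ (comul_pairing cA lam (pairing S) e0 e' erefl e3).
rewrite pair_fun_pairing scale_chomE (adj e4 erefl e3).
rewrite !scalars_scaleE frob_formZl -(frob_formE _ _ e5) -(frob_formE _ _ e2).
rewrite (ef_assoc efA e4 e5 e1 e2) chomZ scalars_scaleE !mulrA !signD.
apply/esym/even_sign_mul.
have -> : n' = l - m - q by lia.
sign_parity.
Qed.

(** Slicing twice turns the two sides into [(c b) a] and [c (b a)]. *)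
Lemma elt_coassoc : bang_coassociative (cofrob_comul S).
Proof.
move=> x n' e e'; apply: chom_ext => a; apply: (form_slices_ext efA) => // i r e1 b.
apply: (form_slices_ext efA) => // i1 j1 e2 c.
have f1 : i + x + m = r - l by lia.
have f2 : i1 + (r - l) + m = j1 by lia.
have f3 : l - m - i + (r - l) = x + l by lia.
have f4 : i1 + i + m = i1 + i + m by [].
have f5 : i1 + i + m + x + m = j1 by lia.
have f6 : l - m - (i1 + i + m) + j1 = x + l by lia.
have f7 : l - m - (i1 + i + m) + l = l - m - i + (l - m - i1) by lia.
have f8 : r - l + l = r by lia.
have f9 : i + (l - m - (i1 + i + m)) + m = l - m - i1 by lia.
rewrite (coassoc_l cA lam e erefl erefl f7 f6 e2 e1).
rewrite gscaleE !chomZ (coassoc_r cA lam e' erefl f3 f8 e1) !chomZ.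
rewrite (adj f1 erefl f3) !chomZ (adj f2 f8 e2).
(* Slicing [lam] by [b] and then evaluating the form of [c] is, up to sign, the
   form of [c b]. *)
have -> : chom_comp (form c (l - m - i1)) (chom_comp (gslice erefl (form b (l - m - i)))
    (lam (l - m - (i1 + i + m)) (l - m - i + (l - m - i1)) f7)) =
    (-1) ^ (m * l + l * i + m * (i1 + 1)) *: form (gmul mu f4 c b) (l - m - (i1 + i + m)).
  apply: chom_ext => z; rewrite 2!chom_compE scale_chomE (adj f9) chomZ.
  have f10 : i1 + (l - m - i1) + m = l by lia.
  have f11 : i1 + i + m + (l - m - (i1 + i + m)) + m = l by lia.
  rewrite -(frob_formE _ _ f10) -(frob_formE _ _ f11) (ef_assoc efA f4 f11 f9 f10) chomZ.
  rewrite signZ; apply: scale_sign; sign_parity.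
rewrite (gsliceZ cA) (adj f5) (ef_assoc efA f4 f5 f1 f2) !signZ.
apply: scale_sign; sign_parity.
Qed.

(** By [counit_fun_form], applying the counit is slicing by the unit. *)
Lemma elt_counit : bang_counit (cofrob_comul S) (cofrob_counit S).
Proof.
split=> x n' e e'; apply: chom_ext => a; have xn : n' = x by lia.
  move: e e'; rewrite xn => e e' {n' xn}.
  have e1 : l + x = x + l by lia.
  have e2 : - m + x + m = x by lia.
  rewrite (counit_comul_l cA lam _ e erefl e1) (counit_fun_form efA) (gsliceZ cA).
  rewrite (adj e2) (ef_unit_l efA) !signZ gidE.
  by apply: even_sign_scale; sign_parity.
move: e e'; rewrite xn => e e' {n' xn}.
have e1 : x + l = x + l by [].
rewrite gscaleE gidE; apply: (form_inj_r efA) => q b.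
have [e2|ne2] := pselect (q + x + m = l); last by rewrite !frob_form0.
rewrite chomZ (counit_comul_r cA lam _ e erefl e1) (adj e2) chomZ !scalars_scaleE.
rewrite -(frob_formE _ _ e2) !mulrA !signD.
apply: even_sign_mul.
have -> : x = l - m - q by lia.
by sign_parity.
Qed.

(** Slicing both factors reduces the symmetry of the copairing to that of the form. *)
Lemma elt_copairing_sym : bang_swap A A \og copairing S =g (-1) ^ l *g copairing S.
Proof.
move=> i n' e e'; apply: chom_ext => u.
have [i0|/eqP ni0] := eqVneq i 0; last by rewrite (gunit_eq0 u ni0) !chom0.
move: e e' u; rewrite i0 => e e' u {i0 i}.
rewrite (gunit_eq1 u) !chomZ; congr (_ *: _) => {u}.
have e1 : 0 + (- m + l) = - m + l by lia.
have e2 : - m + l + 0 = n' by lia.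
rewrite gscaleE (gcompE _ _ _ e1 e2); move: e2; have nE : n' = - m + l by lia.
move: e'; rewrite nE => e' e2 {e n' nE}.
have uE f : copairing S 0 (- m + l) f (gunit1 k) = copair_elt (copairing S).
  by rewrite /copair_elt (int_eq_irr f (add0r _)).
rewrite !uE; apply: (form_slices_ext efA) => // i j f1 a.
have ij : i = j by lia.
move: f1 a; rewrite ij => f1 a {i ij}.
have f2 : j + (l - m - j) + m = l by lia.
rewrite [in RHS]chomZ (copair_slice f1 f2 _ Hr adj).
apply: (form_inj_r efA) => q b.
have [f3|nf3] := pselect (q + j + m = l); last by rewrite !frob_form0.
have qE : q = l - m - j by lia.
move: b; rewrite qE => b {q qE f3}.
have f4 : j + (l - m - j) = - m + l by lia.
have f5 : l - m - j + j + m = l by lia.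
rewrite (swap_slice cA e2 f4 f1 _ (form b j)) (copair_slice f4 f5 _ Hr adj).
rewrite !chomZ !scalars_scaleE (ef_sym efA a b) !mulrA !signD; congr (_ * _).
by apply: sign_eq; sign_parity.
Qed.

Lemma elt_cofrobenius : is_cofrobenius S.
Proof.
split.
- exact: (star_associativeP _).2 (ef_assoc efA).
- by apply/star_unitP; split; [exact: ef_unit_l efA|exact: ef_unit_r efA].
- exact: elt_coassoc.
- exact: elt_counit.
- exact: elt_comul_l.
- exact: elt_comul_r.
- exact: (mul_l_adjoint cA S).2.
- exact: elt_mul_r.
- exact: elt_copairing_sym.
- exact: (pairing_symP S).2 (ef_sym efA).
Qed.

End ElementToCoFrobenius.

Section CoproductExistence.
Variables (k : fieldType) (A : gspace k) (m l : int).
Hypothesis tA : gtate A.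
Variables (mu : ghom (gstar A A) A m) (eta : ghom (gunit k) A (- m)) (eps : ghom A (gunit k) (- l)).
Hypothesis efA : elt_frobenius mu eta eps.

Let cA i : sep_complete (A i) := tate_complete (tA i).

Local Notation form := (frob_form mu eps).

(** The copairing is built from its slices, which the inverse of the pairing
    prescribes. *)
Lemma copairing_exists : exists c : gbang A A (- m + l),
  forall (i j : int) (e : j + i = - m + l) (a : A i),
    gslice e (form a j) c = (-1) ^ (m + (l + m) * i) *: a.
Proof.
have ex (j i : int) (e : j + i = - m + l) : exists y : bang (A j) (A i), forall a : A i,
    slice (A i) (form a j) y = (-1) ^ (m + (l + m) * i) *: a.
  have e1 : i + j + m = l by lia.
  have [phi phiE] := ef_dual efA e1.
  have [y yE] := slices_surjective (cA i) ((-1) ^ (m + (l + m) * i) *: phi).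
  exists y => a; rewrite yE scale_chomE; congr (_ *: _); apply: (form_inj_l efA) => r b.
  have [rj|/eqP nr] := eqVneq r j; first by move: b; rewrite rj => b; rewrite phiE.
  by rewrite !frob_form0 //; lia.
have [c cE] := gbang_build (n := - m + l) (fun j i e => projT1 (cid (ex j i e))).
exists c => i j e a; rewrite gsliceE cE; exact: (projT2 (cid (ex j i e))).
Qed.

(** The coproduct is [(1 (x) mu)(c (x) 1)] for the copairing [c] of
    [copairing_exists]. *)
Lemma comul_exists : exists lam : ghom A (gbang A A) l,
  comul_adjoint (CoFrobData mu lam eta eps).
Proof.
have [c0 c0E] := copairing_exists.
(* [c0] as a homogeneous map out of the ground field: multiples of [c0] in its own
   degree, zero in the others. *)
have cP (i j : int) : exists h : chom (gunit k i) (gbang A A j),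
    forall e : - m + l = j, forall x, h x = gunit_val x *: ecast z (gbang A A z) e c0.
  have [e|ne] := eqVneq (- m + l) j; last by exists 0 => e; rewrite e eqxx in ne.
  have lc : linear (fun x : gunit k i => gunit_val x *: ecast z (gbang A A z) e c0).
    by move=> b x y; rewrite scalerA -scalerDl.
  have [h hE] := gunit_chom_ex lc.
  by exists h => e' x; rewrite hE (int_eq_irr e' e).
pose c : ghom (gunit k) (gbang A A) (- m + l) := GHom (fun i j _ => projT1 (cid (cP i j))).
have cE : copair_elt c = c0.
  by rewrite /copair_elt /= (projT2 (cid (cP 0 (- m + l))) erefl) gunit_val1 scale1r.
pose X := (gid A !og mu) \og bang_star A A A \og (c *og gid A) \og star_lunit A.
have eX (i j : int) : i + l = j -> i + (0 + (- m + l + 0 + (0 + (0 + m)))) = j by lia.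
exists (GHom (fun i j e => X i j (eX i j e))) => i j n q i1 e eq ei a b.
have e1 : i + i1 + m = l by lia.
have e2 : i1 + i = - m + l by lia.
rewrite (copair_mul cA mu c _ e2 e) cE c0E gmulZl signZ; congr (_ *: _).
have -> : i1 = l - m - i by lia.
by apply: sign_eq; sign_parity.
Qed.

Lemma comul_unique (lam lam' : ghom A (gbang A A) l) :
  comul_adjoint (CoFrobData mu lam eta eps) -> comul_adjoint (CoFrobData mu lam' eta eps) ->
  lam = lam'.
Proof.
move=> adj adj'; apply: ghom_ext => j q e e'; apply: chom_ext => x.
apply: (form_slices_ext efA) => // i n e1 a; have e2 : i + j + m = n by lia.
by rewrite (int_eq_irr e' e); apply: etrans (adj _ _ _ _ _ e2 e e1 a x) (esym (adj' _ _ _ _ _ e2 e e1 a x)).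
Qed.

End CoproductExistence.

(** * Symmetric Frobenius algebras in degree zero *)

Section FrobeniusElements.
Variables (k : fieldType) (A : gspace k) (l : int).
Variable F : frob_data A (- l).

Let mu := frob_mul F.
Let eta : ghom (gunit k) A (- 0) := frob_unit F.
Let eps := frob_counit F.

Local Notation form := (frob_form mu eps).

Lemma pair_fun_frob (i j : int) (a : A i) :
  pair_fun (frob_pairing F) a j = (-1) ^ l *: form a j.
Proof.
apply: chom_ext => b; rewrite scale_chomE scalars_scaleE -(pair_funE (frob_pairing F) erefl erefl).
have e1 : i + j + 0 = i + j + 0 by [].
have e2 : i + j + 0 + - l = i + j + (0 + - l) by lia.
rewrite /frob_pairing gscaleE gunit_valZ (gcompE _ _ _ e1 e2) counit_funE.
rewrite (gmulE _ _ _ e1) (frob_formE mu eps); congr (_ * _); apply: sign_eq; sign_parity.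
Qed.

Lemma triple_pairing (i j q p n n' p1 : int) (e1 : i + j = p) (e2 : p + q = n)
    (e3 : i + j + 0 = p1) (e : n + (0 + 0 + (0 + - l)) = n') a b c :
  gunit_val ((frob_pairing F \og (mu *og gid A)) n n' e (gstar_tens e2 (gstar_tens e1 a b) c)) =
  (-1) ^ l * form (gmul mu e3 a b) q c.
Proof.
have f1 : n + (0 + 0) = n by lia.
have f2 : n + (0 + - l) = n' by lia.
have f3 : p + 0 = p1 by lia.
have f4 : q + 0 = q by lia.
have f5 : p1 + q = n by lia.
rewrite (gcompE (frob_pairing F) (mu *og gid A) e f1 f2).
apply: etrans (congr1 (fun z => gunit_val (frob_pairing F _ _ f2 z))
  (gstar_mapE mu (gid A) f1 e2 f5 f3 f4 _ _)) _.
rewrite gidE mul0r expr0z scale1r.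
rewrite (pair_funE (frob_pairing F)) pair_fun_frob scale_chomE scalars_scaleE.
by rewrite (gmulE _ _ _ e3).
Qed.

Lemma form_assoc : star_associative mu -> forall (i j q p1 p2 : int)
    (e1 : i + j + 0 = p1) (e2 : j + q + 0 = p2) (a : A i) (b : A j) (c : A q),
  form (gmul mu e1 a b) q c = form a p2 (gmul mu e2 b c).
Proof.
move=> /star_associativeP H i j q p1 p2 e1 e2 a b c.
have f1 : p1 + q + 0 = i + p2 + 0 by lia.
by rewrite -(frob_formE _ _ f1) -(frob_formE _ _ erefl) (H _ _ _ _ _ _ e1 f1 e2 erefl) mul0r expr0z scale1r.
Qed.

(** Putting the unit in the first place of the cyclic identity gives the symmetry
    of the form; conversely [(c a, b) = (c, a b) = (a b, c)] up to sign. *)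
Lemma cyclicP : star_associative mu -> star_unit mu eta ->
  cyclic (frob_pairing F \og (mu *og gid A)) <->
  forall (i j : int) (a : A i) (b : A j),
    form a j b = (-1) ^ (0 + i * j) * (form b i a : k) :> k.
Proof.
move=> Ha Hu; have Hass := form_assoc Ha.
have [Hl Hr] := (star_unitP _ _).1 Hu.
split=> [H i j a b|H i j q p r n n' e1 e2 e3 e4 e a b c].
  have f1 : 0 + i = i by lia.
  have f2 : j + 0 = j by lia.
  have f3 : j + i = i + j by lia.
  have f4 : i + j + (0 + 0 + (0 + - l)) = i + j - l by lia.
  have g1 : 0 + i + 0 = i by lia.
  have g2 : j + 0 + 0 = j by lia.
  have := congr1 (@gunit_val _ _) (H _ _ _ _ _ _ _ f1 erefl f2 f3 f4 (unit_elt eta) a b).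
  rewrite gunit_valZ (triple_pairing _ _ g2) (triple_pairing _ _ g1).
  rewrite Hl (Hr j g2) 2!frob_formZl expr0z mul0r expr0z !mul1r mulrCA => H1.
  have {}H1 := congr1 (fun x => (-1) ^ l * x) H1.
  by move: H1; rewrite !sign_mulK add0r => H1; rewrite add0r H1.
apply: gunit_inj; rewrite gunit_valZ.
have g1 : i + j + 0 = p by lia.
have g2 : q + i + 0 = r by lia.
rewrite (triple_pairing _ _ g2) (triple_pairing _ _ g1) mulrCA; congr (_ * _).
rewrite (Hass _ _ _ _ _ g2 g1) (H p q) add0r; congr (_ * _).
by rewrite e1.
Qed.

End FrobeniusElements.

Section FrobeniusEquivalence.
Variables (k : fieldType) (A : gspace k) (l : int).
Variable F : frob_data A (- l).

Let mu := frob_mul F.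
Let eta : ghom (gunit k) A (- 0) := frob_unit F.
Let eps := frob_counit F.

Local Notation form := (frob_form mu eps).

Lemma perfect_elt : perfect (frob_pairing F) ->
  (forall i j : int, i + j + 0 = l ->
    exists phi : chom (dual (A j)) (A i), forall (f : chom (A j) (scalars k)) b,
      form (phi f) j b = f b) /\
  (forall (i : int) (a : A i), (forall (j : int) (b : A j), form a j b = 0) -> a = 0).
Proof.
move=> [P [PE Piso]].
have PF (i j : int) (e : i + (0 + - l) = j) (a : A i) (b : A (- j)) :
    (P i j e a : chom (A (- j)) (scalars k)) b = (-1) ^ l * (form a (- j) b : k) :> k.
  have e2 : i + - j + (0 + - l) = 0 by lia.
  rewrite (PE _ _ _ _ e erefl e2) (pair_funE (frob_pairing F)) pair_fun_frob.
  by rewrite scale_chomE scalars_scaleE.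
split=> [i j|i a a0].
  (* The graded dual in degree [j] is the dual of [A] in degree [- j]. *)
  have -> : j = - (- j) by lia.
  move: (- j) => {}j ijl.
  have e : i + (0 + - l) = j by lia.
  have [lP _ [g [Pg gP cg]]] := Piso i j e.
  have lg : linear g by move=> c x y; apply: (can_inj Pg); rewrite lP !gP.
  pose phi := mk_chom (conj lg cg : cont_linear g).
  have phiE f : phi f = g f by exact: mk_chomE.
  exists ((-1) ^ l *: phi) => f b.
  by rewrite scale_chomE phiE frob_formZl -(PF _ _ e) gP.
have [lP _ [g [Pg _ _]]] := Piso i (i + (0 + - l)) erefl.
apply: (can_inj Pg); apply: chom_ext => b.
by rewrite PF a0 mulr0 (linf0 lP) zero_chomE.
Qed.

Lemma form_chom (i j : int) : exists P : chom (A i) (dual (A j)), forall a, P a = (-1) ^ l *: form a j.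
Proof.
have H a b : gunit_val (frob_pairing F (i + j) _ erefl (gstar_tens erefl a b)) =
  (-1) ^ l * (form a j b : k).
  by rewrite (pair_funE (frob_pairing F)) pair_fun_frob scale_chomE scalars_scaleE.
pose h := chom_comp (gunit_valc k _) (frob_pairing F (i + j) _ erefl).
have hE a b : h (gstar_tens erefl a b) = ((-1) ^ l *: form a j : chom (A j) (scalars k)) b.
  by rewrite scale_chomE scalars_scaleE -H /h chom_compE gunit_valcE.
apply: pairing_chom => [|W oW].
  have [tl tr] := @gstar_tens_bilinear k A A i j _ erefl; split=> [b|a] c x y.
    by rewrite -!hE tl chom_linear.
  by rewrite -!hE tr chom_linear.
have [U [oU UW]] := chom_open h oW.
have [[V [Z [oV oZ VZ]]] L R] := gstar_tens_cont erefl oU; split=> [|a|b].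
- by exists V, Z; split=> // u v Vu Zv; rewrite -hE; apply: UW; apply: VZ.
- by have [X [oX XP]] := L a; exists X; split=> // v Xv; rewrite -hE; apply: UW; apply: XP.
- by have [X [oX XP]] := R b; exists X; split=> // v Xv; rewrite -hE; apply: UW; apply: XP.
Qed.

Lemma elt_perfect : elt_frobenius mu eta eps -> perfect (frob_pairing F).
Proof.
move=> ef.
exists (GHom (fun i j e => projT1 (cid (form_chom i (- j))))).
have PE (i j : int) (a : A i) : projT1 (cid (form_chom i (- j))) a = (-1) ^ l *: form a (- j) :=
  projT2 (cid (form_chom i (- j))) a.
split=> [i j n n' e e1 e2 a b|i j e] /=.
  by rewrite PE (pair_funE (frob_pairing F)) pair_fun_frob.
have [lP cP] := chomP (projT1 (cid (form_chom i (- j)))).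
split=> //.
have ijl : i + - j + 0 = l by lia.
have [phi phiE] := ef_dual ef ijl.
have [lphi cphi] := chomP ((-1) ^ l *: phi : chom _ _).
exists ((-1) ^ l *: phi : chom _ _); split=> // [a|f].
  apply: (form_inj_l ef) => r b; rewrite scale_chomE frob_formZl.
  have [rj|/eqP nr] := eqVneq r (- j).
    by move: b; rewrite rj => b; rewrite phiE PE scale_chomE scalars_scaleE sign_mulK.
  by rewrite !frob_form0 ?mulr0 //; lia.
rewrite PE scale_chomE; apply: chom_ext => b.
by rewrite scale_chomE scalars_scaleE frob_formZl sign_mulK phiE.
Qed.

(** A topological isomorphism onto the dual is a continuous right inverse of the
    form together with non-degeneracy, the continuity of the form being automatic. *)
Lemma frobenius_eltP : is_frobenius F <-> elt_frobenius mu eta eps.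
Proof.
split=> [[Ha Hu Hp Hc]|ef].
  have [dl nd] := perfect_elt Hp.
  have [Hl Hr] := (star_unitP mu eta).1 Hu.
  split=> //; first exact: (star_associativeP _).1.
  exact: (cyclicP Ha Hu).1.
have Ha : star_associative mu := (star_associativeP _).2 (ef_assoc ef).
have Hu : star_unit mu eta.
  by apply/star_unitP; split; [exact: ef_unit_l ef|exact: ef_unit_r ef].
split=> //; first exact: elt_perfect.
exact: (cyclicP Ha Hu).2 (ef_sym ef).
Qed.

End FrobeniusEquivalence.

Section DegreeZero.
Variables (k : fieldType) (A : gspace k) (l : int).
Hypothesis tA : gtate A.

Lemma cofrobenius_frobenius (S : cofrob_data A 0 l) :
  is_cofrobenius S -> is_frobenius (frob_of_cofrob S).
Proof.
by move=> /(cofrobenius_elt tA)[ef _]; exact: (frobenius_eltP (frob_of_cofrob S)).2 ef.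
Qed.

Lemma frobenius_cofrobenius (F : frob_data A (- l)) : is_frobenius F ->
  exists! S : cofrob_data A 0 l, is_cofrobenius S /\ frob_of_cofrob S = F.
Proof.
case: F => mu eta eps FF.
have ef : elt_frobenius mu (eta : ghom _ _ (- 0)) eps := (frobenius_eltP (FrobData mu eta eps)).1 FF.
have [lam adj] := comul_exists tA ef.
exists (CoFrobData mu lam (eta : ghom _ _ (- 0)) eps); split.
  split=> //; exact: elt_cofrobenius.
move=> [mu' lam' eta' eps'] [CS [emu eeta eeps]].
subst mu' eta' eps'.
by have [_ adj'] := cofrobenius_elt tA CS; rewrite (comul_unique tA ef adj adj').
Qed.

End DegreeZero.

(** * Regrading *)

Section Regrading.
Variables (k : fieldType) (A : gspace k) (m : int).

Local Notation B := (shift A m).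
Local Notation T := (to_shift A m).

(** Lets composites whose degrees are equal but written differently be compared
    without transport of elements. *)
Definition regrade (C D : gspace k) d d' (e : d = d') (f : ghom C D d) : ghom C D d' :=
  GHom (fun i j e' => f i j (etrans (congr1 (+%R i) e) e')).

Lemma regradeE (C D : gspace k) d d' (e : d = d') (f : ghom C D d) (i j : int)
    (e1 : i + d' = j) (e2 : i + d = j) x : regrade e f i j e1 x = f i j e2 x.
Proof. by congr (chom_fun (f i j _) x); exact: int_eq_irr. Qed.

Definition from_shift : ghom B A (- m) := GHom (fun i j e => chom_cast A e).

Local Notation U := from_shift.

Lemma to_shiftE (i i' : int) (e : i + m = i') (c : i = i' - m) a :
  T i i' e a = chom_cast A c a.
Proof. by congr (chom_fun (chom_cast A _) a); exact: int_eq_irr. Qed.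

Lemma from_shiftK (i i' : int) (e : i + m = i') (e' : i' + - m = i) a :
  U i' i e' (T i i' e a) = a.
Proof.
rewrite (to_shiftE e (esym e')) /from_shift /= => {e}.
by case: _ / e' a.
Qed.

Lemma to_shiftK (i i' : int) (e : i + m = i') (e' : i' + - m = i) x :
  T i i' e (U i' i e' x) = x.
Proof. by rewrite (to_shiftE e (esym e')) /from_shift /= => {e}; case: _ / e'. Qed.

Lemma to_shift_inj (i i' : int) (e : i + m = i') : injective (T i i' e).
Proof.
have e' : i' + - m = i by lia.
exact: can_inj (from_shiftK e e').
Qed.

(** The shift in degree [i'] is by definition [A] in degree [i' - m]; this lemma
    lets any element of the shift be written as an image. *)
Lemma to_shift_id (i' : int) (e : i' - m + m = i') (x : A (i' - m)) : T (i' - m) i' e x = x.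
Proof. by rewrite (to_shiftE e erefl). Qed.

End Regrading.

Arguments from_shift {k} A m.

Section ShiftRelations.
Variables (k : fieldType) (A : gspace k) (m l : int).
Hypothesis tA : gtate A.

Let cA i : sep_complete (A i) := tate_complete (tA i).

Local Notation B := (shift A m).
Local Notation T := (to_shift A m).
Local Notation U := (from_shift A m).

Variables (mu : ghom (gstar A A) A m) (muB : ghom (gstar B B) B 0).

(** The sign is that of moving the regrading of [b] past [a]. *)
Definition mul_shifted := forall (i j n i' j' n' : int) (ei : i + m = i') (ej : j + m = j')
    (en : n + m = n') (e : i' + j' + 0 = n') (e' : i + j + m = n) a b,
  gmul muB e (T i i' ei a) (T j j' ej b) = (-1) ^ (m * i) *: T n n' en (gmul mu e' a b).

Lemma mul_shiftedP : (muB \og (T *og T) =g T \og mu) <-> mul_shifted.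
Proof.
split=> [H i j n i' j' n' ei ej en e e' a b|H n n' e e'].
  have e1 : i + j + (m + m + 0) = n' by lia.
  have e2 : i + j + (m + m) = n' by lia.
  have e3 : i + j + (m + m) = i' + j' by lia.
  have := congr1 (fun h : chom _ _ => h (gstar_tens erefl a b)) (H _ _ e1 e2).
  rewrite (gcompE _ _ _ e3 e) (gcompE _ _ _ e' en) (gstar_mapE _ _ _ erefl erefl ei ej).
  rewrite (gmulE _ _ _ e') chomZ (gmulE _ _ _ e) => <-; by rewrite signK.
apply: chom_ext; apply: gstar_eq => [|i j e0 a b]; first by have [] := cA (n' - m).
have e1 : n + (m + m) = i + m + (j + m) by lia.
have e2 : i + m + (j + m) + 0 = n' by lia.
have e3 : n' - m + m = n' by lia.
have e4 : n + m = n' - m by lia.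
have e5 : i + j + m = n' - m by lia.
rewrite (gcompE _ _ _ e1 e2) (gcompE _ _ _ e4 e3) (gstar_mapE _ _ _ e0 erefl erefl erefl).
by rewrite (gmulE _ _ _ e5) chomZ (gmulE _ _ _ e2) (H _ _ _ _ _ _ _ _ e3 _ e5) signK.
Qed.

Variables (eta : ghom (gunit k) A (- m)) (etaB : ghom (gunit k) B (- 0)).
Variables (eps : ghom A (gunit k) (- l)) (epsB : ghom B (gunit k) (- (l + m))).

Hypothesis mulP : mul_shifted.
Hypothesis unitP : (etaB : ghom _ _ 0) =g T \og eta.
Hypothesis counitP : epsB \og T =g eps.

Local Notation form := (frob_form mu eps).
Local Notation formB := (frob_form muB epsB).

Lemma unit_shifted (e : - m + m = 0) : unit_elt etaB = T (- m) 0 e (unit_elt eta).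
Proof.
have e1 : 0 + (- m + m) = 0 by lia.
have e2 : 0 + - m = - m by lia.
rewrite -(unit_eltE eta e2) -(gcompE T eta e1) -(unitP (addr0 0)).
by rewrite -(unit_eltE etaB (addr0 0)).
Qed.

Lemma counit_shifted (i i' : int) (e : i + m = i') a :
  counit_fun epsB i' (T i i' e a) = counit_fun eps i a.
Proof.
have e1 : i + (m + - (l + m)) = i - l by lia.
have e2 : i' + - (l + m) = i - l by lia.
by rewrite -(counit_funE epsB e2) -(gcompE epsB T e1) (counitP e1 erefl) (counit_funE eps).
Qed.

Lemma form_shifted (i j i' j' : int) (ei : i + m = i') (ej : j + m = j') a b :
  formB (T i i' ei a) j' (T j j' ej b) = (-1) ^ (m * i) * (form a j b : k) :> k.
Proof.
have e1 : i' + j' + 0 = i + j + m + m by lia.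
rewrite -(frob_formE muB epsB e1) -(frob_formE mu eps erefl) (mulP _ _ erefl _ erefl) chomZ.
by rewrite scalars_scaleE counit_shifted.
Qed.

(** Each condition on one side, taken on images under the regrading, is the
    corresponding condition on the other side multiplied by a sign. *)
Lemma elt_frobenius_shifted : elt_frobenius mu eta eps <-> elt_frobenius muB etaB epsB.
Proof.
have mT : - m + m = 0 by lia.
split=> ef; split.
- move=> i j q p1 p2 n e1 e2 e3 e4 a b c.
  have e (r : int) : r - m + m = r by lia.
  have f1 : i - m + (j - m) + m = p1 - m by lia.
  have f2 : p1 - m + (q - m) + m = n - m by lia.
  have f3 : j - m + (q - m) + m = p2 - m by lia.
  have f4 : i - m + (p2 - m) + m = n - m by lia.
  rewrite -(to_shift_id (e i) a) -(to_shift_id (e j) b) -(to_shift_id (e q) c).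
  rewrite (mulP _ _ (e p1) _ f1) (mulP _ _ (e p2) _ f3) gmulZl gmulZr.
  rewrite (mulP _ _ (e n) _ f2) (mulP _ _ (e n) _ f4) (ef_assoc ef _ _ f3 f4) chomZ !signZ.
  by apply: scale_sign; rewrite -f1; sign_parity.
- move=> i e a.
  have ei : i - m + m = i by lia.
  have f : - m + (i - m) + m = i - m by lia.
  rewrite (unit_shifted mT) -(to_shift_id ei a) (mulP _ _ ei _ f) (ef_unit_l ef) chomZ signZ.
  by apply: scale_sign; sign_parity.
- move=> i e a.
  have ei : i - m + m = i by lia.
  have f : i - m + - m + m = i - m by lia.
  rewrite (unit_shifted mT) -(to_shift_id ei a) (mulP _ _ ei _ f) (ef_unit_r ef) chomZ signZ.
  by apply: scale_sign; sign_parity.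
- move=> i j a b.
  have e (r : int) : r - m + m = r by lia.
  rewrite -(to_shift_id (e i) a) -(to_shift_id (e j) b).
  rewrite (form_shifted (e i) (e j)).
  rewrite (form_shifted (e j) (e i)).
  rewrite [form _ _ _](ef_sym ef).
  rewrite [LHS]mulrA [RHS]mulrA.
  congr (_ * _).
  rewrite [LHS]signD [RHS]signD.
  by apply: sign_eq; sign_parity.
- move=> i j ijl.
  have e (r : int) : r - m + m = r by lia.
  have f : i - m + (j - m) + m = l by lia.
  have [phi phiE] := ef_dual ef f.
  exists ((-1) ^ (m * (i - m)) *: (phi : chom (dual (B j)) (B i))) => g b.
  rewrite scale_chomE frob_formZl -(to_shift_id (e i) (phi g)) -{1}(to_shift_id (e j) b).
  by rewrite form_shifted sign_mulK phiE.
- move=> i a H.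
  have e (r : int) : r - m + m = r by lia.
  apply: (ef_nondeg ef) => j b.
  have := H (j + m) (T j (j + m) erefl b).
  rewrite -{1}(to_shift_id (e i) a) form_shifted => /(congr1 (fun x => (-1) ^ (m * (i - m)) * x)).
  by rewrite sign_mulK mulr0.
- move=> i j q p1 p2 n e1 e2 e3 e4 a b c.
  have f1 : i + m + (j + m) + 0 = p1 + m by lia.
  have f2 : p1 + m + (q + m) + 0 = n + m by lia.
  have f3 : j + m + (q + m) + 0 = p2 + m by lia.
  have f4 : i + m + (p2 + m) + 0 = n + m by lia.
  apply: (@to_shift_inj _ _ _ n (n + m) erefl).
  have := ef_assoc ef f1 f2 f3 f4 (T i _ erefl a) (T j _ erefl b) (T q _ erefl c).
  rewrite (mulP _ _ erefl f1 e1) (mulP _ _ erefl f3 e3) gmulZl gmulZr.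
  rewrite (mulP _ _ erefl f2 e2) (mulP _ _ erefl f4 e4) !signZ chomZ => H.
  rewrite -[LHS](signK (m * i + m * p1)) H signZ.
  by apply: scale_sign; rewrite -e1; sign_parity.
- move=> i e a; apply: (@to_shift_inj _ _ _ i (i + m) erefl).
  have f : - 0 + (i + m) + 0 = i + m by lia.
  have := ef_unit_l ef f (T i _ erefl a).
  rewrite (unit_shifted mT) (mulP _ _ erefl f e) => H.
  rewrite -[LHS](signK (m * - m)) H signZ chomZ.
  by apply: scale_sign; sign_parity.
- move=> i e a; apply: (@to_shift_inj _ _ _ i (i + m) erefl).
  have f : i + m + - 0 + 0 = i + m by lia.
  have := ef_unit_r ef f (T i _ erefl a).
  rewrite (unit_shifted mT) (mulP _ _ erefl f e) => H.
  rewrite -[LHS](signK (m * i)) H signZ chomZ.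
  by apply: scale_sign; sign_parity.
- move=> i j a b.
  have := ef_sym ef (T i _ erefl a) (T j _ erefl b).
  rewrite !form_shifted => /(congr1 (fun x => (-1) ^ (m * i) * x)).
  rewrite sign_mulK => ->; rewrite !mulrA !signD.
  by congr (_ * _); apply: sign_eq; sign_parity.
- move=> i0 j0.
  have -> : i0 = i0 + m - m by lia.
  have -> : j0 = j0 + m - m by lia.
  move: (i0 + m) (j0 + m) => {i0 j0} i j ijl.
  have e (r : int) : r - m + m = r by lia.
  have f : i + j + 0 = l + m by lia.
  have [phi phiE] := ef_dual ef f.
  exists ((-1) ^ (m * (i - m)) *: (phi : chom (dual (A (j - m))) (A (i - m)))) => g b.
  rewrite scale_chomE frob_formZl -(form_shifted (e i) (e j)).
  by rewrite !to_shift_id; exact: phiE.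
- move=> i a H; apply: (@to_shift_inj _ _ _ i (i + m) erefl).
  rewrite chom0; apply: (ef_nondeg ef) => j b.
  have e : j - m + m = j by lia.
  by rewrite -(to_shift_id e b) form_shifted H mulr0.
Qed.

End ShiftRelations.

Section ShiftTheorem.
Variables (k : fieldType) (A : gspace k) (m l : int).
Hypothesis tA : gtate A.

Let cA i : sep_complete (A i) := tate_complete (tA i).

Local Notation B := (shift A m).
Local Notation T := (to_shift A m).
Local Notation U := (from_shift A m).

Lemma shift_related_elt (S : cofrob_data A m l) (F : frob_data B (- (l + m))) :
  shift_related S F ->
  (elt_frobenius (cofrob_mul S) (cofrob_unit S) (cofrob_counit S) <->
   elt_frobenius (frob_mul F) (frob_unit F : ghom _ _ (- 0)) (frob_counit F)).
Proof.
by move=> [/(mul_shiftedP tA) R1 R2 R3]; exact: (elt_frobenius_shifted R1 R2 R3).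
Qed.

Lemma shift_frob_exists (S : cofrob_data A m l) :
  exists F : frob_data B (- (l + m)), shift_related S F.
Proof.
case: S => mu lam eta eps.
have d1 : - m + - m + (m + m) = 0 by lia.
have d2 : - m + m = 0 by lia.
have d3 : - m + - l = - (l + m) by lia.
(* [(U (x) U)(T (x) T)] is [(-1)^m], which the scalar compensates. *)
exists (FrobData (regrade d1 ((-1) ^ m *g (T \og mu \og (U *og U))))
  (regrade d2 (T \og eta)) (regrade d3 (eps \og U))); split=> /=.
- apply/(mul_shiftedP tA) => i j n i' j' n' ei ej en e e' a b.
  have f1 : i' + j' + (- m + - m + (m + m)) = n' by lia.
  have f2 : i' + j' + (- m + - m) = i + j by lia.
  have f3 : i + j + (m + m) = n' by lia.
  have g1 : i' + - m = i by lia.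
  have g2 : j' + - m = j by lia.
  rewrite /gmul (regradeE _ _ _ f1) gscaleE (gcompE _ _ _ f2 f3) (gcompE _ _ _ e' en).
  rewrite (gstar_mapE _ _ _ erefl erefl g1 g2) (from_shiftK ei g1) (from_shiftK ej g2).
  rewrite [mu _ _ _ _]chomZ [T _ _ _ _]chomZ signZ.
  by apply: scale_sign; rewrite -ei; sign_parity.
- apply: geqP => i j e e' x; exact: regradeE.
- apply: geqP => i j e e' x.
  have f1 : i + m + (- m + - l) = j by lia.
  have f2 : i + m + - (l + m) = j by lia.
  have f3 : i + m + - m = i by lia.
  by rewrite (gcompE _ _ _ erefl f2) (regradeE _ _ _ f1) (gcompE _ _ _ f3 e') from_shiftK.
Qed.

Lemma shift_frob_unique (S : cofrob_data A m l) (F F' : frob_data B (- (l + m))) :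
  shift_related S F -> shift_related S F' -> F = F'.
Proof.
case: S F F' => mu lam eta eps [muF etaF epsF] [muF' etaF' epsF'] /=.
move=> [/(mul_shiftedP tA) /= R1 /= R2 /= R3] [/(mul_shiftedP tA) /= R1' /= R2' /= R3'].
congr FrobData; apply: ghom_ext => i j e e'; rewrite (int_eq_irr e' e) {e'}; apply: chom_ext => x.
- move: x; apply: gstar_eq => [|p q epq a b]; first by have [] := cA (j - m).
  have f (r : int) : r - m + m = r by lia.
  have e1 : p + q + 0 = j by lia.
  have e2 : p - m + (q - m) + m = j - m by lia.
  rewrite (gmulE _ _ _ e1) (gmulE muF' _ _ e1) -(to_shift_id (f p) a) -(to_shift_id (f q) b).
  by rewrite (R1 _ _ _ _ _ _ (f p) (f q) (f j) e1 e2) (R1' _ _ _ _ _ _ (f p) (f q) (f j) e1 e2).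
- have f : i + (- m + m) = j by lia.
  by rewrite (R2 _ _ e f) (R2' _ _ e f).
- have f : i - m + m = i by lia.
  have g : i - m + (m + - (l + m)) = j by lia.
  have h : i - m + - l = j by lia.
  rewrite -(to_shift_id f x) -(gcompE _ _ g f e) -(gcompE _ _ g f e).
  by rewrite (R3 _ _ g h) (R3' _ _ g h).
Qed.

Lemma shift_cofrob_exists (F : frob_data B (- (l + m))) :
  exists (mu : ghom (gstar A A) A m) (eta : ghom (gunit k) A (- m)) (eps : ghom A (gunit k) (- l)),
    forall lam, shift_related (CoFrobData mu lam eta eps) F.
Proof.
case: F => muF etaF epsF.
have d1 : m + m + 0 + - m = m by lia.
have d2 : 0 + - m = - m by lia.
have d3 : m + - (l + m) = - l by lia.
exists (regrade d1 (U \og (muF \og (T *og T)))), (regrade d2 (U \og etaF)), (regrade d3 (epsF \og T)).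
move=> lam; split=> /=.
- apply: geqP => i j e e' x.
  have f1 : i + (m + m + 0 + - m) = j - m by lia.
  have f2 : i + m = j - m by lia.
  have f3 : j - m + m = j by lia.
  have f4 : j + - m = j - m by lia.
  by rewrite (gcompE _ _ _ f2 f3) (regradeE _ _ _ f1) (gcompE _ _ _ e f4) to_shiftK.
- apply: geqP => i j e e' x.
  have f1 : i + (0 + - m) = j - m by lia.
  have f2 : i + - m = j - m by lia.
  have f3 : j - m + m = j by lia.
  have f4 : j + - m = j - m by lia.
  by rewrite (gcompE _ _ _ f2 f3) (regradeE _ _ _ f1) (gcompE _ _ _ e f4) to_shiftK.
- by apply: geqP => i j e e' x; apply/esym; exact: regradeE.
Qed.

Lemma shift_cofrob_unique (F : frob_data B (- (l + m)))
    (mu mu' : ghom (gstar A A) A m) (lam lam' : ghom A (gbang A A) l)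
    (eta eta' : ghom (gunit k) A (- m)) (eps eps' : ghom A (gunit k) (- l)) :
  shift_related (CoFrobData mu lam eta eps) F -> shift_related (CoFrobData mu' lam' eta' eps') F ->
  [/\ mu = mu', eta = eta' & eps = eps'].
Proof.
move=> [/= R1 R2 R3] [/= R1' R2' R3'].
split; apply: ghom_ext => i j e e'; rewrite (int_eq_irr e' e) {e'}; apply: chom_ext => x.
- have f1 : i + (m + m) = j + m by lia.
  have f2 : i + (m + m + 0) = j + m by lia.
  apply: (@to_shift_inj _ _ _ j (j + m) erefl).
  by rewrite -(gcompE T mu f1) -(gcompE T mu' f1) -(R1 _ _ f2 f1) -(R1' _ _ f2 f1).
- have f1 : i + (- m + m) = j + m by lia.
  have f2 : i + 0 = j + m by lia.
  apply: (@to_shift_inj _ _ _ j (j + m) erefl).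
  by rewrite -(gcompE T eta f1) -(gcompE T eta' f1) -(R2 _ _ f2 f1) -(R2' _ _ f2 f1).
- have f : i + (m + - (l + m)) = j by lia.
  by rewrite -(R3 _ _ f e) -(R3' _ _ f e).
Qed.

Lemma cofrobenius_shift (S : cofrob_data A m l) : is_cofrobenius S ->
  exists! F : frob_data B (- (l + m)), is_frobenius F /\ shift_related S F.
Proof.
move=> CS; have [F SF] := shift_frob_exists S; exists F; split.
  split=> //; apply/frobenius_eltP/(shift_related_elt SF).
  by have [] := cofrobenius_elt tA CS.
by move=> F' [_ SF']; exact: shift_frob_unique SF SF'.
Qed.

Lemma frobenius_unshift (F : frob_data B (- (l + m))) : is_frobenius F ->
  exists! S : cofrob_data A m l, is_cofrobenius S /\ shift_related S F.
Proof.
move=> FF; have [mu [eta [eps R]]] := shift_cofrob_exists F.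
have ef : elt_frobenius mu eta eps := (shift_related_elt (R (GHom (fun _ _ _ => 0)))).2 ((frobenius_eltP F).1 FF).
have [lam adj] := comul_exists tA ef.
exists (CoFrobData mu lam eta eps); split.
  by split; [exact: elt_cofrobenius|exact: R].
move=> [mu' lam' eta' eps'] [CS SF].
have [emu eeta eeps] := shift_cofrob_unique SF (R lam).
subst mu' eta' eps'.
by have [_ adj'] := cofrobenius_elt tA CS; rewrite (comul_unique tA ef adj adj').
Qed.

End ShiftTheorem.

Theorem proposition5p14 (k : fieldType) (A : gspace k) (hA : gtate A) :
  (* products of degree zero: forgetting the coproduct is a bijection from
     biunital coFrobenius structures to symmetric Frobenius structures on A *)
  (forall l : int,
     (forall S : cofrob_data A 0 l,
        is_cofrobenius S -> is_frobenius (frob_of_cofrob S)) /\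
     (forall F : frob_data A (- l), is_frobenius F ->
        exists! S : cofrob_data A 0 l,
          is_cofrobenius S /\ frob_of_cofrob S = F)) /\
  (* products of arbitrary degree m: the same after shifting A by m *)
  (forall m l : int,
     (forall S : cofrob_data A m l, is_cofrobenius S ->
        exists! F : frob_data (shift A m) (- (l + m)),
          is_frobenius F /\ shift_related S F) /\
     (forall F : frob_data (shift A m) (- (l + m)), is_frobenius F ->
        exists! S : cofrob_data A m l,
          is_cofrobenius S /\ shift_related S F)).
Proof.
split=> [l|m l]; split.
- exact: cofrobenius_frobenius.
- exact: frobenius_cofrobenius.
- exact: cofrobenius_shift.
- exact: frobenius_unshift.
Qed.
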